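(* Let $\zeta\ge0$ and $\kappa\ge0$ satisfy $8\zeta+3\kappa<1$ and $\zeta+3\kappa<1$. Let $\{Z_n\}_{n\in\mathbb{N}}$ be a sequence of diagonal matrices $Z_n=\mathrm{diag}(z_1^{(n)},\ldots,z_n^{(n)})$ with $z_j^{(n)}\geq1$ having bounded squeezing of degree $\zeta$, such that the average energy $\lambda(n)=\frac{1}{2n}\sum_{j=1}^n(z_j^{(n)}+1/z_j^{(n)})$ is uniformly bounded in $n$ and satisfies $\lambda(n)\ge\mu$ for all $n$, for some $\mu>1$. Let $\{k_n\}_{n\in\mathbb{N}}$ be a sequence of subsystem sizes bounded of degree $\kappa$. Let $U$ be drawn from the Haar measure on $U(n)$ and let $S(M_{n,k_n})$ denote the von Neumann entropy of the reduced $k_n$-mode Gaussian state with covariance matrix $M_{n,k_n}(U)$. Then there are constants $C,c>0$ such that for every $\epsilon>0$ with $C\beta(\mu)n^{(\zeta+3\kappa-1)/2}<\epsilon$, $$\Pr\Big\{\big|k_nG(\lambda(n))-S(M_{n,k_n})\big|\le\epsilon\Big\}\ge1-\exp\Big(-c\,\frac{\epsilon^4}{\beta(\mu)^4}\,n^{1-8\zeta-3\kappa}\Big).$$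
   Context: $J_k=\begin{pmatrix}0_k&-I_k\\ I_k&0_k\end{pmatrix}$. For $U\in U(n)$, $\eta(U)=\begin{pmatrix}\mathrm{Re}(U)&\mathrm{Im}(U)\\ -\mathrm{Im}(U)&\mathrm{Re}(U)\end{pmatrix}$, $M_n(U)=\eta(U)(Z_n\oplus Z_n^{-1})\eta(U)^T$, and $M_{n,k}(U)$ is the $2k\times2k$ submatrix of $M_n(U)$ with rows and columns indexed by $\{1,\ldots,k\}\cup\{n+1,\ldots,n+k\}$. If $\lambda_1,\ldots,\lambda_k\ge1$ are the symplectic eigenvalues of a $2k\times 2k$ covariance matrix $M$ (spectrum of $J_kM$ equals $\bigcup_j\{\pm i\lambda_j\}$), then the entropy of the corresponding Gaussian state is $S(M)=\sum_{j=1}^kG(\lambda_j)$, where $G(\lambda)=g((\lambda-1)/2)$ and $g(N)=(N+1)\log(N+1)-N\log N$. $\beta(\lambda)=\log\frac{\lambda+1}{\lambda-1}$ for $\lambda>1$. Bounded squeezing of degree $\zeta$: there is $C>0$ with $\|Z_n\|_\infty\le Cn^\zeta$ for all large $n$. Subsystem sizes $k_n\in\{1,\ldots,n\}$ bounded of degree $\kappa$: there is $K>0$ with $k_n\le Kn^\kappa$ for all large $n$. *)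

(* Defs.v *)
From HB Require Import structures.
From mathcomp Require Import all_boot all_order all_algebra.
From mathcomp Require Import all_classical all_reals all_analysis.
From mathcomp Require Import complex.

Set Implicit Arguments.
Unset Strict Implicit.
Unset Printing Implicit Defensive.

Import Order.TTheory GRing.Theory Num.Theory.
Local Open Scope classical_set_scope.
Local Open Scope ring_scope.

Section Defs.
Variable R : realType.

Definition cmx (n : nat) := 'M[R[i]]_n.
HB.instance Definition _ n := Choice.on (cmx n).
HB.instance Definition _ n := isPointed.Build (cmx n) (0 : 'M[R[i]]_n).

Definition adjc n (U : 'M[R[i]]_n) : 'M[R[i]]_n := (map_mx (@conjc R) U)^T.

Definition unitary n (U : 'M[R[i]]_n) : Prop := U *m adjc U = 1%:M.

(* Borel sigma-algebra on C^{n x n} ~ R^{2 n^2}: generated by the real and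
   imaginary parts of the entries *)
Definition cmx_gen n : set (set (cmx n)) :=
  [set A | exists (i j : 'I_n) (B : set R), measurable B /\
     (A = [set U : cmx n | B (complex.Re (U i j))] \/
      A = [set U : cmx n | B (complex.Im (U i j))])].

Definition cmxMeas n := g_sigma_algebraType (@cmx_gen n).

(* P is the Haar (probability) measure of U(n), viewed as a Borel probability
   measure on C^{n x n}: it is concentrated on U(n) and invariant under left
   multiplication by unitaries.  (This characterizes it uniquely.) *)
Definition haar_prob n (P : probability (cmxMeas n) R) : Prop :=
  P [set U : cmxMeas n | unitary U] = 1%E /\
  forall V : 'M[R[i]]_n, unitary V ->
    forall A : set (cmxMeas n), measurable A ->
      P [set U : cmxMeas n | A (V *m U)] = P A.

Definition eta n (U : 'M[R[i]]_n) : 'M[R]_(n + n) :=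
  block_mx (map_mx (@complex.Re R) U) (map_mx (@complex.Im R) U)
           (- map_mx (@complex.Im R) U) (map_mx (@complex.Re R) U).

Definition Mcov n (Z : 'M[R]_n) (U : 'M[R[i]]_n) : 'M[R]_(n + n) :=
  eta U *m block_mx Z 0 0 (invmx Z) *m (eta U)^T.

Definition sub_idx n k (hk : (k <= n)%N) (i : 'I_(k + k)) : 'I_(n + n) :=
  match fintype.split i with
  | inl a => lshift n (widen_ord hk a)
  | inr b => rshift n (widen_ord hk b)
  end.

Definition subcov n k (hk : (k <= n)%N) (M : 'M[R]_(n + n)) : 'M[R]_(k + k) :=
  \matrix_(i, j) M (sub_idx hk i) (sub_idx hk j).

Definition Mcov_sub n k (hk : (k <= n)%N) (Z : 'M[R]_n) (U : 'M[R[i]]_n)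
  : 'M[R]_(k + k) := subcov hk (Mcov Z U).

Definition Jmx k : 'M[R]_(k + k) := block_mx 0 (- 1%:M) 1%:M 0.

(* lam (nonnegative) are symplectic eigenvalues of M: the spectrum of J_k M
   (with multiplicities) is the union of {+- i lam_j}, i.e. the characteristic
   polynomial of J_k M is prod_j (X^2 + lam_j^2). *)
Definition is_symp_eigs k (M : 'M[R]_(k + k)) (lam : 'rV[R]_k) : Prop :=
  (forall j, 0 <= lam 0 j) /\
  char_poly (Jmx k *m M) = \prod_(j < k) ('X ^+ 2 + (lam 0 j ^+ 2)%:P).

Definition symp_eigs k (M : 'M[R]_(k + k)) : 'rV[R]_k :=
  xget 0 (is_symp_eigs M).

Definition gfun (N : R) : R := (N + 1) * ln (N + 1) - N * ln N.
Definition Gfun (l : R) : R := gfun ((l - 1) / 2).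
Definition beta (l : R) : R := ln ((l + 1) / (l - 1)).

Definition entropy k (M : 'M[R]_(k + k)) : R :=
  \sum_(j < k) Gfun (symp_eigs M 0 j).

Definition vnorm n (v : 'cV[R]_n) : R := Num.sqrt (\sum_i v i 0 ^+ 2).

Definition opnorm n (A : 'M[R]_n) : R :=
  sup [set vnorm (A *m v) | v in [set v : 'cV[R]_n | vnorm v = 1]].

Definition Zmx n (z : 'I_n -> R) : 'M[R]_n := diag_mx (\row_j z j).

Definition avg_energy n (z : 'I_n -> R) : R :=
  (2 * n%:R)^-1 * \sum_(j < n) (z j + (z j)^-1).

End Defs.

(* Main.v *)
Require Import Defs.
From HB Require Import structures.
From mathcomp Require Import all_boot all_order all_algebra.
From mathcomp Require Import all_classical all_reals all_analysis.
From mathcomp Require Import complex spectral mxred measurable_realfun.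
From mathcomp Require Import ring lra.

Set Implicit Arguments.
Unset Strict Implicit.
Unset Printing Implicit Defensive.

Import Order.TTheory GRing.Theory Num.Theory.
Import numFieldNormedType.Exports.
Local Open Scope classical_set_scope.
Local Open Scope ring_scope.

(* The reduced covariance matrix M_k(U) is compared with lambda * 1 in Frobenius norm.  The
   numbers lam_j^2 are the (doubled) eigenvalues of -(J M_k)^2, so trace identities and the
   Lipschitz property of G at base points >= mu bound |k G(lambda) - S(M_k)| by a constant
   times sqrt k * t, with t = ||M_k - lambda||_F (an extra factor ||Z|| appears when t > 1).

   The tail of t is controlled without any differential calculus on U(n).  Left invariance
   under the explicit unitaries 1 + s A + d A^2, with A in a spanning family of the Lie
   algebra, gives an exchangeable pair; letting s tend to 0 yields the Stein inequality
   E[f h] <= E[Gamma(f', h)] for linear observables f = <B, M - lambda>, where f' is the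
   explicit preimage of -f under the Casimir operator.  With h = f this is a variance bound of
   order ||Z|| lambda / n; with h = exp (tau f) it is a differential inequality for the moment
   generating function, hence f is subgaussian with variance ||Z||^2 / n.  A discrete Gaussian
   decoupling turns subgaussianity of all <B, M_k - lambda> into
   P(t > t0) <= exp (32 k^2 - n t0^2 / (64 ||Z||^2)).  This bound gives the claimed rate when
   eps is large compared to the entropy term 32 k^2; otherwise the claimed probability is at
   most 1/2 and Chebyshev's inequality suffices, thanks to the lower bound on eps. *)

(** Three difficulties shape the argument. The derivative of g is infinite at 0 and nothing keeps
    the symplectic eigenvalues of a random reduced state away from 1; so only secants of G from the
    fixed base point lambda >= mu are bounded, and the other end is arbitrary. Next, the threshold
    n^((zeta+3kappa-1)/2) allows a single factor ||Z|| in the variance: the mean square of the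
    commutator [B, M] is therefore computed from tr D^2 <= ||Z|| tr D, where D is the direct sum of
    Z and Z^-1. The moment generating function needs a pointwise bound on [B, M] and pays ||Z||^2.
    Finally, the tail is Gaussian in eps, with exponent of order n eps^2 / (k ||Z||^4) at worst,
    while the claim has eps^4: as a deviation above order k ||Z||^2 is impossible, one factor eps^2
    is traded for k^2 ||Z||^4, and this trade produces 8 zeta + 3 kappa. For t > 1 the entropy term
    can spoil the tail bound for finitely many n only, and the constant C rules these out. *)

Local Notation eta := Defs.eta.

(** * The entropy function *)

Section Gfun.
Variable R : realType.
Implicit Types M N x : R.

Lemma ln_le_sub1 x : 0 < x -> ln x <= x - 1.
Proof.
by move=> x0; have := @le_ln1Dx R (x - 1); rewrite addrCA subrr addr0; apply; lra.
Qed.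

Lemma ln_add1_sub_ln N : 0 < N -> ln (N + 1) - ln N <= N^-1.
Proof.
move=> N0; rewrite -ln_div ?posrE//; last lra.
apply: le_trans (ln_le_sub1 _) _; first by rewrite divr_gt0//; lra.
by rewrite mulrDl divff ?gt_eqF// mul1r addrC addKr.
Qed.

(** Concavity of g: the right-hand side is the value at [M] of the tangent at [N], of slope
    [ln (N + 1) - ln N]. It follows from [ln x <= x - 1] at [(M + 1) / (N + 1)] and, with weight
    [M], at [(M + 1) N / ((N + 1) M)]: the two upper bounds add up to zero. For [M = 0] the second
    ratio makes no sense. *)
Lemma gfun_tangent M N : 0 <= M -> 0 < N ->
  gfun M <= (M + 1) * ln (N + 1) - M * ln N.
Proof.
move=> M0 N0; rewrite /gfun.
have N1 : 0 < N + 1 by lra.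
have M1 : 0 < M + 1 by lra.
have r0 : 0 < (M + 1) / (N + 1) by rewrite divr_gt0.
have h1 := ln_le_sub1 r0.
have rN : (M + 1) / (N + 1) * (N + 1) = M + 1 by rewrite divfK ?gt_eqF.
rewrite ln_div ?posrE// in h1.
move: M0; rewrite le_eqVlt => /predU1P[M0|M0].
  rewrite -M0 !mul0r !add0r !subr0 !mul1r ln1.
  by apply: ln_ge0; lra.
have q0 : 0 < (M + 1) / (N + 1) * (N / M) by rewrite mulr_gt0// divr_gt0.
have h2 := ln_le_sub1 q0.
rewrite lnM ?posrE ?divr_gt0// !ln_div ?posrE// in h2.
have h3 : M * (ln (M + 1) - ln (N + 1) + (ln N - ln M)) <=
    (M + 1) / (N + 1) * N - M.
  have -> : (M + 1) / (N + 1) * N - M = M * ((M + 1) / (N + 1) * (N / M) - 1).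
    by field; rewrite !gt_eqF.
  by rewrite ler_pM2l.
lra.
Qed.

Lemma gfun_ge0 M : 0 <= M -> 0 <= gfun M.
Proof.
move=> M0; rewrite /gfun.
move: (M0); rewrite le_eqVlt => /predU1P[<-|M1]; first by rewrite add0r ln1; lra.
have : ln M <= ln (M + 1) by rewrite ler_ln ?posrE; lra.
have : 0 <= ln (M + 1) by apply: ln_ge0; lra.
nra.
Qed.

Lemma gfun_le N : 0 < N -> gfun N <= 1 + N.
Proof.
move=> N0; rewrite /gfun.
have h1 := ln_add1_sub_ln N0.
have h2 : ln (N + 1) <= N by rewrite addrC; apply: le_ln1Dx; lra.
have h3 : N * (ln (N + 1) - ln N) <= 1.
  by rewrite -ler_pdivlMl// mulr1.
nra.
Qed.

(* Here [ln M = 0] is a junk value; the symplectic eigenvalues of a matrix [B *m B^T]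
   are only known to be nonnegative, so [Gfun] is needed on all of [[0, +oo[]. *)
Lemma gfun_neg M : - 2^-1 <= M -> M < 0 -> `|gfun M| <= 1.
Proof.
move=> M0 M1; rewrite /gfun (ln0 (ltW M1)) mulr0 subr0.
have M1' : 0 < M + 1 by lra.
have h0 : ln (M + 1) <= 0 by apply: ln_le0; lra.
have h : 0 < (M + 1)^-1 by rewrite invr_gt0.
have := ln_le_sub1 h; rewrite lnV ?posrE// => h1.
have : (M + 1)^-1 <= 2.
  by rewrite -[leRHS]invrK lef_pV2 ?posrE ?invr_gt0//; lra.
move=> h2; rewrite ler_norml; apply/andP; split; nra.
Qed.

(** The slope of g is unbounded near 0, so the bound is uniform only over secants with one end
    [N >= nu]; the other end may even enter the range where [ln] takes its default value. *)
Lemma gfun_lip nu : 0 < nu -> exists2 L, 0 < L &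
  forall M N, - 2^-1 <= M -> nu <= N -> `|gfun M - gfun N| <= L * `|M - N|.
Proof.
move=> nu0; exists (4 / nu + 2); first by rewrite ltr_wpDl// divr_ge0 ?ltW.
move=> M N hM hN; have N0 : 0 < N by lra.
have nuV : 0 < nu^-1 by rewrite invr_gt0.
have NV : N^-1 <= nu^-1 by rewrite lef_pV2.
have nuN : 1 <= N * nu^-1 by rewrite ler_pdivlMr// mul1r.
have gN := gfun_le N0; have gN0 := gfun_ge0 (ltW N0).
have [M0|M0] := ltP M 0.
  have := gfun_neg hM M0; rewrite ler_norml => /andP[a b].
  by rewrite [`|M - N|]ltr0_norm ?ler_norml; [apply/andP; split; nra|lra].
have gM0 := gfun_ge0 M0.
have d0 := normr_ge0 (M - N); have d1 := ler_norm (M - N).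
have d2 : N - M <= `|M - N| by rewrite distrC ler_norm.
set D := `|M - N| in d0 d1 d2 *.
have up : gfun M - gfun N <= (4 / nu + 2) * D.
  have := gfun_tangent M0 N0; rewrite {2}/gfun => h.
  have l0 : 0 <= ln (N + 1) - ln N by rewrite subr_ge0 ler_ln ?posrE; lra.
  have := ln_add1_sub_ln N0 => l1.
  have h' : gfun M - gfun N <= (M - N) * (ln (N + 1) - ln N) by rewrite {2}/gfun; lra.
  apply: (le_trans h'); nra.
have lo : gfun N - gfun M <= (4 / nu + 2) * D.
  (* The tangent at [M] has slope at most [2 / nu] only if [M] stays away from 0. Below [nu / 2] the
     distance is at least [N / 2], and linear growth of g is enough. *)
  have [hM2|hM2] := leP (nu / 2) M.
    have M1 : 0 < M by lra.
    have := gfun_tangent (ltW N0) M1 => h.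
    have l0 : 0 <= ln (M + 1) - ln M by rewrite subr_ge0 ler_ln ?posrE; lra.
    have := ln_add1_sub_ln M1 => l1.
    have MV : M^-1 <= 2 * nu^-1.
      rewrite -[2]invrK -invfM lef_pV2 ?posrE//; lra.
    have h' : gfun N - gfun M <= (N - M) * (ln (M + 1) - ln M) by rewrite {2}/gfun; lra.
    apply: (le_trans h'); nra.
  have : N / 2 <= D by lra.
  nra.
by rewrite ler_norml; apply/andP; split; lra.
Qed.

Lemma Gfun_lip mu : 1 < mu -> exists2 L, 0 < L &
  forall x l, 0 <= x -> mu <= l -> `|Gfun x - Gfun l| <= L * `|x - l|.
Proof.
move=> mu1; have nu0 : 0 < (mu - 1) / 2 by lra.
have [L L0 HL] := gfun_lip nu0.
exists L => // x l x0 ml; rewrite /Gfun.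
apply: le_trans (HL _ _ _ _) _; [lra|lra|].
rewrite ler_wpM2l ?(ltW L0)//.
have -> : (x - 1) / 2 - (l - 1) / 2 = (x - l) * 2^-1 by field.
rewrite normrM [X in _ * X]ger0_norm ?invr_ge0//; have := normr_ge0 (x - l); lra.
Qed.

Lemma Gfun_growth x : 0 <= x -> `|Gfun x| <= 2 + x.
Proof.
move=> x0; rewrite /Gfun.
have [h|h] := ltP ((x - 1) / 2) 0.
  apply: le_trans (gfun_neg _ h) _; lra.
rewrite ger0_norm ?gfun_ge0//.
move: h; rewrite le_eqVlt => /predU1P[<-|h].
  by rewrite /gfun add0r ln1; lra.
apply: le_trans (gfun_le h) _; lra.
Qed.

Lemma normr_xlnx_le x : 0 < x -> x < 1 -> `|x * ln x| <= 2 * Num.sqrt x.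
Proof.
move=> x0 x1; have s0 : 0 < Num.sqrt x by rewrite sqrtr_gt0.
have sx : Num.sqrt x * Num.sqrt x = x by rewrite -expr2 sqr_sqrtr ?ltW.
have l0 : ln x <= 0 by apply: ln_le0; lra.
have hV : 0 < (Num.sqrt x)^-1 by rewrite invr_gt0.
have := ln_le_sub1 hV; rewrite lnV ?posrE// => h.
have lx : ln x = 2 * ln (Num.sqrt x) by rewrite -{1}sx lnM ?posrE//; lra.
rewrite normrM (ger0_norm (ltW x0)) (ler0_norm l0) lx -{1}sx.
have : Num.sqrt x * (Num.sqrt x)^-1 = 1 by rewrite divff ?gt_eqF.
nra.
Qed.

(** Since [ln] vanishes on nonpositive reals, [y ln y] is zero there and extends continuously
    through 0; this makes [Gfun] continuous on the whole line, including arguments below 1. *)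
Lemma continuous_xlnx x : {for x, continuous (fun y : R => y * ln y)}.
Proof.
have [x0|x0|->] := ltgtP x 0; last first.
- apply/cvgrPdist_lt => e e0; near=> y.
  rewrite mul0r sub0r normrN.
  have [y0|y0] := leP y 0; first by rewrite (ln0 y0) mulr0 normr0.
  have y1 : y < 1.
    near: y.
    exact: lt_nbhsl.
  apply: le_lt_trans (normr_xlnx_le y0 y1) _.
  have : y < (e / 2) ^+ 2.
    near: y.
    by apply: lt_nbhsl; rewrite exprn_gt0// divr_gt0.
  rewrite -ltr_sqrt ?exprn_gt0 ?divr_gt0// sqrtr_sqr ger0_norm; [lra|].
  by rewrite divr_ge0// ltW.
- apply: cvgM; [exact: cvg_id|exact: continuous_ln].
- have E : x * ln x = 0 by rewrite (ln0 (ltW x0)) mulr0.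
  rewrite /prop_for /continuous_at E.
  apply/cvgrPdist_lt => e e0; near=> y.
  rewrite ln0 ?mulr0 ?subrr ?normr0//.
  by apply/ltW; near: y; exact: lt_nbhsl.
Unshelve. all: by end_near. Qed.

Lemma continuous_Gfun_sqrt : continuous (fun s : R => Gfun (Num.sqrt s)).
Proof.
move=> s; apply: (@continuous_comp _ _ _ (@Num.sqrt R) (@Gfun R)).
  exact: sqrt_continuous.
set x := Num.sqrt s.
rewrite /Gfun /gfun.
have c : {for x, continuous (fun y : R => (y - 1) / 2)}.
  by apply: cvgMl; apply: cvgB; [exact: cvg_id|exact: cvg_cst].
have c1 : {for x, continuous (fun y : R => (y - 1) / 2 + 1)}.
  by apply: cvgD; [exact: c|exact: cvg_cst].
have k1 : {for x, continuous (fun y : R => ((y - 1) / 2 + 1) * ln ((y - 1) / 2 + 1))}.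
  exact: (continuous_comp c1 (@continuous_xlnx _)).
have k2 : {for x, continuous (fun y : R => ((y - 1) / 2) * ln ((y - 1) / 2))}.
  exact: (continuous_comp c (@continuous_xlnx _)).
exact: (cvgB k1 k2).
Qed.

End Gfun.

(** * Symplectic eigenvalues *)

Section CharPoly.
Variable F : fieldType.

Lemma char_poly_similar n (P A : 'M[F]_n) : P \in unitmx ->
  char_poly (P *m A *m invmx P) = char_poly A.
Proof.
move=> Pu; pose Q := map_mx (polyC : F -> {poly F}) P.
pose Q' := map_mx (polyC : F -> {poly F}) (invmx P).
have QQ' : Q *m Q' = 1%:M by rewrite /Q /Q' -map_mxM mulmxV// map_scalar_mx.
rewrite /char_poly.
have -> : char_poly_mx (P *m A *m invmx P) = Q *m char_poly_mx A *m Q'.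
  rewrite /char_poly_mx !map_mxM/= mulmxBr mulmxBl; congr (_ - _).
  by rewrite scalar_mxC -mulmxA QQ' mulmx1.
have d : \det Q * \det Q' = 1 by rewrite -det_mulmx QQ' det1.
by rewrite !det_mulmx mulrAC d mul1r.
Qed.

Lemma char_poly_tr n (A : 'M[F]_n) : char_poly A^T = char_poly A.
Proof.
rewrite /char_poly -[RHS]det_tr; congr (\det _).
by rewrite /char_poly_mx -map_trmx linearB/= tr_scalar_mx.
Qed.

Lemma char_poly_opp n (A : 'M[F]_(n + n)) :
  char_poly A \Po - 'X = char_poly (- A).
Proof.
rewrite /char_poly -[_ \Po _]/(comp_poly (- 'X) _) -det_map_mx.
have -> : map_mx (comp_poly (- 'X)) (char_poly_mx A) = - char_poly_mx (- A).
  apply/matrixP => i j; rewrite !mxE !rmorphB/= rmorphMn/= comp_polyX comp_polyC.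
  by rewrite polyCN opprK opprD mulNrn.
rewrite -scaleN1r detZ.
have -> : (-1) ^+ (n + n) = 1 :> {poly F} by rewrite -signr_odd oddD addbb expr0.
by rewrite mul1r.
Qed.

End CharPoly.

Section TrigTrace.
Variable K : comNzRingType.

Lemma is_trig_mulmx n (A B : 'M[K]_n) :
  is_trig_mx A -> is_trig_mx B ->
  is_trig_mx (A *m B) /\ forall i, (A *m B) i i = A i i * B i i.
Proof.
move=> /is_trig_mxP tA /is_trig_mxP tB; split.
  apply/is_trig_mxP => i j ij; rewrite mxE big1// => l _.
  have [il|li] := ltnP i l; first by rewrite tA ?mul0r.
  by rewrite (tB l j) ?mulr0// (leq_ltn_trans li).
move=> i; rewrite mxE (bigD1 i)//= big1 ?addr0// => l li.
have [il|il] := ltnP i l; first by rewrite tA ?mul0r.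
by rewrite (tB l i) ?mulr0// ltn_neqAle il andbT.
Qed.

Lemma is_trig_exp n (A : 'M[K]_n) m : is_trig_mx A ->
  is_trig_mx (A ^+ m) /\ forall i, (A ^+ m) i i = A i i ^+ m.
Proof.
move=> tA; elim: m => [|m [IH1 IH2]].
  by split => [|i]; rewrite expr0 ?mx_trig_scalar ?mxE ?eqxx// scalar_mx_is_trig.
rewrite exprS; have [? E] := is_trig_mulmx tA IH1; split => // i.
by rewrite E IH2 exprS.
Qed.

End TrigTrace.

Section SympEigs.
Variable R : realType.
Local Notation toC := (real_complex R).

(** Schur triangularisation over the complex numbers; unique factorisation of the characteristic
    polynomial identifies the diagonal with the numbers [+- i lam_j]. Hence [- A^2] becomes
    triangular with each [lam_j^2] twice on its diagonal, whether or not [A] is diagonalisable. *)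
Lemma trace_opp_sqr_exp k (A : 'M[R]_(k + k)) (lam : 'I_k -> R) m :
  char_poly A = \prod_(j < k) ('X ^+ 2 + (lam j ^+ 2)%:P) ->
  \tr ((- (A *m A)) ^+ m) = 2 * \sum_j (lam j ^+ 2) ^+ m.
Proof.
case: k => [|k] in A lam *; first by rewrite /mxtrace !big_ord0 mulr0.
set n := (k.+1 + k.+1)%N in A *; move=> cA.
pose AC := map_mx toC A.
have [P Pun] := @Schur R[i] n AC isT; rewrite /similar_to/=.
have Pu := unitarymx_unit Pun.
rewrite conjumx//; set T := P *m AC *m invmx P => tT.
have cT : char_poly T = \prod_(r <- [seq T i i | i <- index_enum 'I_n]) ('X - r%:P).
  by rewrite char_poly_trig// big_map.
pose i_ : R[i] := Complex 0 1.
pose s := [seq i_ * toC (lam j) | j <- index_enum 'I_k.+1] ++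
  [seq - (i_ * toC (lam j)) | j <- index_enum 'I_k.+1].
have sqi : i_ * i_ = -1 by rewrite -expr2 sqr_i.
have sq j : (i_ * toC (lam j)) * (i_ * toC (lam j)) = - toC (lam j ^+ 2).
  by rewrite mulrACA sqi mulN1r -rmorphM expr2.
have cs : char_poly T = \prod_(r <- s) ('X - r%:P).
  rewrite char_poly_similar// -map_char_poly cA rmorph_prod/=.
  rewrite /s big_cat big_map big_map /= -big_split/=.
  apply: eq_bigr => j _; rewrite rmorphD/= rmorphXn/= map_polyX map_polyC/=.
  rewrite polyCN opprK -subr_sqr; congr (_ + _).
  by rewrite [in RHS]expr2 -polyCM sq polyCN opprK.
have /permP pe : perm_eq [seq T i i | i <- index_enum 'I_n] s.
  by apply: prod_XsubC_eq; rewrite -cT -cs.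
have pe' : perm_eq [seq T i i | i <- index_enum 'I_n] s by apply/permP.
apply: (@complexI R).
have -> : toC (\tr ((- (A *m A)) ^+ m)) = \tr (map_mx toC ((- (A *m A)) ^+ m)).
  by rewrite /mxtrace rmorph_sum/=; apply: eq_bigr => i _; rewrite mxE.
have powC : map_mx toC ((- (A *m A)) ^+ m) = (- (AC *m AC)) ^+ m.
  elim: m => [|m IH]; first by rewrite !expr0 map_scalar_mx rmorph1.
  by rewrite !exprS -[LHS]/(map_mx _ (_ *m _)) map_mxM IH map_mxN map_mxM.
have powT : P *m (- (AC *m AC)) ^+ m *m invmx P = (- (T *m T)) ^+ m.
  elim: m {powC} => [|m IH]; first by rewrite !expr0 mulmx1 mulmxV.
  rewrite !exprS -IH -!/(mulmx _ _) -[in RHS]/(mulmx _ _).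
  rewrite -[LHS]/(P *m (- (AC *m AC) *m (- (AC *m AC)) ^+ m) *m invmx P).
  rewrite -[RHS]/(- (T *m T) *m (P *m (- (AC *m AC)) ^+ m *m invmx P)).
  rewrite /T !mulNmx !mulmxN !mulNmx; congr (- _).
  by rewrite !mulmxA !mulmxKV.
have -> : \tr (map_mx toC ((- (A *m A)) ^+ m)) = \tr ((- (T *m T)) ^+ m).
  by rewrite powC -powT mxtrace_mulC mulmxA mulVmx// mul1mx.
have [tTT dTT] := is_trig_mulmx tT tT.
have tN : is_trig_mx (- (T *m T)).
  by apply/is_trig_mxP => i j ij; rewrite mxE; move/is_trig_mxP: tTT => ->//; rewrite oppr0.
have [_ dm] := is_trig_exp m tN.
transitivity (\sum_(r <- [seq T i i | i <- index_enum 'I_n]) (- (r * r)) ^+ m).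
  rewrite big_map /mxtrace; apply: eq_bigr => i _; apply: (etrans (dm i)).
  by rewrite mxE dTT.
rewrite (perm_big _ pe')/= /s big_cat big_map big_map/=.
under eq_bigr do rewrite sq opprK.
under [X in _ + X]eq_bigr do rewrite mulrNN sq opprK.
rewrite rmorphM/= rmorph_sum/= -[toC 2]/(toC 2%:R) rmorph_nat mulr_natl mulr2n.
by congr (_ + _); apply: eq_bigr => j _; rewrite [RHS]rmorphXn.
Qed.

Lemma JmxJ k : Jmx R k *m Jmx R k = - 1%:M.
Proof.
rewrite /Jmx mulmx_block !mul0mx !mulmx0 !add0r !addr0 mulNmx mulmxN !mul1mx.
by rewrite scalar_mx_block opp_block_mx oppr0.
Qed.

Lemma tr_Jmx k : (Jmx R k)^T = - Jmx R k.
Proof.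
by rewrite /Jmx tr_block_mx !trmx0 linearN/= tr_scalar_mx opp_block_mx opprK oppr0.
Qed.

(** For a left eigenvector [v] put [u = v J]. Then [a = |u L|^2] is real, [b = u J u^*] is purely
    imaginary because [J] is real and antisymmetric, and [a = - w b]. If [a = 0] then [u L = 0] and
    [w = 0]. The matrix [L L^T] may be singular. *)
Lemma psd_eigenvalue_imaginary k p (L : 'M[R]_(k + k, p)) (w : R[i]) :
  root (map_poly toC (char_poly (Jmx R k *m (L *m L^T)))) w -> (w^*)%C = - w.
Proof.
rewrite map_char_poly -eigenvalue_root_char => /eigenvalueP[v].
rewrite !map_mxM -map_trmx; set J := map_mx _ _; set LC := map_mx _ _ => vA v0.
have JJ : J *m J = - 1%:M.
  by rewrite /J -map_mxM JmxJ map_mxN map_scalar_mx rmorph1.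
have JT : J^T = - J by rewrite /J map_trmx tr_Jmx map_mxN.
pose cj m n (X : 'M[R[i]]_(m, n)) := map_mx (@conjc R) X.
have cJ : cj _ _ J = J by apply/matrixP => i j; rewrite !mxE conjc_real.
have cL : cj _ _ LC = LC by apply/matrixP => i j; rewrite !mxE conjc_real.
pose u := v *m J.
have uJ : u *m J = - v by rewrite /u -mulmxA JJ mulmxN mulmx1.
have uL : u *m LC *m LC^T = w *: v by rewrite -vA /u !mulmxA.
clearbody u.
pose x := u *m LC.
have cxT : (cj _ _ x)^T = LC^T *m (cj _ _ u)^T.
  by rewrite /x /cj map_mxM -/(cj _ _ LC) cL trmx_mul.
pose a := (x *m (cj _ _ x)^T) 0 0.
pose b := (u *m J *m (cj _ _ u)^T) 0 0.
have ab : a = - w * b.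
  rewrite /a cxT mulmxA uL /b uJ mulNmx -scalemxAl.
  by rewrite mxE [in RHS]mxE mulrNN.
have a0 : a = \sum_j x 0 j * ((x 0 j)^*)%C.
  by rewrite /a mxE; apply: eq_bigr => j _; rewrite !mxE.
have age0 : 0 <= a by rewrite a0; apply: sumr_ge0 => j _; exact: mulcJ_ge0.
have acj : (a^*)%C = a by rewrite -(RRe_real (ger0_real age0)) conjc_real.
have bcj : (b^*)%C = - b.
  have -> : (b^*)%C = (cj _ _ (u *m J *m (cj _ _ u)^T)) 0 0 by rewrite mxE.
  have -> : cj _ _ (u *m J *m (cj _ _ u)^T) = cj _ _ u *m J *m u^T.
    rewrite /cj 2!map_mxM -/(cj _ _ J) cJ; congr (_ *m _).
    by apply/matrixP => i j; rewrite !mxE/= conjcK.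
  have -> : cj _ _ u *m J *m u^T = - (u *m J *m (cj _ _ u)^T)^T.
    by rewrite !trmx_mul trmxK JT mulNmx mulmxN opprK mulmxA.
  by rewrite mxE mxE.
have [az|anz] := eqVneq a 0.
  have x0 : x = 0.
    apply/rowP => j; rewrite [RHS]mxE.
    move/eqP: az; rewrite a0 psumr_eq0 => [|i _]; last exact: mulcJ_ge0.
    move/allP => /(_ j); rewrite mem_index_enum => /(_ isT)/=.
    by rewrite mulf_eq0 conjc_eq0 orbb => /eqP.
  have /eqP : w *: v = 0 by rewrite -uL -/x x0 mul0mx.
  by rewrite scaler_eq0 (negPf v0) orbF => /eqP ->; rewrite conjc0 oppr0.
have bnz : b != 0 by apply: contra_neq anz => b0; rewrite ab b0 mulr0.
have : (a^*)%C = - (w^*)%C * - b by rewrite ab rmorphM/= rmorphN/= bcj.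
rewrite acj ab mulrNN mulNr => /eqP; rewrite eq_sym -subr_eq0 opprK -mulrDl.
by rewrite mulf_eq0 (negPf bnz) orbF addr_eq0 => /eqP.
Qed.

(** The transpose of [- J M] is [M J], which [J] conjugates to [J M]; so the characteristic
    polynomial is even, of the form [q(X^2)]. Each complex root of [q] is the square of an
    eigenvalue, which is imaginary, hence the root is a nonpositive real [r] and [sqrt (- r)] is a
    symplectic eigenvalue. *)
Lemma symp_eigs_exist k p (L : 'M[R]_(k + k, p)) :
  exists lam, is_symp_eigs (L *m L^T) lam.
Proof.
set A := Jmx R k *m (L *m L^T).
set P := char_poly A; set q := even_poly P.
have Pq : P = q \Po 'X^2.
  have ev : P \Po - 'X = P.
    rewrite /P char_poly_opp -char_poly_tr.
    have Ju : Jmx R k \in unitmx.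
      have : Jmx R k *m (- Jmx R k) = 1%:M by rewrite mulmxN JmxJ opprK.
      by case/mulmx1_unit.
    rewrite -(char_poly_similar _ Ju); congr char_poly.
    rewrite linearN/= /A trmx_mul tr_Jmx !mulmxN opprK trmx_mul trmxK.
    by rewrite -!mulmxA mulmxV// mulmx1 !mulmxA.
  have := poly_even_odd P; rewrite -/q; set o := odd_poly P => PE.
  have : P = q \Po 'X^2 - (o \Po 'X^2) * 'X.
    rewrite -[LHS]ev -{1}PE comp_polyD comp_polyM comp_polyX -!comp_polyA.
    by rewrite comp_Xn_poly sqrrN mulrN.
  rewrite -{1}PE => /addrI /eqP; rewrite -addr_eq0 -mulr2n -mulr_natl mulf_eq0.
  rewrite -polyC_natr polyC_eq0 pnatr_eq0/= => /eqP o0.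
  by rewrite -PE o0 addr0.
have Pm : P \is monic := char_poly_monic A.
have sP : size P = (k + k).+1 := size_char_poly A.
have qm : q \is monic.
  by move: Pm; rewrite Pq !monicE lead_coef_comp ?size_polyXn// lead_coefXn expr1n mulr1.
have sq : size q = k.+1.
  have : (size P).-1 = ((size q).-1 * 2)%N by rewrite Pq size_comp_poly size_polyXn.
  rewrite sP muln2 addnn => /double_inj E.
  by rewrite E prednK// lt0n size_poly_eq0 monic_neq0.
have [rs qrs] := closed_field_poly_normal (map_poly toC q).
have lq : lead_coef (map_poly toC q) = 1.
  by rewrite lead_coef_map (monicP qm) rmorph1.
rewrite lq scale1r in qrs.
have srs : size rs = k.
  have := congr1 (fun r : {poly R[i]} => size r) qrs.
  by rewrite size_prod_XsubC size_map_poly sq => -[].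
have rsE r : r \in rs -> r = - toC (Num.sqrt (- complex.Re r) ^+ 2).
  move=> rrs; pose w := sqrtc r.
  have ww : w ^+ 2 = r by rewrite sqr_sqrtc.
  have wim : (w^*)%C = - w.
    apply: (@psd_eigenvalue_imaginary k p L).
    rewrite -/A -/P Pq map_comp_poly map_polyXn /root horner_comp hornerXn ww.
    by rewrite -/(root _ _) qrs root_prod_XsubC.
  have : 0 <= - r.
    by rewrite -ww expr2 -mulrN -wim mulcJ_ge0.
  move=> r0; have rr : r = toC (complex.Re r).
    by rewrite RRe_real// -[r]opprK realN ger0_real.
  rewrite sqr_sqrtr; first by rewrite rmorphN/= -rr opprK.
  by move: r0; rewrite {1}rr -rmorphN/= ler0c.
exists (\row_j Num.sqrt (- complex.Re (nth 0 rs j))); split.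
  by move=> j; rewrite mxE sqrtr_ge0.
rewrite -/A -/P; apply: (@map_poly_inj _ _ toC).
rewrite Pq map_comp_poly map_polyXn qrs rmorph_prod/= (big_nth 0) srs big_mkord.
rewrite rmorph_prod/=; apply: eq_bigr => j _.
rewrite comp_polyB comp_polyX comp_polyC rmorphD/= rmorphXn/= map_polyX map_polyC/= mxE.
rewrite {1}[nth 0 rs j]rsE ?polyCN ?opprK//.
by apply: mem_nth; rewrite srs.
Qed.

(** [symp_eigs] is a choice with default value 0; on Gram matrices the choice is a genuine one. *)
Lemma symp_eigsP k p (L : 'M[R]_(k + k, p)) :
  is_symp_eigs (L *m L^T) (symp_eigs (L *m L^T)).
Proof.
by have [lam Hlam] := symp_eigs_exist L; exact: (xgetI _ Hlam).
Qed.

End SympEigs.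

(** * Frobenius norm and deviation of the entropy *)

Section Frobenius.
Variable R : rcfType.

Definition dotm m n (A B : 'M[R]_(m, n)) : R := \tr (A^T *m B).
Definition fnorm m n (A : 'M[R]_(m, n)) : R := Num.sqrt (dotm A A).

Lemma dotmE m n (A B : 'M[R]_(m, n)) :
  dotm A B = \sum_i \sum_j A i j * B i j.
Proof.
rewrite /dotm /mxtrace exchange_big; apply: eq_bigr => j _.
by rewrite mxE; apply: eq_bigr => i _; rewrite mxE.
Qed.

Lemma dotmC m n (A B : 'M[R]_(m, n)) : dotm A B = dotm B A.
Proof. by rewrite !dotmE; do 2!apply: eq_bigr => ? _; rewrite mulrC. Qed.

Lemma dotmDr m n (A B C : 'M[R]_(m, n)) : dotm A (B + C) = dotm A B + dotm A C.
Proof. by rewrite /dotm mulmxDr linearD. Qed.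

Lemma dotmDl m n (A B C : 'M[R]_(m, n)) : dotm (A + B) C = dotm A C + dotm B C.
Proof. by rewrite ![dotm _ C]dotmC dotmDr. Qed.

Lemma dotmZr m n a (A B : 'M[R]_(m, n)) : dotm A (a *: B) = a * dotm A B.
Proof. by rewrite /dotm -scalemxAr linearZ. Qed.

Lemma dotmZl m n a (A B : 'M[R]_(m, n)) : dotm (a *: A) B = a * dotm A B.
Proof. by rewrite dotmC dotmZr dotmC. Qed.

Lemma dotmNr m n (A B : 'M[R]_(m, n)) : dotm A (- B) = - dotm A B.
Proof. by rewrite -scaleN1r dotmZr mulN1r. Qed.

Lemma dotmNl m n (A B : 'M[R]_(m, n)) : dotm (- A) B = - dotm A B.
Proof. by rewrite dotmC dotmNr dotmC. Qed.

Lemma dotmBr m n (A B C : 'M[R]_(m, n)) : dotm A (B - C) = dotm A B - dotm A C.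
Proof. by rewrite dotmDr dotmNr. Qed.

Lemma dotmBl m n (A B C : 'M[R]_(m, n)) : dotm (A - B) C = dotm A C - dotm B C.
Proof. by rewrite dotmDl dotmNl. Qed.

Lemma dotm0r m n (A : 'M[R]_(m, n)) : dotm A 0 = 0.
Proof. by rewrite -(scale0r A) dotmZr mul0r. Qed.

Lemma dotm_sumr m n (I : Type) (r : seq I) (A : 'M[R]_(m, n)) (F : I -> 'M[R]_(m, n)) :
  dotm A (\sum_(i <- r) F i) = \sum_(i <- r) dotm A (F i).
Proof. by elim/big_rec2: _ => [|i x y _ <-]; rewrite ?dotm0r// dotmDr. Qed.

Lemma dotm_mull m n p (A : 'M[R]_(m, n)) (B : 'M[R]_(n, p)) C :
  dotm (A *m B) C = dotm B (A^T *m C).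
Proof. by rewrite /dotm trmx_mul mulmxA. Qed.

Lemma dotm_mulr m n p (A : 'M[R]_(m, n)) (B : 'M[R]_(n, p)) C :
  dotm (A *m B) C = dotm A (C *m B^T).
Proof. by rewrite /dotm trmx_mul -mulmxA mxtrace_mulC -mulmxA. Qed.

Lemma dotm_tr m n (A B : 'M[R]_(m, n)) : dotm A^T B^T = dotm A B.
Proof. by rewrite /dotm trmxK mxtrace_mulC -mxtrace_tr trmx_mul trmxK. Qed.

Lemma dotmm_ge0 m n (A : 'M[R]_(m, n)) : 0 <= dotm A A.
Proof.
rewrite dotmE; apply: sumr_ge0 => i _; apply: sumr_ge0 => j _.
by rewrite -expr2 sqr_ge0.
Qed.
Hint Resolve dotmm_ge0 : core.

Lemma fnorm_ge0 m n (A : 'M[R]_(m, n)) : 0 <= fnorm A.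
Proof. exact: sqrtr_ge0. Qed.
Hint Resolve fnorm_ge0 : core.

Lemma fnorm_sqr m n (A : 'M[R]_(m, n)) : fnorm A ^+ 2 = dotm A A.
Proof. by rewrite sqr_sqrtr. Qed.

Lemma dotm_sqr_le m n (A B : 'M[R]_(m, n)) :
  dotm A B ^+ 2 <= dotm A A * dotm B B.
Proof.
have [b0|b0] := eqVneq (dotm B B) 0.
  have : forall t, 0 <= dotm A A + 2 * t * dotm A B.
    move=> t; have := dotmm_ge0 (A + t *: B).
    rewrite dotmDl !dotmDr !dotmZl !dotmZr (dotmC B A) b0; lra.
  move=> h; have [->|ab] := eqVneq (dotm A B) 0.
    by rewrite expr0n/= mulr_ge0.
  have := h (- (dotm A A + 1) / (2 * dotm A B)).
  have -> : 2 * (- (dotm A A + 1) / (2 * dotm A B)) * dotm A B = - (dotm A A + 1).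
    by field.
  lra.
have bp : 0 < dotm B B by rewrite lt_neqAle eq_sym b0/=.
have := dotmm_ge0 (A - (dotm A B / dotm B B) *: B).
rewrite dotmBl !dotmBr !dotmZl !dotmZr (dotmC B A).
set x := dotm A B; set y := dotm B B in bp b0 *; set w := dotm A A.
have -> : w - x / y * x - (x / y * x - x / y * (x / y * y)) = w - x ^+ 2 / y by field.
by rewrite subr_ge0 ler_pdivrMr.
Qed.

Lemma normr_dotm_le m n (A B : 'M[R]_(m, n)) : `|dotm A B| <= fnorm A * fnorm B.
Proof.
rewrite -(@ler_pXn2r _ 2) ?nnegrE ?mulr_ge0//.
by rewrite real_normK ?num_real// exprMn !fnorm_sqr dotm_sqr_le.
Qed.

Lemma fnormD m n (A B : 'M[R]_(m, n)) : fnorm (A + B) <= fnorm A + fnorm B.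
Proof.
rewrite -(@ler_pXn2r _ 2) ?nnegrE ?addr_ge0// sqrrD !fnorm_sqr.
rewrite dotmDl !dotmDr (dotmC B A).
have := le_trans (ler_norm _) (normr_dotm_le A B); lra.
Qed.

Lemma fnormZ m n a (A : 'M[R]_(m, n)) : fnorm (a *: A) = `|a| * fnorm A.
Proof.
by rewrite /fnorm dotmZl dotmZr mulrA -expr2 sqrtrM ?sqr_ge0// sqrtr_sqr.
Qed.

Lemma fnormN m n (A : 'M[R]_(m, n)) : fnorm (- A) = fnorm A.
Proof. by rewrite /fnorm dotmNl dotmNr opprK. Qed.

Lemma fnormB m n (A B : 'M[R]_(m, n)) : fnorm (A - B) <= fnorm A + fnorm B.
Proof. by apply: le_trans (fnormD _ _) _; rewrite fnormN. Qed.

Lemma fnorm_tr m n (A : 'M[R]_(m, n)) : fnorm A^T = fnorm A.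
Proof. by rewrite /fnorm dotm_tr. Qed.

Lemma fnorm_orthol m n p (A : 'M[R]_(m, n)) (B : 'M[R]_(n, p)) :
  A^T *m A = 1%:M -> fnorm (A *m B) = fnorm B.
Proof. by move=> AA; rewrite /fnorm dotm_mull mulmxA AA mul1mx. Qed.

Lemma fnorm_orthor m n p (A : 'M[R]_(m, n)) (B : 'M[R]_(n, p)) :
  B *m B^T = 1%:M -> fnorm (A *m B) = fnorm A.
Proof. by move=> BB; rewrite /fnorm dotm_mulr -mulmxA BB mulmx1. Qed.

Lemma fnormM m n p (A : 'M[R]_(m, n)) (B : 'M[R]_(n, p)) :
  fnorm (A *m B) <= fnorm A * fnorm B.
Proof.
rewrite -(@ler_pXn2r _ 2) ?nnegrE ?mulr_ge0// exprMn !fnorm_sqr.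
have -> : dotm (A *m B) (A *m B) =
    \sum_i \sum_j dotm (row i A)^T (col j B) ^+ 2.
  rewrite dotmE; apply: eq_bigr => i _; apply: eq_bigr => j _.
  rewrite -expr2; congr (_ ^+ 2); rewrite dotmE mxE; apply: eq_bigr => l _.
  by rewrite big_ord1 !mxE.
have -> : dotm A A = \sum_i dotm (row i A)^T (row i A)^T.
  rewrite dotmE; apply: eq_bigr => i _; rewrite dotmE; apply: eq_bigr => l _.
  by rewrite big_ord1 !mxE.
have -> : dotm B B = \sum_j dotm (col j B) (col j B).
  rewrite dotmE exchange_big; apply: eq_bigr => i _; rewrite dotmE.
  by apply: eq_bigr => l _; rewrite big_ord1 !mxE.
rewrite mulr_suml; apply: ler_sum => i _; rewrite mulr_sumr.
by apply: ler_sum => j _; exact: dotm_sqr_le.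
Qed.

Lemma entry_le_fnorm m n (A : 'M[R]_(m, n)) i j : `|A i j| <= fnorm A.
Proof.
rewrite -(@ler_pXn2r _ 2) ?nnegrE// real_normK ?num_real// fnorm_sqr dotmE.
rewrite (bigD1 i)//= (bigD1 j)//= -expr2 -addrA lerDl addr_ge0//.
  by apply: sumr_ge0 => l _; rewrite -expr2 sqr_ge0.
by apply: sumr_ge0 => l _; apply: sumr_ge0 => l' _; rewrite -expr2 sqr_ge0.
Qed.

Lemma fnorm1 n : fnorm (1%:M : 'M[R]_n) = Num.sqrt n%:R.
Proof. by rewrite /fnorm /dotm trmx1 mul1mx mxtrace1. Qed.

Lemma sum_normr_le n (a : 'I_n -> R) :
  \sum_i `|a i| <= Num.sqrt n%:R * Num.sqrt (\sum_i a i ^+ 2).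
Proof.
pose u : 'rV[R]_n := const_mx 1; pose v : 'rV[R]_n := \row_i `|a i|.
have -> : \sum_i `|a i| = dotm u v.
  by rewrite dotmE big_ord1; apply: eq_bigr => i _; rewrite !mxE mul1r.
have -> : \sum_i a i ^+ 2 = dotm v v.
  rewrite dotmE big_ord1; apply: eq_bigr => i _; rewrite !mxE -expr2.
  by rewrite real_normK ?num_real.
have -> : n%:R = dotm u u.
  rewrite dotmE big_ord1; under eq_bigr do rewrite !mxE mul1r.
  by rewrite sumr_const card_ord.
exact: le_trans (ler_norm _) (normr_dotm_le _ _).
Qed.

End Frobenius.
#[global] Hint Resolve dotmm_ge0 fnorm_ge0 : core.

(** * Deviation of the entropy in terms of the Frobenius norm *)

Section EntropyDeviation.
Variable R : realType.

Lemma Jmx_ortho k : (Jmx R k)^T *m Jmx R k = 1%:M.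
Proof. by rewrite tr_Jmx mulNmx JmxJ opprK. Qed.

Lemma Jmx_ortho' k : Jmx R k *m (Jmx R k)^T = 1%:M.
Proof. by rewrite tr_Jmx mulmxN JmxJ opprK. Qed.

(** As [J^2 = -1], the terms of order zero in [E] cancel. What remains is of first and second order,
    with [E] multiplied only by scalars, by the orthogonal matrix [J] and by itself. *)
Lemma Jmx_shift_sqr k (E : 'M[R]_(k + k)) l (J := Jmx R k) :
  (J *m (l%:M + E)) *m (J *m (l%:M + E)) + (l ^+ 2)%:M =
  - (l *: E) + l *: (J *m E *m J) + J *m (E *m (J *m E)).
Proof.
rewrite mulmxDr mul_mx_scalar mulmxDl !mulmxDr.
have -> : (l *: J) *m (l *: J) = - (l ^+ 2)%:M.
  by rewrite -scalemxAl -scalemxAr JmxJ scalerA -expr2 scalerN scalemx1.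
have -> : (l *: J) *m (J *m E) = - (l *: E).
  by rewrite -scalemxAl mulmxA JmxJ mulNmx mul1mx scalerN.
have -> : (J *m E) *m (l *: J) = l *: (J *m E *m J) by rewrite -scalemxAr.
have -> : (J *m E) *m (J *m E) = J *m (E *m (J *m E)) by rewrite !mulmxA.
by rewrite addrC !addrA subrr add0r.
Qed.

(** With [N = - (J M)^2], the traces of [N^0], [N^1], [N^2] express the sum of [(lam_j^2 - l^2)^2]
    as half of [tr Y^2], where [Y = l^2 - N]. [Y] need not be symmetric, but Cauchy-Schwarz still
    bounds [tr Y^2] by its squared Frobenius norm. The parameter [e] is any operator bound on
    [M - l]; it serves for the quadratic term of [Y]. *)
Lemma symp_eigs_deviation k (M : 'M[R]_(k + k)) (lam : 'rV[R]_k) (l e : R) :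
  is_symp_eigs M lam -> 1 <= l ->
  (forall p (X : 'M[R]_(k + k, p)), fnorm ((M - l%:M) *m X) <= e * fnorm X) ->
  \sum_j `|lam 0 j - l| <= Num.sqrt k%:R * ((2 * l + e) * fnorm (M - l%:M)).
Proof.
move=> [lam0 cA] l1 He; set E := M - l%:M in He *; set J := Jmx R k.
set A := J *m M in cA *.
pose Y := A *m A + (l ^+ 2)%:M.
have ME : M = l%:M + E by rewrite /E addrC subrK.
have YE : Y = - (l *: E) + l *: (J *m E *m J) + J *m (E *m (J *m E)).
  by rewrite /Y /A ME; exact: Jmx_shift_sqr.
have sumE : \sum_j (lam 0 j ^+ 2 - l ^+ 2) ^+ 2 = 2^-1 * \tr (Y *m Y).
  have t0 := trace_opp_sqr_exp 0 cA; have t1 := trace_opp_sqr_exp 1 cA.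
  have t2 := trace_opp_sqr_exp 2 cA.
  set N := - (A *m A) in t0 t1 t2.
  have -> : Y = (l ^+ 2)%:M - N by rewrite /Y /N opprK addrC.
  have -> : \tr (((l ^+ 2)%:M - N) *m ((l ^+ 2)%:M - N)) =
      \tr (N ^+ 2) - 2 * l ^+ 2 * \tr (N ^+ 1) + (l ^+ 2) ^+ 2 * \tr (N ^+ 0).
    have -> : \tr (N ^+ 2) = \tr (N *m N) by [].
    have -> : \tr (N ^+ 0) = \tr (1%:M : 'M[R]_(k + k)) by [].
    have -> : \tr (N ^+ 1) = \tr N by [].
    set x := l ^+ 2; clearbody N x; rewrite mulmxBl !mulmxBr -scalar_mxM.
    rewrite mul_mx_scalar mul_scalar_mx !raddfB/= !mxtraceZ !mxtrace_scalar.
    by ring.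
  pose S i := \sum_j (lam 0 j ^+ 2) ^+ i.
  rewrite t0 t1 t2 -/(S 0%N) -/(S 1%N) -/(S 2%N).
  have -> : \sum_j (lam 0 j ^+ 2 - l ^+ 2) ^+ 2 =
      S 2%N - 2 * l ^+ 2 * S 1%N + (l ^+ 2) ^+ 2 * S 0%N.
    rewrite /S !mulr_sumr -sumrB -big_split/=; apply: eq_bigr => j _.
    by rewrite expr0 expr1; ring.
  by field.
have Yle : fnorm Y <= (2 * l + e) * fnorm E.
  rewrite YE; apply: le_trans (fnormD _ _) _.
  have h1 : fnorm (J *m (E *m (J *m E))) <= e * fnorm E.
    rewrite fnorm_orthol ?Jmx_ortho//; apply: le_trans (He _ _) _.
    by rewrite fnorm_orthol ?Jmx_ortho.
  have h2 : fnorm (- (l *: E) + l *: (J *m E *m J)) <= 2 * l * fnorm E.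
    apply: le_trans (fnormD _ _) _; rewrite fnormN !fnormZ.
    rewrite fnorm_orthor ?Jmx_ortho'// fnorm_orthol ?Jmx_ortho//.
    by rewrite ger0_norm; lra.
  lra.
have trY : \tr (Y *m Y) <= fnorm Y ^+ 2.
  have -> : \tr (Y *m Y) = dotm Y^T Y by rewrite /dotm trmxK.
  apply: le_trans (ler_norm _) (le_trans (normr_dotm_le _ _) _).
  by rewrite fnorm_tr expr2.
have h0 : 0 <= (2 * l + e) * fnorm E by apply: le_trans Yle; exact: fnorm_ge0.
(* Differences of squares dominate differences because [lam_j + l >= 1]. *)
apply: (@le_trans _ _ (\sum_j `|lam 0 j ^+ 2 - l ^+ 2|)).
  apply: ler_sum => j _; rewrite subr_sqr normrM ler_peMr//.
  by have := lam0 j; move=> ?; rewrite ger0_norm; lra.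
apply: le_trans (sum_normr_le _) _; rewrite ler_wpM2l ?sqrtr_ge0//.
rewrite sumE -[leRHS]ger0_norm// -sqrtr_sqr ler_wsqrtr//.
have : fnorm Y ^+ 2 <= ((2 * l + e) * fnorm E) ^+ 2 by rewrite lerXn2r ?nnegrE ?fnorm_ge0.
have := sqr_ge0 (fnorm Y); lra.
Qed.

Lemma entropy_deviation k p (B : 'M[R]_(k + k, p)) (l e L : R) :
  let M := B *m B^T in 0 <= L -> 1 <= l ->
  (forall x, 0 <= x -> `|Gfun x - Gfun l| <= L * `|x - l|) ->
  (forall q (X : 'M[R]_(k + k, q)), fnorm ((M - l%:M) *m X) <= e * fnorm X) ->
  `|k%:R * Gfun l - entropy M| <=
    L * (Num.sqrt k%:R * ((2 * l + e) * fnorm (M - l%:M))).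
Proof.
move=> M L0 l1 HL He; have se := symp_eigsP B; rewrite -/M in se.
have -> : k%:R * Gfun l - entropy M = \sum_(j < k) (Gfun l - Gfun (symp_eigs M 0 j)).
  rewrite sumrB; congr (_ - _); rewrite mulr_natl.
  by rewrite big_const_ord iter_addr_0.
apply: le_trans (ler_norm_sum _ _ _) _.
apply: (@le_trans _ _ (L * \sum_j `|symp_eigs M 0 j - l|)).
  rewrite mulr_sumr; apply: ler_sum => j _; rewrite distrC HL//.
  by case: se.
by rewrite ler_wpM2l// symp_eigs_deviation.
Qed.

End EntropyDeviation.

(** * Measurability of the entropy *)

Section Bernstein.
Variable R : realType.

(* E[phi(S_N)] for S_N binomial, written as a polynomial in the success
   probability; the recursion conditions on the first trial. *)
Fixpoint bern N (phi : nat -> R) : {poly R} :=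
  if N is N'.+1 then 'X * bern N' (phi \o succn) + (1 - 'X) * bern N' phi
  else (phi 0%N)%:P.

Lemma bernS N phi x : (bern N.+1 phi).[x] =
  x * (bern N (phi \o succn)).[x] + (1 - x) * (bern N phi).[x].
Proof. by rewrite /= !hornerE. Qed.

Lemma bern_le N phi psi x : 0 <= x <= 1 ->
  (forall i, (i <= N)%N -> phi i <= psi i) ->
  (bern N phi).[x] <= (bern N psi).[x].
Proof.
move=> /andP[x0 x1]; elim: N phi psi => [|N IH] phi psi h.
  by rewrite !hornerC h.
rewrite !bernS lerD// ler_wpM2l ?subr_ge0//; apply: IH => i iN; apply: h => //.
exact: leqW.
Qed.

Lemma bern_affine N a c phi x :
  (bern N (fun i => a * phi i + c)).[x] = a * (bern N phi).[x] + c.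
Proof.
elim: N phi => [|N IH] phi; first by rewrite !hornerC.
rewrite !bernS IH -[_ \o _]/(fun i => a * (phi \o succn) i + c) IH; ring.
Qed.

(** Variance plus squared bias of a binomial variable. The centre [a] is arbitrary because
    conditioning on a first success shifts it by 1. *)
Lemma bern_variance N a x :
  (bern N (fun i => (i%:R - a) ^+ 2)).[x] = N%:R * x * (1 - x) + (N%:R * x - a) ^+ 2.
Proof.
elim: N a => [|N IH] a; first by rewrite /= hornerC; ring.
rewrite bernS IH.
have -> : (fun i => (i%:R - a) ^+ 2) \o succn =
    (fun i => (i%:R - (a - 1)) ^+ 2) :> (nat -> R).
  by apply/funext => i /=; congr (_ ^+ 2); rewrite -natr1; ring.
by rewrite IH -natr1; ring.
Qed.

(** The Bernstein polynomial of [h] on the growing interval [[0, T]], [T = m + 1], of degree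
    [N = T^4]. The variance of the node [T i / N] is at most [T^2 / N] and a function of linear
    growth is of order [T] on the interval, so the degree has to outgrow [T^3]. *)
Definition bernstein_approx (h : R -> R) (m : nat) : {poly R} :=
  let T := m.+1%:R in
  bern (m.+1 ^ 4) (fun i => h (T * i%:R / (m.+1 ^ 4)%:R)) \Po (T^-1 *: 'X).

(** Chebyshev's argument at one point: nodes near [s] are handled by continuity, the others by
    linear growth against the variance. *)
Lemma bernstein_approx_cvg (h : R -> R) K s : 0 <= s ->
  {for s, continuous h} -> (forall u, 0 <= u -> `|h u| <= K * (1 + u)) ->
  (bernstein_approx h m).[s] @[m --> \oo] --> h s.
Proof.
move=> s0 ch hK.
have K0 : 0 <= K.
  have := hK 0 (lexx _); rewrite addr0 mulr1; exact: le_trans.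
apply/cvgrPdist_le => e e0.
have /cvgrPdist_lt /(_ (e / 2)) := ch.
rewrite divr_gt0// => /(_ isT) /nbhs_ballP[d /= d0 hd].
near=> m.
have hm1 : (Num.bound s <= m)%N by near: m; exists (Num.bound s).
have hm2 : (Num.bound ((e / 2)^-1 * (4 * K / d ^+ 2)) <= m)%N.
  by near: m; exists (Num.bound ((e / 2)^-1 * (4 * K / d ^+ 2))).
set T : R := m.+1%:R; set N := (m.+1 ^ 4)%N.
have T0 : 0 < T by rewrite ltr0n.
have T1 : 1 <= T by rewrite ler1n.
have NT : N%:R = T ^+ 4 :> R by rewrite /N natrX.
have sT : s <= T.
  apply: le_trans (ltW (archi_boundP s0)) _; rewrite ler_nat.
  exact: leqW.
have x01 : 0 <= s / T <= 1.
  apply/andP; split; first by rewrite divr_ge0// ltW.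
  by rewrite ler_pdivrMr// mul1r.
rewrite /bernstein_approx -/T -/N horner_comp hornerZ hornerX [T^-1 * s]mulrC.
set phi := fun i : nat => h (T * i%:R / N%:R).
(* [4 K T] bounds the oscillation of [h] on [[0, T]], and [(u - s)^2 / d^2 >= 1] for nodes [u]
   outside the ball of radius [d]; the last factor converts from nodes to indices. *)
pose A := 4 * K * T / d ^+ 2 * T ^+ 2 / N%:R ^+ 2.
have A0 : 0 <= A by rewrite !(mulr_ge0, divr_ge0, exprn_ge0, invr_ge0)// ltW.
have key i : (i <= N)%N -> `|phi i - h s| <= A * (i%:R - N%:R * (s / T)) ^+ 2 + e / 2.
  move=> iN; set u := T * i%:R / N%:R.
  have N0 : 0 < N%:R :> R by rewrite NT exprn_gt0.
  have u0 : 0 <= u by rewrite /u divr_ge0 ?mulr_ge0// ltW.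
  have uT : u <= T by rewrite /u ler_pdivrMr// ler_pM2l// ler_nat.
  have Eu : A * (i%:R - N%:R * (s / T)) ^+ 2 = 4 * K * T / d ^+ 2 * (u - s) ^+ 2.
    rewrite /A /u; field; rewrite !gt_eqF//.
  rewrite Eu; have [us|us] := ltP `|s - u| d.
    rewrite distrC; have := hd u us; rewrite /= => /ltW h1.
    apply: (le_trans h1); rewrite lerDr.
    by rewrite mulr_ge0 ?sqr_ge0// divr_ge0 ?sqr_ge0// !mulr_ge0// ltW.
  have h1 : `|phi i - h s| <= 4 * K * T.
    apply: le_trans (ler_normB _ _) _.
    have := hK _ u0; have := hK _ s0; rewrite /phi -/u => ? ?.
    nra.
  have h2 : 1 <= (u - s) ^+ 2 / d ^+ 2.
    rewrite ler_pdivlMr ?exprn_gt0// mul1r -[leRHS]real_normK ?num_real//.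
    by rewrite lerXn2r ?nnegrE ?(ltW d0)// distrC.
  have h3 : 4 * K * T / d ^+ 2 * (u - s) ^+ 2 = 4 * K * T * ((u - s) ^+ 2 / d ^+ 2).
    by ring.
  rewrite h3; apply: (le_trans h1); have : 0 <= 4 * K * T by rewrite !mulr_ge0// ltW.
  have := e0; nra.
pose V := (bern N (fun i => (i%:R - N%:R * (s / T)) ^+ 2)).[s / T].
have VN : A * V <= e / 2.
  have -> : V = N%:R * (s / T) * (1 - s / T).
    by rewrite /V bern_variance subrr expr0n/= addr0.
  have : N%:R * (s / T) * (1 - s / T) <= N%:R.
    rewrite -mulrA ler_piMr ?ler0n//; move: x01; move: (s / T) => x /andP[]; nra.
  move=> hV; apply: (le_trans (ler_wpM2l A0 hV)).
  have -> : A * N%:R = 4 * K / d ^+ 2 / T.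
    by rewrite /A NT; field; rewrite !gt_eqF.
  rewrite ler_pdivrMr// -ler_pdivrMl ?divr_gt0//.
  apply: le_trans (ltW (archi_boundP _)) _; last by rewrite ler_nat leqW.
  by rewrite !(mulr_ge0, divr_ge0, exprn_ge0, invr_ge0)// ltW.
have up : (bern N phi).[s / T] <= A * V + (h s + e / 2).
  rewrite /V -bern_affine; apply: bern_le => // i iN.
  have := key i iN; move: (A * _) (phi i) => q p.
  by rewrite ler_norml => /andP[]; lra.
have lo : - (A * V) + (h s - e / 2) <= (bern N phi).[s / T].
  rewrite -mulNr /V -bern_affine; apply: bern_le => // i iN; rewrite mulNr.
  have := key i iN; move: (A * _) (phi i) => q p.
  by rewrite ler_norml => /andP[]; lra.
move: up lo VN; move: (A * V) (bern N phi).[s / T] => q p.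
by move=> ? ? ?; rewrite ler_norml; apply/andP; split; lra.
Unshelve. all: by end_near. Qed.

End Bernstein.

(** * Measurability of matrix-valued maps, entry by entry *)

Section MatrixMeasurability.
Context d (T : measurableType d) (R : realType).

Definition mxmeas m n (X : T -> 'M[R]_(m, n)) :=
  forall i j, measurable_fun setT (fun t => X t i j).

Lemma mxmeas_cst m n (A : 'M[R]_(m, n)) : mxmeas (fun=> A).
Proof. by move=> i j; exact: measurable_cst. Qed.

Lemma mxmeas_mul m n p (X : T -> 'M[R]_(m, n)) (Y : T -> 'M[R]_(n, p)) :
  mxmeas X -> mxmeas Y -> mxmeas (fun t => X t *m Y t).
Proof.
move=> mX mY i j; under eq_fun do rewrite mxE.
by apply: measurable_sum => l; exact: measurable_funM.
Qed.

Lemma mxmeas_add m n (X Y : T -> 'M[R]_(m, n)) :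
  mxmeas X -> mxmeas Y -> mxmeas (fun t => X t + Y t).
Proof. by move=> mX mY i j; under eq_fun do rewrite mxE; exact: measurable_funD. Qed.

Lemma mxmeas_opp m n (X : T -> 'M[R]_(m, n)) :
  mxmeas X -> mxmeas (fun t => - X t).
Proof. by move=> mX i j; under eq_fun do rewrite mxE; exact: measurableT_comp. Qed.

Lemma mxmeas_tr m n (X : T -> 'M[R]_(m, n)) :
  mxmeas X -> mxmeas (fun t => (X t)^T).
Proof. by move=> mX i j; under eq_fun do rewrite mxE; exact: mX. Qed.

Lemma mxmeas_exp n (X : T -> 'M[R]_n) m :
  mxmeas X -> mxmeas (fun t => X t ^+ m).
Proof.
move=> mX; elim: m => [|m IH]; first exact: mxmeas_cst.
by under [X in mxmeas X]eq_fun do rewrite exprS; exact: mxmeas_mul.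
Qed.

Lemma measurable_mxtrace n (X : T -> 'M[R]_n) :
  mxmeas X -> measurable_fun setT (fun t => \tr (X t)).
Proof. by move=> mX; apply: measurable_sum => i; exact: mX. Qed.

Lemma measurable_dotm m n (X Y : T -> 'M[R]_(m, n)) :
  mxmeas X -> mxmeas Y -> measurable_fun setT (fun t => dotm (X t) (Y t)).
Proof.
by move=> mX mY; apply: measurable_mxtrace; apply: mxmeas_mul => //; exact: mxmeas_tr.
Qed.

Lemma measurable_fnorm m n (X : T -> 'M[R]_(m, n)) :
  mxmeas X -> measurable_fun setT (fun t => fnorm (X t)).
Proof.
move=> mX; apply: (@measurableT_comp _ _ _ _ _ _ (@Num.sqrt R)).
  by apply: continuous_measurable_fun; exact: sqrt_continuous.
exact: measurable_dotm.
Qed.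

(* [\sum_j q (lam_j ^ 2)] is a combination of traces of powers of [- (J M)^2] for every
   polynomial [q]; Bernstein polynomials pass to the limit [q s = G (sqrt s)]. *)
Lemma measurable_entropy k p (B : T -> 'M[R]_(k + k, p)) :
  mxmeas B -> measurable_fun setT (fun t => entropy (B t *m (B t)^T)).
Proof.
move=> mB; pose M t := B t *m (B t)^T.
have mM : mxmeas M by apply: mxmeas_mul => //; exact: mxmeas_tr.
pose h (s : R) := Gfun (Num.sqrt s).
pose N t := - ((Jmx R k *m M t) *m (Jmx R k *m M t)).
have mN : mxmeas N.
  by apply: mxmeas_opp; apply: mxmeas_mul; apply: mxmeas_mul => //; exact: mxmeas_cst.
pose S (q : {poly R}) t := \sum_(i < size q) q`_i * (2^-1 * \tr (N t ^+ i)).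
have SE q t : S q t = \sum_j q.[symp_eigs (M t) 0 j ^+ 2].
  have [_ cA] := symp_eigsP (B t).
  rewrite /S; under [RHS]eq_bigr do rewrite horner_coef.
  rewrite exchange_big/=; apply: eq_bigr => i _; rewrite -mulr_sumr.
  by rewrite (trace_opp_sqr_exp i cA) mulKf.
apply: (@measurable_fun_cvg _ _ _ _ (fun m => S (bernstein_approx h m))).
  move=> m; apply: measurable_sum => i; apply: measurable_funM => //.
  by apply: measurable_funM => //; apply: measurable_mxtrace; exact: mxmeas_exp.
move=> t _ /=; have [lam0 _] := symp_eigsP (B t).
under eq_fun do rewrite SE.
rewrite /entropy -/(M t).
apply: cvg_big => [|j _]; first exact: add_continuous.
have -> : Gfun (symp_eigs (M t) 0 j) = h (symp_eigs (M t) 0 j ^+ 2).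
  by rewrite /h sqrtr_sqr ger0_norm ?lam0.
apply: (@bernstein_approx_cvg _ _ 3) => //; first exact: sqr_ge0.
  exact: continuous_Gfun_sqrt.
move=> u u0; apply: le_trans (Gfun_growth (sqrtr_ge0 _)) _.
have : Num.sqrt u <= 1 + u.
  have := sqr_ge0 (Num.sqrt u - 1); rewrite sqrrB1 sqr_sqrtr//.
  have := sqrtr_ge0 u; lra.
lra.
Qed.

End MatrixMeasurability.

(** * Haar averages *)

Section Eta.
Variable R : realType.
Implicit Types (x y : R[i]).

Lemma ReD x y : complex.Re (x + y) = complex.Re x + complex.Re y.
Proof. by case: x y => [? ?] [? ?]. Qed.

Lemma ImD x y : complex.Im (x + y) = complex.Im x + complex.Im y.
Proof. by case: x y => [? ?] [? ?]. Qed.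

Lemma ReM x y :
  complex.Re (x * y) = complex.Re x * complex.Re y - complex.Im x * complex.Im y.
Proof. by case: x y => [? ?] [? ?]. Qed.

Lemma ImM x y :
  complex.Im (x * y) = complex.Re x * complex.Im y + complex.Im x * complex.Re y.
Proof. by case: x y => [? ?] [? ?]. Qed.

Lemma Re_sum (I : Type) (r : seq I) (F : I -> R[i]) :
  complex.Re (\sum_(i <- r) F i) = \sum_(i <- r) complex.Re (F i).
Proof. by elim/big_rec2: _ => [|i a b _ <-] //; rewrite ReD. Qed.

Lemma Im_sum (I : Type) (r : seq I) (F : I -> R[i]) :
  complex.Im (\sum_(i <- r) F i) = \sum_(i <- r) complex.Im (F i).
Proof. by elim/big_rec2: _ => [|i a b _ <-] //; rewrite ImD. Qed.

Lemma eta_mul n (U V : 'M[R[i]]_n) : eta (U *m V) = eta U *m eta V.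
Proof.
rewrite /eta mulmx_block; congr block_mx; apply/matrixP => i j;
  rewrite !mxE ?Re_sum ?Im_sum.
- by rewrite -big_split; apply: eq_bigr => l _; rewrite !mxE ReM mulrN.
- by rewrite -big_split; apply: eq_bigr => l _; rewrite !mxE ImM.
- rewrite -sumrN -big_split; apply: eq_bigr => l _; rewrite !mxE ImM opprD addrC.
  by rewrite mulNr mulrN.
- rewrite -big_split; apply: eq_bigr => l _; rewrite !mxE ReM mulNr addrC.
  by [].
Qed.

Lemma eta_adjc n (U : 'M[R[i]]_n) : eta (adjc U) = (eta U)^T.
Proof.
rewrite /eta tr_block_mx; congr block_mx; apply/matrixP => i j; rewrite !mxE;
  by case: (U j i) => a b //=; rewrite opprK.
Qed.

Lemma eta_add n (U V : 'M[R[i]]_n) : eta (U + V) = eta U + eta V.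
Proof.
rewrite /eta add_block_mx; congr block_mx; apply/matrixP => i j;
  by rewrite !mxE ?ReD ?ImD ?opprD.
Qed.

Lemma eta_scale n (a : R) (U : 'M[R[i]]_n) : eta (real_complex R a *: U) = a *: eta U.
Proof.
rewrite /eta scale_block_mx; congr block_mx; apply/matrixP => i j;
  by rewrite !mxE ?ReM ?ImM/= mul0r ?addr0 ?subr0 ?mulrN.
Qed.

Lemma eta1 n : eta (1%:M : 'M[R[i]]_n) = 1%:M.
Proof.
rewrite /eta scalar_mx_block; congr block_mx; apply/matrixP => i j; rewrite !mxE;
  by case: (i == j); rewrite ?oppr0.
Qed.

Lemma eta_inj n : injective (@eta R n).
Proof.
move=> U V /eq_block_mx[/matrixP hR /matrixP hI _ _]; apply/matrixP => i j.
move: (hR i j) (hI i j); rewrite !mxE; case: (U i j) (V i j) => [a b] [c d] /=.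
by move=> -> ->.
Qed.

(** Turns unitarity of [U] into orthogonality of [eta U], so that all later computations take place
    with real matrices and the Frobenius inner product. *)
Lemma unitaryE n (U : 'M[R[i]]_n) : unitary U <-> eta U *m (eta U)^T = 1%:M.
Proof.
rewrite -eta_adjc -eta_mul -eta1; split => [->//|/eta_inj]; exact.
Qed.

Lemma unitary_ortho n (U : 'M[R[i]]_n) : unitary U -> (eta U)^T *m eta U = 1%:M.
Proof. by move=> /unitaryE /mulmx1C. Qed.

Lemma unitary_mul n (U V : 'M[R[i]]_n) : unitary U -> unitary V -> unitary (U *m V).
Proof.
move=> /unitaryE hU /unitaryE hV; apply/unitaryE.
by rewrite eta_mul trmx_mul mulmxA -[_ *m eta V *m _]mulmxA hV mulmx1.
Qed.

Lemma unitary_adjc n (U : 'M[R[i]]_n) : unitary U -> unitary (adjc U).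
Proof. by move=> /unitary_ortho h; apply/unitaryE; rewrite eta_adjc trmxK. Qed.

End Eta.

(** * Expectations of bounded observables under the Haar measure *)

Section Haar.
Variables (R : realType) (n : nat).
Local Notation T := (cmxMeas R n).

Lemma measurable_Re (i j : 'I_n) : measurable_fun setT (fun U : T => complex.Re (U i j)).
Proof.
move=> _ Y mY; rewrite setTI; apply: sub_sigma_algebra.
by exists i, j, Y; split => //; left.
Qed.

Lemma measurable_Im (i j : 'I_n) : measurable_fun setT (fun U : T => complex.Im (U i j)).
Proof.
move=> _ Y mY; rewrite setTI; apply: sub_sigma_algebra.
by exists i, j, Y; split => //; right.
Qed.

Lemma mxmeas_eta : mxmeas (fun U : T => eta U).
Proof.
move=> i j; case: (split_ordP i) => i' ->; case: (split_ordP j) => j' ->; rewrite /eta.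
- by under eq_fun do rewrite block_mxEul mxE; exact: measurable_Re.
- by under eq_fun do rewrite block_mxEur mxE; exact: measurable_Im.
- under eq_fun do rewrite block_mxEdl !mxE.
  by apply: measurableT_comp => //; exact: measurable_Im.
- by under eq_fun do rewrite block_mxEdr mxE; exact: measurable_Re.
Qed.

Definition Un : set T := [set U | unitary U].

Lemma measurable_Un : measurable Un.
Proof.
have -> : Un = (fun U : T => fnorm (eta U *m (eta U)^T - 1%:M)) @^-1` [set 0].
  apply/seteqP; split => U /=.
    by move=> /unitaryE ->; rewrite subrr /fnorm dotm0r sqrtr0.
  move=> h; apply/unitaryE/eqP; rewrite -subr_eq0; apply/eqP/matrixP => i j.
  have := entry_le_fnorm (eta U *m (eta U)^T - 1%:M) i j.
  by rewrite h normr_le0 => /eqP ->; rewrite mxE.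
rewrite -[X in measurable X]setTI.
have : measurable_fun setT (fun U : T => fnorm (eta U *m (eta U)^T - 1%:M)).
  apply: measurable_fnorm; apply: mxmeas_add; last exact: mxmeas_cst.
  apply: mxmeas_mul; first exact: mxmeas_eta.
  by apply: mxmeas_tr; exact: mxmeas_eta.
by apply => //; exact: measurable_set1.
Qed.

Lemma measurable_mull (V : 'M[R[i]]_n) : measurable_fun setT (fun U : T => V *m U : T).
Proof.
apply: (@measurability _ _ T T setT (fun U : T => V *m U : T) (@cmx_gen R n) erefl).
have mVU : mxmeas (fun U : T => eta (V *m U)).
  under [X in mxmeas X]eq_fun do rewrite eta_mul.
  by apply: mxmeas_mul; [exact: mxmeas_cst|exact: mxmeas_eta].
move=> _ [C [i [j [B [mB [->|->]]]]] <-].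
- have := mVU (lshift n i) (lshift n j) => /(_ measurableT B mB).
  by congr (measurable (_ `&` _)); apply/seteqP; split => U /=;
     rewrite /eta block_mxEul [map_mx _ _ _ _]mxE.
- have := mVU (lshift n i) (rshift n j) => /(_ measurableT B mB).
  by congr (measurable (_ `&` _)); apply/seteqP; split => U /=;
     rewrite /eta block_mxEur [map_mx _ _ _ _]mxE.
Qed.

Variables (P : probability T R) (hP : haar_prob P).

(** Integration is restricted to the full-measure set [Un]: the observables are built from
    polynomials in the entries, which are bounded there but not on the whole matrix space. *)
Definition Ex (g : T -> R) : R := \int[P]_(U in Un) g U.

(** A class stable under ring operations, [expR] and left translation by unitaries, in which
    integrability is automatic. *)
Definition bm (g : T -> R) : Prop :=
  measurable_fun setT g /\ exists K, forall U : T, unitary U -> `|g U| <= K.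

Lemma P_Un : P Un = 1%E. Proof. by case: hP. Qed.

Lemma bm_cst c : bm (fun=> c).
Proof. by split; [exact: measurable_cst|exists `|c|]. Qed.

Lemma bmD f g : bm f -> bm g -> bm (fun U => f U + g U).
Proof.
move=> [mf [K hK]] [mg [L hL]]; split; first exact: measurable_funD.
by exists (K + L) => U uU; apply: le_trans (ler_normD _ _) (lerD (hK _ uU) (hL _ uU)).
Qed.

Lemma bmM f g : bm f -> bm g -> bm (fun U => f U * g U).
Proof.
move=> [mf [K hK]] [mg [L hL]]; split; first exact: measurable_funM.
by exists (K * L) => U uU; rewrite normrM ler_pM ?hK ?hL.
Qed.

Lemma bmN f : bm f -> bm (fun U => - f U).
Proof.
move=> [mf [K hK]]; split; first exact: measurableT_comp.
by exists K => U uU; rewrite normrN hK.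
Qed.

Lemma bmB f g : bm f -> bm g -> bm (fun U => f U - g U).
Proof. by move=> bf bg; apply: bmD => //; exact: bmN. Qed.

Lemma bmZ c f : bm f -> bm (fun U => c * f U).
Proof. by move=> bf; apply: bmM => //; exact: bm_cst. Qed.

Lemma bm_norm f : bm f -> bm (fun U => `|f U|).
Proof.
move=> [mf [K hK]]; split; first exact: measurableT_comp.
by exists K => U uU; rewrite normr_id hK.
Qed.

Lemma bm_expR f : bm f -> bm (fun U => expR (f U)).
Proof.
move=> [mf [K hK]]; split; first exact: measurableT_comp.
exists (expR K) => U uU; rewrite ger0_norm ?expR_ge0// ler_expR.
exact: le_trans (ler_norm _) (hK _ uU).
Qed.

Lemma bm_sum (I : Type) (r : seq I) (F : I -> T -> R) :
  (forall i, bm (F i)) -> bm (fun U => \sum_(i <- r) F i U).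
Proof.
move=> bF; elim: r => [|i r IH].
  by under [X in bm X]eq_fun do rewrite big_nil; exact: bm_cst.
by under [X in bm X]eq_fun do rewrite big_cons; exact: bmD.
Qed.

Lemma bm_mull V f : unitary V -> bm f -> bm (fun U : T => f (V *m U)).
Proof.
move=> uV [mf [K hK]]; split.
  by apply: (measurableT_comp mf); exact: measurable_mull.
by exists K => U uU; apply: hK; exact: unitary_mul.
Qed.

Lemma bm_integrable f : bm f -> P.-integrable Un (EFin \o f).
Proof.
move=> [mf [K hK]]; apply: measurable_bounded_integrable.
- exact: measurable_Un.
- by have h : (P Un < +oo)%E by rewrite P_Un ltry.
- exact: measurable_funTS.
- exists K; split; first exact: num_real.
  by move=> x Kx U /= uU; apply: le_trans (hK _ uU) (ltW Kx).
Qed.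

Lemma ExD f g : bm f -> bm g -> Ex (fun U => f U + g U) = Ex f + Ex g.
Proof.
by move=> bf bg; apply: RintegralD; [exact: measurable_Un|exact: bm_integrable..].
Qed.

Lemma ExB f g : bm f -> bm g -> Ex (fun U => f U - g U) = Ex f - Ex g.
Proof.
by move=> bf bg; apply: RintegralB; [exact: measurable_Un|exact: bm_integrable..].
Qed.

Lemma ExZ c f : bm f -> Ex (fun U => c * f U) = c * Ex f.
Proof.
by move=> bf; apply: RintegralZl; [exact: measurable_Un|exact: bm_integrable].
Qed.

Lemma Ex_cst c : Ex (fun=> c) = c.
Proof.
have h : fine (P Un) = 1 by rewrite P_Un.
rewrite /Ex Rintegral_cst; last exact: measurable_Un.
by transitivity (c * 1); [congr (_ * _)|rewrite mulr1].
Qed.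

Lemma Ex_sum (I : Type) (r : seq I) (F : I -> T -> R) : (forall i, bm (F i)) ->
  Ex (fun U => \sum_(i <- r) F i U) = \sum_(i <- r) Ex (F i).
Proof.
move=> bF; elim: r => [|i r IH].
  by under [X in Ex X]eq_fun do rewrite big_nil; rewrite big_nil Ex_cst.
under [X in Ex X]eq_fun do rewrite big_cons.
by rewrite ExD ?IH ?big_cons//; exact: bm_sum.
Qed.

Lemma Ex_le f g : bm f -> bm g -> (forall U : T, unitary U -> f U <= g U) ->
  Ex f <= Ex g.
Proof.
move=> bf bg fg; apply: le_Rintegral => //; first exact: measurable_Un.
- exact: bm_integrable.
- exact: bm_integrable.
Qed.

Lemma Ex_eq f g : (forall U : T, unitary U -> f U = g U) -> Ex f = Ex g.
Proof. by move=> fg; apply: eq_Rintegral => U /set_mem; exact: fg. Qed.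

(** Invariance on measurable sets says that the image of [P] under left translation is [P]; the
    change of variables applies because [Un] is its own preimage. *)
Lemma Ex_mull V f : unitary V -> bm f -> Ex (fun U : T => f (V *m U)) = Ex f.
Proof.
move=> uV bf; rewrite /Ex /Rintegral; congr fine.
pose phi (U : T) : T := V *m U.
have mphi : measurable_fun setT phi by exact: measurable_mull.
have phiUn : phi @^-1` Un = Un.
  apply/seteqP; split => U /=; rewrite /Un /phi /=; last exact: unitary_mul.
  move=> /(unitary_mul (unitary_adjc uV)); by rewrite mulmxA (mulmx1C uV) mul1mx.
have -> : (\int[P]_(U in Un) (f (V *m U))%:E =
    \int[P]_(U in phi @^-1` Un) ((EFin \o f) \o phi) U)%E by rewrite phiUn.
rewrite -(integral_pushforward mphi _ _ measurable_Un).
- apply: eq_measure_integral => A mA _; rewrite /pushforward.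
  by case: hP => _ /(_ V uV A mA).
- by apply/measurable_EFinP; exact: bf.1.
- rewrite phiUn; apply: (@bm_integrable (fun U => f (phi U))); exact: bm_mull.
Qed.

(** The set [A] may leave [Un], but only by a null set, so hypotheses on unitary points suffice. *)
Lemma Ex_markov f (A : set T) a : bm f -> measurable A ->
  (forall U : T, unitary U -> 0 <= f U) ->
  (forall U : T, unitary U -> A U -> a <= f U) -> 0 <= a ->
  (a%:E * P A <= (Ex f)%:E)%E.
Proof.
move=> bf mA f0 fa a0.
have mU := measurable_Un.
have PA : (P A <= P (A `&` Un))%E.
  have hC : P (~` Un) = 0%E.
    by rewrite probability_setC// P_Un subee.
  have : (P A <= P ((A `&` Un) `|` ~` Un))%E.
    apply: le_measure; rewrite ?inE//.
      by apply: measurableU; [exact: measurableI|exact: measurableC].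
    by move=> U AU; case: (pselect (Un U)) => h; [left|right].
  move=> /le_trans; apply.
  apply: le_trans (measureU2 _ _ _) _; [exact: measurableI|exact: measurableC|].
  by rewrite (_ : _ (~` Un) = 0%E) ?adde0//; exact: hC.
have mI : measurable_fun setT (\1_A : T -> R) by exact: measurable_indic.
have bI : bm (\1_A : T -> R).
  split => //; exists 1 => U _; rewrite indicE.
  by case: (_ \in _); rewrite ?normr1 ?normr0.
have EI : Ex \1_A = fine (P (A `&` Un)) by rewrite /Ex /Rintegral integral_indic.
have : Ex (fun U => a * \1_A U) <= Ex f.
  apply: Ex_le => //; first exact: bmZ.
  move=> U uU; rewrite indicE; have [AU|AU] := boolP (U \in A).
    by rewrite mulr1; apply: fa => //; exact: set_mem.
  by rewrite mulr0 f0.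
rewrite ExZ// EI -lee_fin EFinM => h; apply: le_trans h.
apply: (@le_trans _ _ (a%:E * P (A `&` Un))%E); first by rewrite lee_wpmul2l ?lee_fin.
rewrite fineK//; exact: fin_num_measure (measurableI _ _ mA mU).
Qed.

End Haar.

(** * Small steps on the unitary group *)

Section Generators.
Variables (R : realType) (n : nat).

(* All ordered pairs are used: a spanning family of the Lie algebra of U(n), with
   repetitions and (for [E_pp - E_pp]) zeros, which keeps the sums below uniform. *)
Definition genidx : finType := (bool * ('I_n * 'I_n))%type.

Definition genC (a : genidx) : 'M[R[i]]_n :=
  if a.1 then delta_mx a.2.1 a.2.2 - delta_mx a.2.2 a.2.1
  else Complex 0 1 *: (delta_mx a.2.1 a.2.2 + delta_mx a.2.2 a.2.1).

Definition genA (a : genidx) : 'M[R]_(n + n) := eta (genC a).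

(** Minus the nonzero eigenvalue of the square of a nonzero generator: for [p = q] such a generator
    is [2 i E_pp], hence 4. *)
Definition galpha (a : genidx) : R := if a.2.1 == a.2.2 then 4 else 1.

Lemma genAE (a : genidx) :
  genA a = let E := delta_mx a.2.1 a.2.2 in let F := delta_mx a.2.2 a.2.1 in
    if a.1 then block_mx (E - F) 0 0 (E - F)
    else block_mx 0 (E + F) (- (E + F)) 0.
Proof.
rewrite /genA /genC; case: a => -[] [p q] /=; rewrite /eta.
- congr block_mx; apply/matrixP => i j; rewrite !mxE;
    by case: (_ && _); case: (_ && _); rewrite /= ?subrr ?subr0 ?sub0r ?oppr0.
- congr block_mx; apply/matrixP => i j; rewrite !mxE;
    by case: (_ && _); case: (_ && _); 
      rewrite /= ?(mul0r, mulr0, mul1r, mulr1, subr0, add0r, addr0, oppr0, subrr).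
Qed.

Lemma genA_tr a : (genA a)^T = - genA a.
Proof.
rewrite genAE; case: a => -[] [p q] /=; rewrite tr_block_mx opp_block_mx !trmx0 !oppr0;
  congr block_mx; rewrite !(linearN, linearB, linearD)/= !trmx_delta ?opprB ?opprK//.
- by rewrite addrC.
- by rewrite addrC.
- by rewrite addrC.
- by rewrite addrC.
Qed.

Lemma genA_cube a : genA a *m genA a *m genA a = - (galpha a *: genA a).
Proof.
rewrite genAE /galpha; case: a => -[] [p q] /=.
  have D3 : (delta_mx p q - delta_mx q p) *m (delta_mx p q - delta_mx q p) *m
      (delta_mx p q - delta_mx q p) =
      - ((if p == q then 4 else 1) *: (delta_mx p q - delta_mx q p)) :> 'M[R]_n.
    have [->|pq] := eqVneq p q; first by rewrite subrr !mul0mx scaler0 oppr0.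
    have qp : (q == p) = false by rewrite eq_sym (negPf pq).
    rewrite scale1r !(mulmxBl, mulmxBr) !mul_delta_mx_cond (negPf pq) qp !eqxx.
    rewrite !(mulr1n, mulr0n) !(mulmxBl, mulmxBr, mul0mx, sub0r, mulNmx, subr0) .
    by rewrite !mul_delta_mx_cond (negPf pq) qp !eqxx
      !(mulr1n, mulr0n, subr0, sub0r, opprK, oppr0, addr0, add0r) opprB addrC.
  rewrite !mulmx_block !(mul0mx, mulmx0, addr0, add0r) scale_block_mx opp_block_mx.
  by rewrite !scaler0 !oppr0 D3.
have S3 : (delta_mx p q + delta_mx q p) *m (delta_mx p q + delta_mx q p) *m
    (delta_mx p q + delta_mx q p) =
    (if p == q then 4 else 1) *: (delta_mx p q + delta_mx q p) :> 'M[R]_n.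
  have [->|pq] := eqVneq p q.
    rewrite -mulr2n !(mulmxDl, mulmxDr) -!mulr2n.
    rewrite !mul_delta_mx !mulr2n; move: (delta_mx q q) => x.
    by apply/matrixP => i j; rewrite !mxE; ring.
  have qp : (q == p) = false by rewrite eq_sym (negPf pq).
  rewrite scale1r !(mulmxDl, mulmxDr) !mul_delta_mx_cond (negPf pq) qp !eqxx.
  rewrite !(mulr1n, mulr0n) !(mulmxDl, mulmxDr, mul0mx, add0r, addr0).
  by rewrite !mul_delta_mx_cond (negPf pq) qp !eqxx
      !(mulr1n, mulr0n, addr0, add0r).
rewrite !mulmx_block !(mul0mx, mulmx0, addr0, add0r) scale_block_mx opp_block_mx.
by rewrite !scaler0 !oppr0 !(mulmxN, mulNmx) !opprK scalerN opprK S3.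
Qed.

(* As [A^3 = - alpha A], the matrix [1 + s A + d A^2] is orthogonal as soon as
   [2 d - alpha d^2 = s^2]; [gdelta] is the small root. *)
Definition gdelta a (s : R) : R := s ^+ 2 / (1 + Num.sqrt (1 - galpha a * s ^+ 2)).

Lemma galpha_bounds a : 0 <= galpha a <= 4.
Proof. by rewrite /galpha; case: ifP => _; apply/andP; split; lra. Qed.

(** [gdelta] is [(1 - sqrt (1 - alpha s^2)) / alpha] with its numerator rationalised, which makes
    the size [s^2] visible. The radicand is nonnegative because [alpha <= 4] and [s^2 <= 1/4]. *)
Lemma gdeltaP a s : s ^+ 2 <= 4^-1 ->
  [/\ 0 <= gdelta a s, gdelta a s <= s ^+ 2 &
      2 * gdelta a s - galpha a * gdelta a s ^+ 2 = s ^+ 2].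
Proof.
move=> hs; have /andP[al0 al4] := galpha_bounds a; rewrite /gdelta.
have s0 := sqr_ge0 s; set r := Num.sqrt _.
have r0 : 0 <= r by exact: sqrtr_ge0.
have rr : r ^+ 2 = 1 - galpha a * s ^+ 2 by rewrite sqr_sqrtr//; nra.
have r1 : 0 < 1 + r by lra.
split; first by rewrite divr_ge0// ltW.
  by rewrite ler_pdivrMr//; nra.
have -> : 2 * (s ^+ 2 / (1 + r)) - galpha a * (s ^+ 2 / (1 + r)) ^+ 2 =
    s ^+ 2 * (2 * (1 + r) - galpha a * s ^+ 2) / (1 + r) ^+ 2 by field; rewrite gt_eqF.
have -> : galpha a * s ^+ 2 = 1 - r ^+ 2 by rewrite rr; ring.
by field; rewrite gt_eqF.
Qed.

Definition stepC a s : 'M[R[i]]_n :=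
  1%:M + (real_complex R s *: genC a + real_complex R (gdelta a s) *: (genC a *m genC a)).

Lemma eta_stepC a s : eta (stepC a s) =
  1%:M + (s *: genA a + gdelta a s *: (genA a *m genA a)).
Proof. by rewrite /stepC !eta_add eta1 !eta_scale eta_mul. Qed.

Lemma eta_stepCN a s : eta (stepC a (- s)) = (eta (stepC a s))^T.
Proof.
rewrite !eta_stepC !linearD/= !linearZ/= trmx_mul trmx1 genA_tr mulNmx mulmxN opprK.
by rewrite scalerN scaleNr /gdelta sqrrN.
Qed.

(** By antisymmetry [V V^T = (1 + d A^2)^2 - s^2 A^2], and [A^4 = - alpha A^2] reduces this to
    [1 + (2 d - alpha d^2 - s^2) A^2]. *)
Lemma unitary_stepC a s : s ^+ 2 <= 4^-1 -> unitary (stepC a s).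
Proof.
move=> hs; have [_ _ E] := gdeltaP a hs.
apply/unitaryE; rewrite -eta_stepCN !eta_stepC.
have -> : gdelta a (- s) = gdelta a s by rewrite /gdelta sqrrN.
set d := gdelta a s in E *; set A := genA a.
have A3 : A *m (A *m A) = - (galpha a *: A) by rewrite mulmxA genA_cube.
rewrite !(mulmxDl, mulmxDr, mul1mx, mulmx1).
rewrite -!(scalemxAl, scalemxAr) !scalerA.
have -> : A *m A *m A = - (galpha a *: A) by rewrite genA_cube.
rewrite -[A *m A *m (A *m A)]mulmxA A3 mulmxN -scalemxAr.
set B := A *m A.
have -> : d *: B = (2^-1 * s ^+ 2 + 2^-1 * (galpha a * d ^+ 2)) *: B.
  by congr (_ *: _); rewrite -E; field.
clear A3; move: B (A) => B' A'; apply/matrixP => i j; rewrite !mxE; by field.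
Qed.

Lemma stepCK a s : s ^+ 2 <= 4^-1 -> stepC a (- s) *m stepC a s = 1%:M.
Proof.
move=> hs; apply: (@eta_inj R n); rewrite eta_mul eta_stepCN eta1.
by apply: unitary_ortho; exact: unitary_stepC.
Qed.

Lemma dotm_block (A B C D A' B' C' D' : 'M[R]_n) :
  dotm (block_mx A B C D) (block_mx A' B' C' D') =
  dotm A A' + dotm B B' + dotm C C' + dotm D D'.
Proof.
rewrite /dotm tr_block_mx mulmx_block mxtrace_block !linearD/=.
by rewrite addrACA -!addrA; congr (_ + _); rewrite addrCA.
Qed.

Lemma dotm_delta p q (Y : 'M[R]_n) : dotm (delta_mx p q) Y = Y p q.
Proof.
rewrite dotmE (bigD1 p)//= (bigD1 q)//= !big1 ?addr0.
- by rewrite mxE !eqxx mul1r.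
- by move=> i ip; apply: big1 => j _; rewrite mxE (negPf ip) mul0r.
- by move=> j jq; rewrite mxE (negPf jq) andbF mul0r.
Qed.

Lemma sum_genidx (V : nmodType) (W : genidx -> V) :
  \sum_a W a = \sum_p \sum_q (W (true, (p, q)) + W (false, (p, q))).
Proof.
transitivity (\sum_(b : bool) \sum_(pq : 'I_n * 'I_n) W (b, pq)).
  by rewrite pair_big; apply: eq_bigr => -[].
rewrite big_bool/= -big_split/= pair_big/=; apply: eq_bigr => -[p q] _ //.
Qed.

(** A Bessel inequality for the family of generators. Each square of a signed sum of four entries
    costs a factor 4, and every entry is met for both orders of its index pair, whence 8. *)
Lemma sum_genA_sqr (Y : 'M[R]_(n + n)) :
  \sum_a dotm (genA a) Y ^+ 2 <= 8 * dotm Y Y.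
Proof.
rewrite sum_genidx -[Y]submxK.
set Y1 := ulsubmx Y; set Y2 := ursubmx Y; set Y3 := dlsubmx Y; set Y4 := drsubmx Y.
rewrite dotm_block.
pose W p q := Y1 p q ^+ 2 + Y2 p q ^+ 2 + Y3 p q ^+ 2 + Y4 p q ^+ 2.
have WE : \sum_p \sum_q W p q = dotm Y1 Y1 + dotm Y2 Y2 + dotm Y3 Y3 + dotm Y4 Y4.
  rewrite !dotmE -!big_split; apply: eq_bigr => p _; rewrite -!big_split.
  by apply: eq_bigr => q _; rewrite -!expr2.
rewrite -WE.
have -> : 8 * \sum_p \sum_q W p q = \sum_p \sum_q (4 * W p q + 4 * W q p).
  have -> : \sum_p \sum_q (4 * W p q + 4 * W q p) =
      \sum_p \sum_q 4 * W p q + \sum_p \sum_q 4 * W q p.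
    by rewrite -big_split; apply: eq_bigr => p _; rewrite -big_split.
  rewrite [X in _ = _ + X]exchange_big/=.
  under [X in _ = X + _]eq_bigr do rewrite -mulr_sumr.
  under [X in _ = _ + X]eq_bigr do rewrite -mulr_sumr.
  by rewrite -!mulr_sumr; lra.
apply: ler_sum => p _; apply: ler_sum => q _.
rewrite !genAE /= !dotm_block !dotmBl !dotmNl !dotmDl !dotm_delta.
rewrite ![dotm 0 _]dotmC !dotm0r /W.
move: (Y1 p q) (Y1 q p) (Y2 p q) (Y2 q p) (Y3 p q) (Y3 q p) (Y4 p q) (Y4 q p).
move=> a b c d e f g h.
(* Lagrange's identity: four times a sum of four squares minus the square of the sum is the sum of
   six squared differences. It is used for [a, - b, g, - h] and for [c, d, - e, - f]. *)
have := sqr_ge0 (a + b); have := sqr_ge0 (a - g); have := sqr_ge0 (a + h).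
have := sqr_ge0 (b + g); have := sqr_ge0 (b - h); have := sqr_ge0 (g + h).
have := sqr_ge0 (c - d); have := sqr_ge0 (c + e); have := sqr_ge0 (c + f).
have := sqr_ge0 (d + e); have := sqr_ge0 (d + f); have := sqr_ge0 (e - f).
nra.
Qed.

Lemma delta_mul_delta (X : 'M[R]_n) (p q r t : 'I_n) :
  delta_mx p q *m X *m delta_mx r t = X q r *: delta_mx p t.
Proof.
apply/matrixP => i j; rewrite !mxE (bigD1 r)//= big1 ?addr0; last first.
  by move=> l lr; rewrite !mxE (negPf lr) mulr0.
rewrite !mxE (bigD1 q)//= big1 ?addr0; last first.
  by move=> l lq; rewrite !mxE (negPf lq) andbF mul0r.
by rewrite !mxE !eqxx/= andbT; case: (i == p); case: (j == t); rewrite /= ?(mul1r, mulr1, mul0r, mulr0).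
Qed.

Lemma sum_delta_tr (X : 'M[R]_n) :
  \sum_(p < n) \sum_(q < n) delta_mx p q *m X *m delta_mx p q = X^T :> 'M[R]_n.
Proof.
under eq_bigr do under eq_bigr do rewrite delta_mul_delta.
rewrite [RHS]matrix_sum_delta; apply: eq_bigr => p _; apply: eq_bigr => q _.
by rewrite mxE.
Qed.

Lemma sum_delta_trace (X : 'M[R]_n) :
  \sum_(p < n) \sum_(q < n) delta_mx p q *m X *m delta_mx q p = (\tr X)%:M :> 'M[R]_n.
Proof.
under eq_bigr do under eq_bigr do rewrite delta_mul_delta.
under eq_bigr do rewrite -scaler_suml -/(mxtrace X).
rewrite -scaler_sumr -scalemx1; congr (_ *: _).
by rewrite [RHS]scalar_mx_sum_delta; apply: eq_bigr => i _; rewrite scale1r.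
Qed.

Lemma sum_anti (X : 'M[R]_n) :
  \sum_(p < n) \sum_(q < n) (delta_mx p q - delta_mx q p) *m X *m (delta_mx p q - delta_mx q p)
  = 2 *: X^T - 2 *: (\tr X)%:M.
Proof.
have E (p q : 'I_n) : (delta_mx p q - delta_mx q p) *m X *m (delta_mx p q - delta_mx q p) =
   (delta_mx p q *m X *m delta_mx p q - delta_mx p q *m X *m delta_mx q p) +
   (delta_mx q p *m X *m delta_mx q p - delta_mx q p *m X *m delta_mx p q).
  rewrite !(mulmxBl, mulmxBr).
  move: (delta_mx p q *m X *m delta_mx p q) (delta_mx p q *m X *m delta_mx q p).
  move: (delta_mx q p *m X *m delta_mx q p) (delta_mx q p *m X *m delta_mx p q).
  by move=> a b c d; apply/matrixP => i j; rewrite !mxE; ring.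
under eq_bigr do under eq_bigr do rewrite E.
under eq_bigr do rewrite big_split/= !sumrB.
rewrite big_split/= !sumrB sum_delta_tr sum_delta_trace.
rewrite [X in _ + (X - _)]exchange_big/= sum_delta_tr.
rewrite [X in _ + (_ - X)]exchange_big/= sum_delta_trace.
by rewrite -scalerBr scaler_nat mulr2n.
Qed.

Lemma sum_symm (X : 'M[R]_n) :
  \sum_(p < n) \sum_(q < n) (delta_mx p q + delta_mx q p) *m X *m (delta_mx p q + delta_mx q p)
  = 2 *: X^T + 2 *: (\tr X)%:M.
Proof.
have E (p q : 'I_n) : (delta_mx p q + delta_mx q p) *m X *m (delta_mx p q + delta_mx q p) =
   (delta_mx p q *m X *m delta_mx p q + delta_mx p q *m X *m delta_mx q p) +
   (delta_mx q p *m X *m delta_mx q p + delta_mx q p *m X *m delta_mx p q).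
  by rewrite !(mulmxDl, mulmxDr) -!addrA; congr (_ + _); rewrite addrC -!addrA; congr (_ + _); rewrite addrC.
under eq_bigr do under eq_bigr do rewrite E.
under eq_bigr do rewrite !big_split/=.
rewrite !big_split/= sum_delta_tr sum_delta_trace.
rewrite [X in _ + (X + _)]exchange_big/= sum_delta_tr.
rewrite [X in _ + (_ + X)]exchange_big/= sum_delta_trace.
by rewrite -scalerDr scaler_nat mulr2n.
Qed.

End Generators.

(** * The Casimir operator on symmetric matrices and its inverse *)

Section Casimir.
Variables (R : realType) (n : nat).
Local Notation J := (Jmx R n).

Lemma sum_block (I : Type) (r : seq I) (A B C D : I -> 'M[R]_n) :
  \sum_(i <- r) block_mx (A i) (B i) (C i) (D i) =
  block_mx (\sum_(i <- r) A i) (\sum_(i <- r) B i) (\sum_(i <- r) C i) (\sum_(i <- r) D i).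
Proof.
elim: r => [|i r IH]; last by rewrite !big_cons IH add_block_mx.
by rewrite !big_nil /block_mx !row_mx0 col_mx0.
Qed.

(** Blockwise, the sum of [E_pq X E_pq] is the transpose of [X] and the sum of [E_pq X E_qp] is its
    trace times the identity; symmetry of [M] expresses the transposed blocks through [M] and
    [J M J^T]. *)
Lemma casimir (M : 'M[R]_(n + n)) : M^T = M ->
  \sum_a genA R a *m M *m genA R a = 2 *: (M - J *m M *m J^T) - (2 * \tr M)%:M.
Proof.
rewrite -[M]submxK.
set M1 := ulsubmx M; set M2 := ursubmx M; set M3 := dlsubmx M; set M4 := drsubmx M.
move: M1 M2 M3 M4 => M1 M2 M3 M4; rewrite tr_block_mx => /eq_block_mx[t1 t3 t2 t4].
pose D p q : 'M[R]_n := delta_mx p q - delta_mx q p.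
pose S p q : 'M[R]_n := delta_mx p q + delta_mx q p.
rewrite sum_genidx.
transitivity (\sum_p \sum_q block_mx
   (D p q *m M1 *m D p q - S p q *m M4 *m S p q)
   (D p q *m M2 *m D p q + S p q *m M3 *m S p q)
   (D p q *m M3 *m D p q + S p q *m M2 *m S p q)
   (D p q *m M4 *m D p q - S p q *m M1 *m S p q)).
  apply: eq_bigr => p _; apply: eq_bigr => q _; rewrite !genAE /= -/(D p q) -/(S p q).
  rewrite !mulmx_block !(mul0mx, mulmx0, addr0, add0r, mulNmx, mulmxN, opprK).
  by rewrite add_block_mx.
under eq_bigr do rewrite sum_block !sumrB !big_split/=.
rewrite sum_block !sumrB !big_split/= !sum_anti !sum_symm t1 t2 t3 t4.
rewrite /Jmx tr_block_mx !trmx0 linearN/= tr_scalar_mx.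
rewrite !mulmx_block !(mul0mx, mulmx0, addr0, add0r, mulNmx, mulmxN, opprK, mul1mx, mulmx1).
rewrite opp_block_mx add_block_mx scale_block_mx mxtrace_block scalar_mx_block.
have t23 : \tr M2 = \tr M3 by rewrite -t3 mxtrace_tr.
rewrite opp_block_mx add_block_mx t23; congr block_mx; apply/matrixP => i j; rewrite !mxE.
- by case: (i == j); rewrite ?mulr1n ?mulr0n; ring.
- by case: (i == j); rewrite ?mulr1n ?mulr0n; ring.
- by case: (i == j); rewrite ?mulr1n ?mulr0n; ring.
- by case: (i == j); rewrite ?mulr1n ?mulr0n; ring.
Qed.

Lemma casimir1 : \sum_(a : genidx n) genA R a *m genA R a = (- (4 * n%:R))%:M.
Proof.
have := @casimir 1%:M (trmx1 _ _).
under eq_bigr do rewrite mulmx1.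
move=> ->; rewrite mulmx1 Jmx_ortho' subrr scaler0 sub0r mxtrace1 -raddfN.
by congr _%:M; rewrite natrD; ring.
Qed.

(* Inverts the Casimir operator: the Laplacian of the observable attached to [Bp B] is
   minus the (centred) observable attached to [B]. *)
Definition Bp (B : 'M[R]_(n + n)) : 'M[R]_(n + n) :=
  ((2 * n%:R + 1) / (8 * n%:R * (n%:R + 1))) *: B +
  (8 * n%:R * (n%:R + 1))^-1 *: (J *m B *m J^T).

Lemma dotm_Jconj (B X : 'M[R]_(n + n)) :
  dotm B (J *m X *m J^T) = dotm (J *m B *m J^T) X.
Proof.
rewrite dotmC -mulmxA dotm_mull dotm_mulr trmxK dotmC; congr (dotm _ X).
by rewrite tr_Jmx !mulNmx mulmxN.
Qed.

Hypothesis n0 : (0 < n)%N.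
Let nR : 0 < n%:R :> R. Proof. by rewrite ltr0n. Qed.

(** Conjugation by [J] is an isometry and the two coefficients of [Bp] add up to exactly
    [1 / (4 n)]. *)
Lemma fnorm_Bp B : fnorm (Bp B) <= fnorm B / (4 * n%:R).
Proof.
have n1 : 0 < n%:R + 1 :> R by rewrite addr_gt0.
have JB : fnorm (J *m B *m J^T) = fnorm B.
  rewrite fnorm_orthor ?trmxK; last exact: Jmx_ortho.
  by rewrite fnorm_orthol//; exact: Jmx_ortho.
have q0 : 0 < 8 * n%:R * (n%:R + 1) :> R by rewrite !mulr_gt0.
have p0 : 0 <= (2 * n%:R + 1) / (8 * n%:R * (n%:R + 1)) :> R.
  by apply: divr_ge0; [rewrite addr_ge0// mulr_ge0|exact: ltW].
have p1 : 0 <= (8 * n%:R * (n%:R + 1))^-1 :> R by rewrite invr_ge0 ltW.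
apply: le_trans (fnormD _ _) _; rewrite !fnormZ JB (ger0_norm p0) (ger0_norm p1).
by rewrite le_eqVlt; apply/orP; left; apply/eqP; field; rewrite !gt_eqF.
Qed.

(** On traceless symmetric matrices the Laplacian is [- 4 n] where [J M J^T = M] and [- 4 (n + 1)]
    where [J M J^T = - M]. The coefficients of [Bp] have sum [1 / (4 n)] and difference
    [1 / (4 (n + 1))], so both parts are inverted; the trace term supplies the centring by [l]. *)
Lemma casimir_dotm (B M : 'M[R]_(n + n)) l : M^T = M -> \tr M = 2 * n%:R * l ->
  \sum_a (2^-1 * (dotm (Bp B) (genA R a *m genA R a *m M) +
                  dotm (Bp B) (M *m (genA R a *m genA R a))) -
          dotm (Bp B) (genA R a *m M *m genA R a)) = - dotm B (M - l%:M).
Proof.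
move=> Ms trM.
have sc (x : R) (C : 'M[R]_(n + n)) : dotm C x%:M = x * dotm C 1%:M.
  by rewrite -[x%:M]scalemx1 dotmZr.
rewrite sumrB -mulr_sumr big_split/= -!dotm_sumr casimir// -mulmx_suml -mulmx_sumr.
rewrite casimir1 mul_scalar_mx mul_mx_scalar trM /Bp.
rewrite !(dotmBr, dotmZr, dotmDl, dotmZl) dotm_Jconj.
rewrite !(sc l) !(sc (2 * (2 * n%:R * l))).
have JJB : J *m (J *m B *m J^T) *m J^T = B.
  by rewrite !mulmxA JmxJ -!mulmxA -trmx_mul JmxJ linearN/= trmx1 mulNmx mulmxN mulmx1 mul1mx opprK.
rewrite !dotm_Jconj JJB -![dotm (J *m B *m J^T) 1%:M]dotm_Jconj mulmx1 Jmx_ortho'.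
have n1 : 0 < n%:R + 1 :> R by rewrite addr_gt0.
by field; rewrite !gt_eqF.
Qed.

End Casimir.

(** * Taylor expansion of conjugation by a small step *)

Section StepExpansion.
Variables (R : realType) (N : nat).
Implicit Types (A B M : 'M[R]_N).

Lemma step_expand A B M s d : A^T = - A ->
  let V := 1%:M + (s *: A + d *: (A *m A)) in
  dotm B (V *m M *m V^T) = dotm B M +
    s * (dotm B (A *m M) - dotm B (M *m A)) +
    d * (dotm B (A *m A *m M) + dotm B (M *m (A *m A))) -
    s ^+ 2 * dotm B (A *m M *m A) +
    s * d * (dotm B (A *m M *m (A *m A)) - dotm B (A *m A *m M *m A)) +
    d ^+ 2 * dotm B (A *m A *m M *m (A *m A)).
Proof.
move=> AT V; have AAT : (A *m A)^T = A *m A by rewrite trmx_mul AT mulNmx mulmxN opprK.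
have -> : V^T = 1%:M + (s *: - A + d *: (A *m A)).
  by rewrite /V !linearD/= !linearZ/= trmx1 AAT AT.
rewrite /V.
move: (A *m A) {AAT} => A2.
rewrite !(mulmxDl, mulmxDr, mul1mx, mulmx1) -!(scalemxAl, scalemxAr).
rewrite !(dotmDr, dotmZr) !(mulmxN, dotmNr).
by ring.
Qed.

Lemma dotm_commE A B M : M^T = M ->
  dotm B (A *m M) - dotm B (M *m A) = dotm A (B *m M - M *m B).
Proof.
by move=> Ms; rewrite dotmBr ![dotm B _]dotmC dotm_mulr dotm_mull Ms.
Qed.

(** Every word with at most four letters [A] around [M] pairs with [B] to at most [b], as [k >= 1];
    6 and 10 count such terms. In the sum of the steps [s] and [- s] the odd terms cancel, and
    [2 d = s^2 + al d^2] leaves an error of fourth order. *)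
Lemma step_bounds A B M s d al k (V := 1%:M + (s *: A + d *: (A *m A)))
    (V' := 1%:M + (- s *: A + d *: (A *m A))) (b := fnorm B * k ^+ 4 * fnorm M) :
  A^T = - A -> M^T = M -> s ^+ 2 <= 4^-1 -> 0 <= d <= s ^+ 2 -> 0 <= al <= 4 ->
  2 * d - al * d ^+ 2 = s ^+ 2 -> 1 <= k -> fnorm A <= k ->
  `|dotm B (V *m M *m V^T) - dotm B M - s * dotm A (B *m M - M *m B)|
     <= 6 * b * s ^+ 2 /\
  `|dotm B (V *m M *m V^T) + dotm B (V' *m M *m V'^T) - 2 * dotm B M -
    2 * s ^+ 2 * (2^-1 * (dotm B (A *m A *m M) + dotm B (M *m (A *m A)))
       - dotm B (A *m M *m A))| <= 10 * b * (s ^+ 2) ^+ 2.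
Proof.
move=> AT Ms hs /andP[d0 ds] /andP[al0 al4] E k1 Ak.
have k0 : 0 <= k by lra.
have bnd X i : (i <= 4)%N -> fnorm X <= k ^+ i * fnorm M -> `|dotm B X| <= b.
  move=> i4 hX; apply: le_trans (normr_dotm_le _ _) _.
  rewrite /b -mulrA ler_wpM2l ?fnorm_ge0//; apply: (le_trans hX).
  by rewrite ler_wpM2r ?fnorm_ge0// ler_weXn2l.
have fA X i : fnorm X <= k ^+ i * fnorm M -> fnorm (A *m X) <= k ^+ i.+1 * fnorm M.
  move=> hX; apply: le_trans (fnormM _ _) _; rewrite exprS -mulrA.
  by apply: ler_pM => //; exact: fnorm_ge0.
have fA' X i : fnorm X <= k ^+ i * fnorm M -> fnorm (X *m A) <= k ^+ i.+1 * fnorm M.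
  move=> hX; apply: le_trans (fnormM _ _) _; rewrite exprSr mulrAC.
  by apply: ler_pM => //; exact: fnorm_ge0.
have f0 : fnorm M <= k ^+ 0 * fnorm M by rewrite expr0 mul1r.
have bq1 : `|dotm B (A *m A *m M)| <= b.
  by apply: (bnd _ 2) => //; rewrite -mulmxA; do 2 apply: (fA).
have bq2 : `|dotm B (M *m (A *m A))| <= b.
  by apply: (bnd _ 2) => //; rewrite mulmxA; do 2 apply: (fA').
have br : `|dotm B (A *m M *m A)| <= b by apply: (bnd _ 2) => //; apply: fA'; exact: fA.
have bt1 : `|dotm B (A *m M *m (A *m A))| <= b.
  by apply: (bnd _ 3) => //; rewrite mulmxA; do 2 apply: (fA'); exact: fA.
have bt2 : `|dotm B (A *m A *m M *m A)| <= b.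
  by apply: (bnd _ 3) => //; apply: fA'; rewrite -mulmxA; do 2 apply: (fA).
have bw : `|dotm B (A *m A *m M *m (A *m A))| <= b.
  by apply: (bnd _ 4) => //; rewrite mulmxA; do 2 apply: (fA'); rewrite -mulmxA; do 2 apply: (fA).
have b0 : 0 <= b := le_trans (normr_ge0 _) bw.
have V'E : dotm B (V' *m M *m V'^T) = _ := step_expand B M (- s) d AT.
rewrite V'E (step_expand B M s d AT) -dotm_commE// {V'E}.
move: (dotm B (A *m M)) (dotm B (M *m A)) (dotm B M) => u1 u2 u0.
move: bq1 bq2 br bt1 bt2 bw.
move: (dotm B (A *m A *m M)) (dotm B (M *m (A *m A))) (dotm B (A *m M *m A)) => q1 q2 r.
move: (dotm B (A *m M *m (A *m A))) (dotm B (A *m A *m M *m A)) => t1 t2.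
move: (dotm B (A *m A *m M *m (A *m A))) => w bq1 bq2 br bt1 bt2 bw.
have s20 : 0 <= s ^+ 2 := sqr_ge0 s.
split.
  have -> : u0 + s * (u1 - u2) + d * (q1 + q2) - s ^+ 2 * r + s * d * (t1 - t2) + d ^+ 2 * w -
     u0 - s * (u1 - u2) = d * (q1 + q2) - s ^+ 2 * r + s * d * (t1 - t2) + d ^+ 2 * w by ring.
  have n1 : `|d * (q1 + q2)| <= 2 * b * s ^+ 2.
    rewrite normrM (ger0_norm d0).
    have := le_trans (ler_normD q1 q2) (lerD bq1 bq2); have := normr_ge0 (q1 + q2); nra.
  have n2 : `|s ^+ 2 * r| <= b * s ^+ 2 by rewrite normrM (ger0_norm s20) mulrC ler_wpM2r.
  have s1 : `|s| <= 1.
    have := normr_ge0 s; have : `|s| ^+ 2 = s ^+ 2 by rewrite real_normK ?num_real.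
    nra.
  have n3 : `|s * d * (t1 - t2)| <= 2 * b * s ^+ 2.
    rewrite !normrM (ger0_norm d0).
    have h1 := le_trans (ler_normB t1 t2) (lerD bt1 bt2); have h2 := normr_ge0 (t1 - t2).
    have : `|s| * d <= s ^+ 2 by have := normr_ge0 s; nra.
    have : 0 <= `|s| * d by rewrite mulr_ge0.
    move: (`|s| * d) => z; nra.
  have n4 : `|d ^+ 2 * w| <= b * s ^+ 2.
    rewrite normrM (ger0_norm (sqr_ge0 d)).
    have : d ^+ 2 <= s ^+ 2 by nra.
    have := sqr_ge0 d; have := normr_ge0 w; move: (d ^+ 2) => z; nra.
  apply: le_trans (ler_normD _ _) _; apply: le_trans (lerD (ler_normD _ _) n4) _.
  apply: le_trans (lerD (lerD (ler_normB _ _) n3) (lexx _)) _; lra.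
set X := (X in `|X|).
have -> : X = al * d ^+ 2 * (q1 + q2) + 2 * d ^+ 2 * w.
  transitivity (2 * d * (q1 + q2) - s ^+ 2 * (q1 + q2) + 2 * d ^+ 2 * w).
    by rewrite /X; field.
  by rewrite -E; ring.
have d2 : d ^+ 2 <= (s ^+ 2) ^+ 2 by rewrite lerXn2r ?nnegrE.
have d20 := sqr_ge0 d.
move: ((s ^+ 2) ^+ 2) (d ^+ 2) d2 d20 => z y d2 d20.
apply: le_trans (ler_normD _ _) _; rewrite !normrM.
rewrite (ger0_norm al0) (ger0_norm d20) (ger0_norm (ler0n R 2)).
have h1 := le_trans (ler_normD q1 q2) (lerD bq1 bq2); have h2 := normr_ge0 (q1 + q2).
have h3 := normr_ge0 w.
have : al * y <= 4 * z by apply: ler_pM.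
have : 0 <= al * y by rewrite mulr_ge0.
move: (al * y) => v; nra.
Qed.

End StepExpansion.

(** * Stein identity *)

Section Stein.
Variables (R : realType) (n : nat).
Hypothesis n0 : (0 < n)%N.
Local Notation T := (cmxMeas R n).
Local Notation idx := (genidx n).
Variables (P : probability T R) (hP : haar_prob P).

Definition Mg (D : 'M[R]_(n + n)) (U : 'M[R[i]]_n) : 'M[R]_(n + n) :=
  eta U *m D *m (eta U)^T.

Lemma Mg_mul D V U : Mg D (V *m U) = eta V *m Mg D U *m (eta V)^T.
Proof. by rewrite /Mg eta_mul trmx_mul !mulmxA. Qed.

Lemma Mg_sym D U : D^T = D -> (Mg D U)^T = Mg D U.
Proof. by move=> Ds; rewrite /Mg !trmx_mul trmxK Ds mulmxA. Qed.

Lemma fnorm_Mg D U : unitary U -> fnorm (Mg D U) = fnorm D.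
Proof.
move=> uU; have h := unitary_ortho uU.
by rewrite /Mg fnorm_orthor ?trmxK// fnorm_orthol.
Qed.

Lemma mxtrace_Mg D U : unitary U -> \tr (Mg D U) = \tr D.
Proof.
by move=> uU; rewrite /Mg mxtrace_mulC mulmxA unitary_ortho// mul1mx.
Qed.

Lemma Mg_mulmx D D' U : unitary U -> Mg D U *m Mg D' U = Mg (D *m D') U.
Proof.
move=> uU; rewrite /Mg !mulmxA -[_ *m (eta U)^T *m eta U]mulmxA.
by rewrite unitary_ortho// mulmx1.
Qed.

Lemma mxmeas_Mg D : mxmeas (fun U : T => Mg D U).
Proof.
apply: mxmeas_mul; last by apply: mxmeas_tr; exact: mxmeas_eta.
by apply: mxmeas_mul; [exact: mxmeas_eta|exact: mxmeas_cst].
Qed.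

Variables (D : 'M[R]_(n + n)) (l : R).
Hypotheses (Ds : D^T = D) (trD : \tr D = 2 * n%:R * l).

Definition linobs (B : 'M[R]_(n + n)) (U : T) : R := dotm B (Mg D U - l%:M).
(** The gradient of [linobs B] for left translations: by [dotm_commE] its pairing with a generator
    is the derivative of the observable in that direction. *)
Definition YB (B : 'M[R]_(n + n)) (U : T) : 'M[R]_(n + n) := B *m Mg D U - Mg D U *m B.

Lemma linobs_mul B V (U : T) : linobs B (V *m U) =
  dotm B (eta V *m Mg D U *m (eta V)^T) - dotm B l%:M.
Proof. by rewrite /linobs dotmBr Mg_mul. Qed.

Lemma bm_dotm m p (X Y : T -> 'M[R]_(m, p)) KX KY : mxmeas X -> mxmeas Y ->
  (forall U : T, unitary U -> fnorm (X U) <= KX) ->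
  (forall U : T, unitary U -> fnorm (Y U) <= KY) ->
  bm (fun U => dotm (X U) (Y U)).
Proof.
move=> mX mY hX hY; split; first exact: measurable_dotm.
exists (KX * KY) => U uU; apply: le_trans (normr_dotm_le _ _) _.
by apply: ler_pM; rewrite ?fnorm_ge0 ?hX ?hY.
Qed.

Lemma bm_linobs B : bm (linobs B).
Proof.
apply: (@bm_dotm _ _ _ _ (fnorm B) (fnorm D + fnorm (l%:M : 'M[R]_(n + n)))).
- exact: mxmeas_cst.
- by apply: mxmeas_add; [exact: mxmeas_Mg|exact: mxmeas_cst].
- by [].
- by move=> U uU; apply: le_trans (fnormB _ _) _; rewrite fnorm_Mg.
Qed.

Lemma mxmeas_YB B : mxmeas (YB B).
Proof.
apply: mxmeas_add; first by apply: mxmeas_mul; [exact: mxmeas_cst|exact: mxmeas_Mg].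
by apply: mxmeas_opp; apply: mxmeas_mul; [exact: mxmeas_Mg|exact: mxmeas_cst].
Qed.

Lemma fnorm_YB B (U : T) : unitary U -> fnorm (YB B U) <= 2 * (fnorm B * fnorm D).
Proof.
move=> uU; apply: le_trans (fnormB _ _) _.
have := fnormM B (Mg D U); have := fnormM (Mg D U) B; rewrite fnorm_Mg//; lra.
Qed.

Lemma bm_dotmYB A B : bm (fun U => dotm A (YB B U)).
Proof.
apply: (@bm_dotm _ _ _ _ (fnorm A) (2 * (fnorm B * fnorm D))) => //.
- exact: mxmeas_YB.
- by move=> U; exact: fnorm_YB.
Qed.

Lemma bm_YB2 B B' : bm (fun U => dotm (YB B U) (YB B' U)).
Proof.
apply: (@bm_dotm _ _ _ _ (2 * (fnorm B * fnorm D)) (2 * (fnorm B' * fnorm D))).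
- exact: mxmeas_YB.
- exact: mxmeas_YB.
- by move=> U; exact: fnorm_YB.
- by move=> U; exact: fnorm_YB.
Qed.

Definition cidx : R := \sum_(a : idx) 1.
(** A common bound for the generators, at least 1 so that its powers increase. Like [cidx], it
    enters only remainders that vanish with the step size. *)
Definition kap : R := 1 + \sum_(a : idx) fnorm (genA R a).
Definition bnd (B : 'M[R]_(n + n)) : R := fnorm B * kap ^+ 4 * fnorm D.

Lemma kap_ge (a : idx) : fnorm (genA R a) <= kap.
Proof.
rewrite /kap (bigD1 a)//= addrCA lerDl addr_ge0// sumr_ge0// => i _.
exact: fnorm_ge0.
Qed.

Lemma kap_ge1 : 1 <= kap.
Proof. by rewrite lerDl sumr_ge0// => i _; exact: fnorm_ge0. Qed.

Lemma bnd_ge0 B : 0 <= bnd B.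
Proof.
have k0 : 0 <= kap by apply: le_trans kap_ge1.
by apply: mulr_ge0; [apply: mulr_ge0; [|exact: exprn_ge0]|]; exact: fnorm_ge0.
Qed.

Lemma linobs_step_gen (A B : 'M[R]_(n + n)) s d al V1 V2 (U : T) : unitary U ->
  eta V1 = 1%:M + (s *: A + d *: (A *m A)) ->
  eta V2 = 1%:M + (- s *: A + d *: (A *m A)) ->
  A^T = - A -> s ^+ 2 <= 4^-1 -> 0 <= d <= s ^+ 2 -> 0 <= al <= 4 ->
  2 * d - al * d ^+ 2 = s ^+ 2 -> fnorm A <= kap ->
  `|linobs B (V1 *m U) - linobs B U - s * dotm A (YB B U)| <= 6 * bnd B * s ^+ 2 /\
  `|linobs B (V1 *m U) + linobs B (V2 *m U) - 2 * linobs B U -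
    2 * s ^+ 2 * (2^-1 * (dotm B (A *m A *m Mg D U) + dotm B (Mg D U *m (A *m A)))
       - dotm B (A *m Mg D U *m A))| <= 10 * bnd B * (s ^+ 2) ^+ 2.
Proof.
move=> uU E1 E2 AT hs hd hal dE Ak.
have := @step_bounds R _ A B (Mg D U) s d al kap AT (Mg_sym _ Ds) hs hd hal dE kap_ge1 Ak.
rewrite -E1 -E2 fnorm_Mg// -/(bnd B).
have F0 : linobs B U = dotm B (Mg D U) - dotm B l%:M := dotmBr _ _ _.
rewrite !linobs_mul F0 /YB.
move: (dotm B (eta V1 *m _ *m _)) (dotm B (eta V2 *m _ *m _)) => x1 x2.
move: (dotm B (Mg D U)) (dotm B l%:M) => x0 y; move: (dotm A _) (2^-1 * _ - _) => w v.
move=> [h1 h2]; split.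
  by have -> : x1 - y - (x0 - y) - s * w = x1 - x0 - s * w by ring.
by have -> : x1 - y + (x2 - y) - 2 * (x0 - y) - 2 * s ^+ 2 * v = x1 + x2 - 2 * x0 - 2 * s ^+ 2 * v by ring.
Qed.

Lemma eta_stepC_opp (a : idx) (s : R) : eta (stepC a (- s)) =
  1%:M + (- s *: genA R a + gdelta a s *: (genA R a *m genA R a)).
Proof. by rewrite eta_stepC /gdelta sqrrN. Qed.

Lemma linobs_step (a : idx) B s (U : T) : unitary U -> s ^+ 2 <= 4^-1 ->
  `|linobs B (stepC a s *m U) - linobs B U - s * dotm (genA R a) (YB B U)|
    <= 6 * bnd B * s ^+ 2 /\
  `|linobs B (stepC a s *m U) + linobs B (stepC a (- s) *m U) - 2 * linobs B U -
    2 * s ^+ 2 * (2^-1 * (dotm B (genA R a *m genA R a *m Mg D U) +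
       dotm B (Mg D U *m (genA R a *m genA R a)))
       - dotm B (genA R a *m Mg D U *m genA R a))| <= 10 * bnd B * (s ^+ 2) ^+ 2.
Proof.
move=> uU hs; have [d0 ds dE] := gdeltaP a hs.
have hd : 0 <= gdelta a s <= s ^+ 2 by rewrite d0 ds.
exact: (linobs_step_gen B uU (eta_stepC a s) (eta_stepC_opp a s) (genA_tr R a) hs hd
  (galpha_bounds R a) dE (kap_ge a)).
Qed.

(** The symmetric second differences, summed over the generators, form a discrete Laplacian;
    [linobs (Bp B)] solves its Poisson equation up to fourth order. *)
Lemma linobs_laplacian B s (U : T) : unitary U -> s ^+ 2 <= 4^-1 ->
  `|\sum_(a : idx) (linobs (Bp B) (stepC a s *m U) + linobs (Bp B) (stepC a (- s) *m U)
      - 2 * linobs (Bp B) U) + 2 * s ^+ 2 * linobs B U|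
   <= cidx * (10 * bnd (Bp B)) * (s ^+ 2) ^+ 2.
Proof.
move=> uU hs.
have trM : \tr (Mg D U) = 2 * n%:R * l by rewrite mxtrace_Mg.
have := casimir_dotm n0 B (Mg_sym U Ds) trM; rewrite -/(linobs B U) => cas.
have -> : 2 * s ^+ 2 * linobs B U = - \sum_(a : idx) 2 * s ^+ 2 *
    (2^-1 * (dotm (Bp B) (genA R a *m genA R a *m Mg D U) +
       dotm (Bp B) (Mg D U *m (genA R a *m genA R a)))
       - dotm (Bp B) (genA R a *m Mg D U *m genA R a)).
  by rewrite -mulr_sumr cas mulrN opprK.
rewrite -sumrB; apply: le_trans (ler_norm_sum _ _ _) _.
apply: (@le_trans _ _ (\sum_(a : idx) 10 * bnd (Bp B) * (s ^+ 2) ^+ 2)).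
  by apply: ler_sum => a _; have [_] := linobs_step a (Bp B) uU hs.
rewrite -[leRHS]mulrA /cidx mulr_suml.
by apply: ler_sum => a _; rewrite mul1r.
Qed.

(* Reversibility: the two half-steps [s] and [-s] are exchanged by the invariant
   substitution [U -> V_s U]. *)
Lemma Ex_antisym B (h : T -> R) V V' : bm h -> unitary V -> unitary V' ->
  V' *m V = 1%:M ->
  Ex P (fun U => (linobs B (V *m U) + linobs B (V' *m U) - 2 * linobs B U) * h U)
  = - Ex P (fun U => (linobs B (V *m U) - linobs B U) * (h (V *m U) - h U)).
Proof.
move=> bh uV uV' VV.
have b1 : bm (fun U : T => linobs B (V *m U)) by apply: bm_mull => //; exact: bm_linobs.
have b2 : bm (fun U : T => linobs B (V' *m U)) by apply: bm_mull => //; exact: bm_linobs.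
have b3 : bm (fun U : T => h (V *m U)) by exact: bm_mull.
have bF := bm_linobs B.
pose G1 (U : T) := (linobs B (V *m U) - linobs B U) * h U.
pose G2 (U : T) := (linobs B (V' *m U) - linobs B U) * h U.
pose G3 (U : T) := (linobs B (V *m U) - linobs B U) * h (V *m U).
have bG1 : bm G1 by apply: bmM => //; exact: bmB.
have bG2 : bm G2 by apply: bmM => //; exact: bmB.
have bG3 : bm G3 by apply: bmM => //; exact: bmB.
transitivity (Ex P (fun U => G1 U + G2 U)).
  apply: Ex_eq => U _; rewrite /G1 /G2.
  move: (linobs B (V *m U)) (linobs B (V' *m U)) (linobs B U) (h U) => p q r t; ring.
transitivity (- Ex P (fun U => G3 U - G1 U)); last first.
  congr (- _); apply: Ex_eq => U _; rewrite /G3 /G1.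
  move: (linobs B (V *m U)) (h (V *m U)) (linobs B U) (h U) => p q r t; ring.
have e4 : Ex P G2 = - Ex P G3.
  apply: (etrans (esym (Ex_mull hP uV bG2))).
  transitivity (Ex P (fun U => -1 * G3 U)).
    apply: Ex_eq => U _; rewrite /G2 /G3 mulmxA VV mul1mx.
    move: (linobs B (V *m U)) (h (V *m U)) (linobs B U) => p q r; ring.
  by apply: (etrans (ExZ hP _ bG3)); rewrite mulN1r.
apply: (etrans (ExD hP bG1 bG2)); apply: (etrans (congr1 (fun x => Ex P G1 + x) e4)).
apply: esym; apply: (etrans (congr1 -%R (ExB hP bG3 bG1))); exact: opprB.
Qed.

(** Bounds the product of the derivatives of [linobs (Bp B)] and of the test function along one
    generator, the latter being dominated by [g] times the derivative of [linobs B]. *)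
Definition steinW B (g : T -> R) (a : idx) (U : T) : R :=
  `|dotm (genA R a) (YB (Bp B) U)| * (`|dotm (genA R a) (YB B U)| * g U).

Lemma bm_steinW B g a : bm g -> bm (steinW B g a).
Proof.
move=> bg; apply: bmM; first by apply: bm_norm; exact: bm_dotmYB.
by apply: bmM => //; apply: bm_norm; exact: bm_dotmYB.
Qed.

(** Multiply the discrete Poisson equation by [h]; reversibility replaces second differences by
    products of first differences, which the first-order expansions bound by [s^2 steinW]. The
    constants [K1] to [K6] do not depend on [s]. *)
Lemma Ex_stein_step B (h g : T -> R) K s (V V' : idx -> 'M[R[i]]_n) Kg Kh
    (K1 := 6 * bnd (Bp B)) (K4 := kap * (2 * (fnorm (Bp B) * fnorm D)))
    (K5 := kap * (2 * (fnorm B * fnorm D)) * Kg)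
    (K3 := K1 * K5 + K4 * K + K1 * K)
    (K6 := cidx * (10 * bnd (Bp B)) * Kh) :
  bm h -> bm g -> 0 <= K -> 0 < s -> s <= 2^-1 ->
  (forall U : T, unitary U -> 0 <= g U <= Kg) ->
  (forall U : T, unitary U -> `|h U| <= Kh) ->
  (forall a, unitary (V a)) -> (forall a, unitary (V' a)) ->
  (forall a, V' a *m V a = 1%:M) ->
  (forall U : T, unitary U ->
    `|\sum_a (linobs (Bp B) (V a *m U) + linobs (Bp B) (V' a *m U) - 2 * linobs (Bp B) U)
      + 2 * s ^+ 2 * linobs B U| <= cidx * (10 * bnd (Bp B)) * (s ^+ 2) ^+ 2) ->
  (forall a (U : T), unitary U ->
    `|linobs (Bp B) (V a *m U) - linobs (Bp B) U - s * dotm (genA R a) (YB (Bp B) U)|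
      <= K1 * s ^+ 2) ->
  (forall a (U : T), unitary U -> `|h (V a *m U) - h U| <=
     s * (`|dotm (genA R a) (YB B U)| * g U) + K * s ^+ 2) ->
  2 * s ^+ 2 * Ex P (fun U => linobs B U * h U) <=
  s ^+ 2 * Ex P (fun U => \sum_a steinW B g a U) + (cidx * K3 + K6) * s ^+ 3.
Proof.
move=> bh bg K0 s0 s2 g0 hKh uV uV' VV lap fst hK.
have unit1 : unitary (1%:M : 'M[R[i]]_n).
  by apply/unitaryE; rewrite eta1 trmx1 mulmx1.
have kap0 : 0 <= kap by apply: le_trans kap_ge1.
have Kg0 : 0 <= Kg by have /andP[] := g0 1%:M unit1; exact: le_trans.
have Kh0 : 0 <= Kh := le_trans (normr_ge0 _) (hKh 1%:M unit1).
have K10 : 0 <= K1 by rewrite /K1 mulr_ge0// bnd_ge0.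
have K40 : 0 <= K4 by rewrite /K4 !mulr_ge0// fnorm_ge0.
have K50 : 0 <= K5 by rewrite /K5 !mulr_ge0// fnorm_ge0.
have c0 : 0 <= cidx by apply: sumr_ge0.
have bW a : bm (steinW B g a) by exact: bm_steinW.
have bF := bm_linobs (Bp B).
have bFV a : bm (fun U : T => linobs (Bp B) (V a *m U)) by exact: bm_mull.
have bFV' a : bm (fun U : T => linobs (Bp B) (V' a *m U)) by exact: bm_mull.
have bhV a : bm (fun U : T => h (V a *m U)) by exact: bm_mull.
pose L a (U : T) := (linobs (Bp B) (V a *m U) + linobs (Bp B) (V' a *m U) - 2 * linobs (Bp B) U) * h U.
pose G a (U : T) := (linobs (Bp B) (V a *m U) - linobs (Bp B) U) * (h (V a *m U) - h U).
have bL a : bm (L a).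
  by apply: bmM => //; apply: bmB; [exact: bmD|exact: bmZ].
have bG a : bm (G a) by apply: bmM; exact: bmB.
have LG a : Ex P (L a) = - Ex P (G a) := Ex_antisym (Bp B) bh (uV a) (uV' a) (VV a).
have bfh : bm (fun U => linobs B U * h U) by apply: bmM => //; exact: bm_linobs.
have bSL : bm (fun U => \sum_a (-1 * L a U)) by apply: bm_sum => a; exact: bmZ.
have s3 : (s ^+ 2) ^+ 2 <= s ^+ 3.
  have -> : (s ^+ 2) ^+ 2 = s * s ^+ 3 by ring.
  by apply: ler_piMl; [rewrite exprn_ge0// ltW|lra].
have st1 : 2 * s ^+ 2 * Ex P (fun U => linobs B U * h U) <=
    \sum_a Ex P (G a) + K6 * s ^+ 3.
  rewrite -(ExZ hP _ bfh).
  apply: (@le_trans _ _ (Ex P (fun U => \sum_a (-1 * L a U) + K6 * s ^+ 3))).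
    apply: (Ex_le hP); [exact: bmZ|by apply: bmD => //; exact: bm_cst|].
    move=> U uU; have := lap U uU; have := hKh U uU.
    have -> : \sum_a (-1 * L a U) = - ((\sum_a (linobs (Bp B) (V a *m U) +
        linobs (Bp B) (V' a *m U) - 2 * linobs (Bp B) U)) * h U).
      by rewrite mulr_suml -sumrN; apply: eq_bigr => a _; rewrite mulN1r.
    move: (\sum_a _) (linobs B U) (h U) => X f y hy hX.
    have e : 2 * s ^+ 2 * (f * y) = (X + 2 * s ^+ 2 * f) * y - X * y by ring.
    rewrite e [leRHS]addrC lerD2r; apply: le_trans (ler_norm _) _; rewrite normrM.
    apply: (@le_trans _ _ (cidx * (10 * bnd (Bp B)) * (s ^+ 2) ^+ 2 * Kh)).
      by apply: ler_pM.
    rewrite /K6 mulrAC; apply: ler_wpM2l s3.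
    exact: (mulr_ge0 (mulr_ge0 c0 (mulr_ge0 (ler0n R 10) (bnd_ge0 (Bp B)))) Kh0).
  rewrite (ExD hP bSL (bm_cst _ _)) Ex_cst// lerD2r (Ex_sum hP); last by move=> a; exact: bmZ.
  apply: ler_sum => a _; rewrite (ExZ hP _ (bL a)) LG; lra.
apply: (le_trans st1).
have bSW : bm (fun U => \sum_a steinW B g a U) by exact: bm_sum.
rewrite (Ex_sum hP)// mulr_sumr [(cidx * K3 + K6) * _]mulrDl addrA lerD2r.
rewrite -mulrA /cidx mulr_suml -big_split/=; apply: ler_sum => a _.
rewrite mul1r -(ExZ hP _ (bW a)) -(Ex_cst hP (K3 * s ^+ 3)) -(ExD hP); last 2 first.
- exact: bmZ.
- exact: bm_cst.
apply: (Ex_le hP) => //; first by apply: bmD; [exact: bmZ|exact: bm_cst].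
move=> U uU; rewrite /G /steinW; apply: le_trans (ler_norm _) _; rewrite normrM.
have h1 := fst a U uU; have h2 := hK a U uU; have /andP[gU gK] := g0 U uU.
have Ale := kap_ge a.
have b4 : `|dotm (genA R a) (YB (Bp B) U)| <= K4.
  apply: le_trans (normr_dotm_le _ _) _; rewrite /K4.
  by apply: ler_pM => //; rewrite ?fnorm_ge0// fnorm_YB.
have b5 : `|dotm (genA R a) (YB B U)| * g U <= K5.
  rewrite /K5; apply: ler_pM => //; apply: le_trans (normr_dotm_le _ _) _.
  by apply: ler_pM => //; rewrite ?fnorm_ge0// fnorm_YB.
have d1 : `|linobs (Bp B) (V a *m U) - linobs (Bp B) U| <=
    s * `|dotm (genA R a) (YB (Bp B) U)| + K1 * s ^+ 2.
  move: h1; move: (linobs (Bp B) (V a *m U) - linobs (Bp B) U) (dotm _ _) => x y hxy.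
  have -> : x = (x - s * y) + s * y by ring.
  apply: le_trans (ler_normD _ _) _; rewrite normrM (gtr0_norm s0); lra.
apply: (@le_trans _ _ ((s * `|dotm (genA R a) (YB (Bp B) U)| + K1 * s ^+ 2) *
   (s * (`|dotm (genA R a) (YB B U)| * g U) + K * s ^+ 2))).
  by apply: ler_pM.
have y0 : 0 <= `|dotm (genA R a) (YB B U)| * g U by rewrite mulr_ge0.
have x0 := normr_ge0 (dotm (genA R a) (YB (Bp B) U)).
move: b4 b5 y0 x0 K10 K40 K50; rewrite /K3; clear -s0 s2 K0.
move: (`|dotm (genA R a) (YB B U)| * g U) `|dotm _ _| K1 K4 K5 => y x k1 k4 k5 xk yk y0 x0 k10 k40 k50.
have e : (s * x + k1 * s ^+ 2) * (s * y + K * s ^+ 2) =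
   s ^+ 2 * (x * y) + (k1 * y + x * K + k1 * K * s) * s ^+ 3 by ring.
rewrite e lerD2l ler_wpM2r ?exprn_ge0 ?(ltW s0)//.
have : k1 * y <= k1 * k5 by rewrite ler_wpM2l.
have : x * K <= k4 * K by rewrite ler_wpM2r.
have : k1 * K * s <= k1 * K by rewrite ler_piMr ?mulr_ge0//; lra.
lra.
Qed.

(** The intended [h] is a function of [linobs B], with [g] dominating its derivative. Dividing the
    one-step inequality by [s^2] and letting [s] tend to 0 removes the remainder. *)
Lemma Ex_stein B (h g : T -> R) K : bm h -> bm g -> 0 <= K ->
  (forall U : T, unitary U -> 0 <= g U) ->
  (forall (a : idx) s (U : T), unitary U -> 0 < s -> s <= 2^-1 ->
     `|h (stepC a s *m U) - h U| <= s * (`|dotm (genA R a) (YB B U)| * g U) + K * s ^+ 2) ->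
  Ex P (fun U => linobs B U * h U) <= 2^-1 * Ex P (fun U => \sum_a steinW B g a U).
Proof.
move=> bh bg K0 g0 hK.
have [_ [Kg hKg]] := bg; have [_ [Kh hKh]] := bh.
have g0' (U : T) : unitary U -> 0 <= g U <= Kg.
  by move=> uU; rewrite g0//=; apply: le_trans (ler_norm _) (hKg U uU).
have key (s : R) : 0 < s -> s <= 2^-1 -> _ := fun s0 s2 => @Ex_stein_step B h g K s
  (fun a => stepC a s) (fun a => stepC a (- s)) Kg Kh bh bg K0 s0 s2 g0' hKh.
have {key}[c key] : exists c, forall s : R, 0 < s -> s <= 2^-1 ->
    2 * s ^+ 2 * Ex P (fun U => linobs B U * h U) <=
    s ^+ 2 * Ex P (fun U => \sum_a steinW B g a U) + c * s ^+ 3.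
  eexists => s s0 s2.
  have hss : s ^+ 2 <= 4^-1 by nra.
  have hssN : (- s) ^+ 2 <= 4^-1 by rewrite sqrrN.
  exact: (key s s0 s2 (fun a => unitary_stepC a hss) (fun a => unitary_stepC a hssN)
    (fun a => stepCK a hss) (fun U uU => @linobs_laplacian B s U uU hss)
    (fun a U uU => proj1 (@linobs_step a (Bp B) s U uU hss))
    (fun a U uU => hK a s U uU s0 s2)).
move: key; move: (Ex P _) (Ex P _) => y x key.
rewrite -subr_le0; apply/ler_addgt0Pr => e e0; rewrite add0r.
have c1 : 0 < `|c| + 1 by rewrite ltr_wpDl.
pose s := Num.min 2^-1 (e / (`|c| + 1)).
have s0 : 0 < s by rewrite lt_min invr_gt0 ltr0n/= divr_gt0.
have s2 : s <= 2^-1 by rewrite ge_min lexx.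
have se : s * (`|c| + 1) <= e by rewrite -ler_pdivlMr// ge_min lexx orbT.
have := key s s0 s2.
have -> : 2 * s ^+ 2 * x = s ^+ 2 * (2 * x) by ring.
have -> : s ^+ 2 * y + c * s ^+ 3 = s ^+ 2 * (y + c * s) by ring.
rewrite ler_pM2l ?exprn_gt0// => h1.
have := ler_norm c; nra.
Qed.

End Stein.

(** * Moments and concentration *)

Section ExpInequalities.
Variable R : realType.

Lemma expR_sub1_le (u : R) : `|expR u - 1| <= `|u| + u ^+ 2 * expR `|u|.
Proof.
have h1 := expR_ge1Dx u; have h2 := expR_ge1Dx (- u).
have e0 := expR_gt0 u; have : expR (- u) * expR u = 1 by rewrite -expRD addNr expR0.
move=> e1; have h3 : expR u - 1 <= u * expR u by nra.
have u2 := sqr_ge0 u; have E0 := expR_gt0 `|u|.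
rewrite ler_norml; apply/andP; split.
  have := ler_norm (- u); rewrite normrN; nra.
have [u0|u0] := leP 0 u; first by rewrite (ger0_norm u0); nra.
have : 0 <= `|u| by []. 
have : u * expR u <= 0 by nra.
nra.
Qed.

Lemma expR_sub_le (x y : R) : expR x - expR y <= (x - y) * expR x.
Proof.
have -> : expR y = expR x * expR (y - x) by rewrite -expRD addrC subrK.
have := expR_ge1Dx (y - x); have := expR_gt0 x; nra.
Qed.

Lemma inv_onem_le (x : R) : 0 <= x -> x <= 2^-1 -> 1 <= (1 - x) * expR (2 * x).
Proof.
move=> x0 x1; have := expR_ge1Dx (2 * x); nra.
Qed.

(** Integers of absolute value at most [N], coded by sign and magnitude. Zero is counted twice,
    which the one-sided estimates below allow. *)
Definition sgnat N (t : bool * 'I_N.+1) : R := (-1) ^+ t.1 * t.2%:R.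

Lemma sum_half N : \sum_(r < N) 2^-1 ^+ r <= 2 :> R.
Proof.
suff : \sum_(r < N) 2^-1 ^+ r = 2 - 2 * 2^-1 ^+ N :> R.
  by move=> ->; rewrite gerBl mulr_ge0// exprn_ge0// invr_ge0.
elim: N => [|N IH]; first by rewrite big_ord0 expr0; ring.
by rewrite big_ord_recr/= IH exprS; field.
Qed.

(** From [(r - 1)^2 >= 0], each term is at most [2 * 2^-r]; the two signs give at most
    [8 = 1 + 7 <= exp 7]. *)
Lemma sum_gauss N :
  \sum_(t : bool * 'I_N.+1) expR (- (sgnat t ^+ 2) / 2) <= expR 7 :> R.
Proof.
have e12 : expR 2^-1 <= 2 :> R.
  have := expR_ge1Dx (- 2^-1 : R); have : expR (- 2^-1) * expR 2^-1 = 1 :> R.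
    by rewrite -expRD addNr expR0.
  have := expR_gt0 (2^-1 : R); have := expR_gt0 (- 2^-1 : R); nra.
have eN1 : expR (- 1) <= 2^-1 :> R.
  have := expR_ge1Dx (1 : R); have : expR (- 1) * expR 1 = 1 :> R.
    by rewrite -expRD addNr expR0.
  have := expR_gt0 (- 1 : R); nra.
have term (r : nat) : expR (- (r%:R ^+ 2) / 2) <= 2 * 2^-1 ^+ r :> R.
  apply: (@le_trans _ _ (expR (2^-1 - r%:R))).
    rewrite ler_expR; have := sqr_ge0 (r%:R - 1 : R); nra.
  rewrite expRD ler_pM ?expR_ge0//.
  have -> : - r%:R = r%:R * (-1) :> R by rewrite mulrN1.
  by rewrite expRM_natl lerXn2r ?nnegrE ?expR_ge0.
apply: (@le_trans _ _ (\sum_(b : bool) \sum_(r < N.+1) 2 * 2^-1 ^+ r)).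
  rewrite pair_big/=; apply: ler_sum => -[b r] _ /=.
  apply: le_trans (term r); rewrite /sgnat/= exprMn -exprM mulnC exprM sqrrN expr1n expr1n mul1r.
  by [].
rewrite big_bool/= -!mulr_sumr.
have := sum_half N.+1; have := expR_ge1Dx (7 : R); lra.
Qed.

(* Discrete Hubbard-Stratonovich bound: the term closest to [a / 2] suffices. *)
Lemma gauss_decoupling1 N (a : R) : `|a| <= N%:R ->
  expR (a ^+ 2 / 4 - 1) <= \sum_(t : bool * 'I_N.+1) expR (- (sgnat t ^+ 2) + a * sgnat t).
Proof.
move=> aN; pose r := Num.truncn (`|a| / 2).
have a2 : 0 <= `|a| / 2 by rewrite divr_ge0.
have /andP[r1 r2] := truncn_itv a2; rewrite -/r in r1 r2.
have rN : (r < N.+1)%N.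
  rewrite ltnS -(ler_nat R); apply: (le_trans r1); have := normr_ge0 a; lra.
pose t : bool * 'I_N.+1 := (a < 0, Ordinal rN).
rewrite (bigD1 t)//= -[leLHS]addr0 lerD//; last first.
  by apply: sumr_ge0 => i _; exact: expR_ge0.
have -> : a * sgnat t = `|a| * r%:R.
  rewrite /sgnat/=; have [a0|a0] := ltP a 0; first by rewrite ltr0_norm// expr1; ring.
  by rewrite ger0_norm// expr0 mul1r.
have -> : sgnat t ^+ 2 = r%:R ^+ 2.
  by rewrite /sgnat/= exprMn -exprM mulnC exprM sqrrN expr1n expr1n mul1r.
rewrite ler_expR -[a ^+ 2]real_normK ?num_real//.
have {}r2 : `|a| / 2 < r%:R + 1 by rewrite natr1.
move: r1 r2; move: (`|a|) (r%:R) => x y r1 r2.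
have e2 : (x / 2 - y) ^+ 2 <= 1 by apply: exprn_ile1; lra.
have -> : - y ^+ 2 + x * y = x ^+ 2 / 4 - (x / 2 - y) ^+ 2 by field.
lra.
Qed.

End ExpInequalities.

(** * Variance and exponential moments through the Stein inequality *)

Section Moments.
Variables (R : realType) (n : nat).
Hypothesis n0 : (0 < n)%N.
Local Notation T := (cmxMeas R n).
Local Notation idx := (genidx n).
Variables (P : probability T R) (hP : haar_prob P).
Let nR : 0 < n%:R :> R. Proof. by rewrite ltr0n. Qed.

(** Weighted arithmetic-geometric inequality [x y <= 2 n x^2 + y^2 / (8 n)], balanced because [Bp B]
    is smaller than [B] by a factor of about [4 n]. *)
Lemma steinW_sum D B g (U : T) : 0 <= g U ->
  \sum_a steinW D B g a U <=
  (16 * n%:R * dotm (YB D (Bp B) U) (YB D (Bp B) U) +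
   dotm (YB D B U) (YB D B U) / n%:R) * g U.
Proof.
move=> g0; apply: (@le_trans _ _ (\sum_(a : idx)
   (2 * n%:R * dotm (genA R a) (YB D (Bp B) U) ^+ 2 +
    (8 * n%:R)^-1 * dotm (genA R a) (YB D B U) ^+ 2) * g U)).
  apply: ler_sum => a _; rewrite /steinW mulrA ler_wpM2r//.
  move: (dotm _ _) (dotm _ _) => y x.
  have <- : `|x| ^+ 2 = x ^+ 2 by rewrite real_normK ?num_real.
  have <- : `|y| ^+ 2 = y ^+ 2 by rewrite real_normK ?num_real.
  move: `|x| `|y| => {}x {}y; rewrite -subr_ge0.
  have -> : 2 * n%:R * x ^+ 2 + (8 * n%:R)^-1 * y ^+ 2 - x * y =
     2 * n%:R * (x - (4 * n%:R)^-1 * y) ^+ 2 by field; rewrite gt_eqF.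
  by apply: mulr_ge0; [rewrite mulr_ge0// ltW|exact: sqr_ge0].
rewrite -mulr_suml ler_wpM2r// big_split/= -!mulr_sumr.
have h1 := sum_genA_sqr (YB D (Bp B) U); have h2 := sum_genA_sqr (YB D B U).
apply: lerD.
  have -> : 16 * n%:R * dotm (YB D (Bp B) U) (YB D (Bp B) U) =
    2 * n%:R * (8 * dotm (YB D (Bp B) U) (YB D (Bp B) U)) by ring.
  by rewrite ler_wpM2l// mulr_ge0// ltW.
have -> : dotm (YB D B U) (YB D B U) / n%:R = (8 * n%:R)^-1 * (8 * dotm (YB D B U) (YB D B U)).
  by field; rewrite gt_eqF.
by rewrite ler_wpM2l// invr_ge0 mulr_ge0// ltW.
Qed.

Variables (D : 'M[R]_(n + n)) (l : R).
Hypotheses (Ds : D^T = D) (trD : \tr D = 2 * n%:R * l).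
Local Notation fB := (linobs D l).

Lemma bm_steinV B : bm (fun U => 16 * n%:R * dotm (YB D (Bp B) U) (YB D (Bp B) U) +
   dotm (YB D B U) (YB D B U) / n%:R).
Proof.
apply: bmD; first by apply: bmZ; exact: bm_YB2.
by apply: bmM; [exact: bm_YB2|exact: bm_cst].
Qed.

Lemma Ex_stein2 B (h g : T -> R) K : bm h -> bm g -> 0 <= K ->
  (forall U : T, unitary U -> 0 <= g U) ->
  (forall (a : idx) s (U : T), unitary U -> 0 < s -> s <= 2^-1 ->
     `|h (stepC a s *m U) - h U| <= s * (`|dotm (genA R a) (YB D B U)| * g U) + K * s ^+ 2) ->
  Ex P (fun U => fB B U * h U) <=
  2^-1 * Ex P (fun U => (16 * n%:R * dotm (YB D (Bp B) U) (YB D (Bp B) U) +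
   dotm (YB D B U) (YB D B U) / n%:R) * g U).
Proof.
move=> bh bg K0 g0 hK.
apply: le_trans (Ex_stein n0 hP Ds trD bh bg K0 g0 hK) _.
rewrite ler_wpM2l ?invr_ge0//; apply: (Ex_le hP).
- by apply: bm_sum => a; exact: bm_steinW.
- by apply: bmM => //; exact: bm_steinV.
- by move=> U uU; apply: steinW_sum; exact: g0.
Qed.

(** A constant test function has no increments, so [g = 0] is allowed; replacing [B] by [- B] then
    gives mean zero. *)
Lemma Ex_linobs_le0 B : Ex P (fB B) <= 0.
Proof.
have := @Ex_stein2 B (fun=> 1) (fun=> 0) 0 (bm_cst _ 1) (bm_cst _ 0) (lexx _).
have -> : Ex P (fun U => fB B U * 1) = Ex P (fB B).
  by apply: Ex_eq => U _; rewrite mulr1.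
have -> : Ex P (fun U => (16 * n%:R * dotm (YB D (Bp B) U) (YB D (Bp B) U) +
   dotm (YB D B U) (YB D B U) / n%:R) * 0) = 0.
  by rewrite -[RHS](Ex_cst hP); apply: Ex_eq => U _; rewrite mulr0.
rewrite mulr0; apply => // a s U _ _ _.
by rewrite subrr normr0 !mulr0 mul0r addr0.
Qed.

Lemma Ex_linobs B : Ex P (fB B) = 0.
Proof.
apply/eqP; rewrite eq_le Ex_linobs_le0/=.
have := Ex_linobs_le0 (- B).
have -> : Ex P (fB (- B)) = Ex P (fun U => -1 * fB B U).
  by apply: Ex_eq => U _; rewrite /linobs dotmNl mulN1r.
by rewrite (ExZ hP _ (bm_linobs D l B)) mulN1r oppr_le0.
Qed.

Lemma linobs_step_lip (a : idx) B s (U : T) : unitary U -> 0 < s -> s <= 2^-1 ->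
  `|fB B (stepC a s *m U) - fB B U| <=
    s * `|dotm (genA R a) (YB D B U)| + 6 * bnd D B * s ^+ 2.
Proof.
move=> uU s0 s2; have hss : s ^+ 2 <= 4^-1 by nra.
have [h1 _] := linobs_step l Ds a B uU hss; move: h1.
move: (fB B (stepC a s *m U)) (fB B U) (dotm (genA R a) _) (6 * _) => x y w k h1.
have -> : x - y = (x - y - s * w) + s * w by ring.
apply: le_trans (ler_normD _ _) _; rewrite normrM (gtr0_norm s0); lra.
Qed.

Lemma Mg_op zm (U : T) : unitary U ->
  (forall p (X : 'M[R]_(n + n, p)), fnorm (D *m X) <= zm * fnorm X) ->
  forall p (X : 'M[R]_(n + n, p)), fnorm (Mg D U *m X) <= zm * fnorm X.
Proof.
move=> uU hop p X; rewrite /Mg -!mulmxA fnorm_orthol; last exact: unitary_ortho.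
apply: le_trans (hop _ _) _; rewrite fnorm_orthol//.
by rewrite trmxK; apply/unitaryE.
Qed.

(** Uses the operator norm of [D], as its Frobenius norm grows with the dimension in the
    application. *)
Lemma fnorm_YB_op zm B (U : T) : unitary U ->
  (forall p (X : 'M[R]_(n + n, p)), fnorm (D *m X) <= zm * fnorm X) ->
  fnorm (YB D B U) <= 2 * zm * fnorm B.
Proof.
move=> uU hop; apply: le_trans (fnormB _ _) _.
have h1 := Mg_op uU hop B.
have h2 : fnorm (B *m Mg D U) <= zm * fnorm B.
  by rewrite -fnorm_tr trmx_mul Mg_sym// -[leRHS]/(zm * _) -(fnorm_tr B); exact: Mg_op.
lra.
Qed.

(** The Stein inequality for [h = exp (tau f)] and [g = tau h]. The gradients of [f] and of its
    preimage contribute equally, each with [4 zm^2 |B|^2 / n], and the factor 1/2 leaves one of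
    them. *)
Lemma Ex_linobs_expR zm B : 0 <= zm ->
  (forall p (X : 'M[R]_(n + n, p)), fnorm (D *m X) <= zm * fnorm X) ->
  forall tau, 0 <= tau ->
  Ex P (fun U => fB B U * expR (tau * fB B U)) <=
  tau * (4 * zm ^+ 2 * dotm B B / n%:R) * Ex P (fun U => expR (tau * fB B U)).
Proof.
move=> zm0 hop tau tau0.
pose h (U : T) := expR (tau * fB B U).
have bf := bm_linobs D l B.
have bh : bm h by apply: bm_expR; exact: bmZ.
have bg : bm (fun U => tau * h U) by exact: bmZ.
have [_ [Kh hKh]] := bh.
pose K1 := 6 * bnd D B.
have K10 : 0 <= K1 := mulr_ge0 (ler0n R 6) (bnd_ge0 D B).
pose K4 := kap R n * (2 * (fnorm B * fnorm D)) + K1.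
have kap0 : 0 <= kap R n := le_trans ler01 (kap_ge1 R n).
have K40 : 0 <= K4.
  apply: addr_ge0 => //; apply: mulr_ge0 => //; apply: mulr_ge0 => //.
  by apply: mulr_ge0; exact: fnorm_ge0.
have unit1 : unitary (1%:M : 'M[R[i]]_n).
  by apply/unitaryE; rewrite eta1 trmx1 mulmx1.
have Kh0 : 0 <= Kh := le_trans (normr_ge0 _) (hKh 1%:M unit1).
pose E := expR (tau * K4).
have E0 : 0 < E := expR_gt0 _.
(* Uniform second-order remainder of [exp (tau f)] along a step: [tau K1] comes from the remainder
   of [f], the rest from [expR_sub1_le]. *)
pose K := Kh * (tau * K1 + tau ^+ 2 * K4 ^+ 2 * E).
have K0 : 0 <= K.
  apply: mulr_ge0 => //; apply: addr_ge0; first exact: mulr_ge0.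
  by apply: mulr_ge0; [apply: mulr_ge0; exact: sqr_ge0|exact: ltW].
have := @Ex_stein2 B h (fun U => tau * h U) K bh bg K0.
have st : forall (a : idx) s (U : T), unitary U -> 0 < s -> s <= 2^-1 ->
     `|h (stepC a s *m U) - h U| <= s * (`|dotm (genA R a) (YB D B U)| * (tau * h U)) + K * s ^+ 2.
  move=> a s U uU s0 s2.
  have s1 : s <= 1 by apply: (le_trans s2); rewrite invf_le1 ?ler1n.
  have w4 : `|dotm (genA R a) (YB D B U)| <= kap R n * (2 * (fnorm B * fnorm D)).
    apply: le_trans (normr_dotm_le _ _) _.
    by apply: ler_pM; rewrite ?fnorm_ge0 ?kap_ge ?fnorm_YB.
  have h1 := linobs_step_lip a B uU s0 s2.
  have h0 : 0 < h U := expR_gt0 _.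
  have hU : h U <= Kh by apply: le_trans (ler_norm _) (hKh U uU).
  have hE : h (stepC a s *m U) - h U =
      h U * (expR (tau * (fB B (stepC a s *m U) - fB B U)) - 1).
    rewrite /h; move: (fB B (stepC a s *m U)) (fB B U) => x y.
    by rewrite mulrBr mulr1 -expRD; congr (expR _ - _); ring.
  rewrite hE normrM (gtr0_norm h0).
  move: h1 w4; move: (fB B (stepC a s *m U) - fB B U) `|dotm _ _| (normr_ge0 (dotm (genA R a) (YB D B U))) => x w w0 h1 w4.
  have xs : `|x| <= s * K4.
    apply: (le_trans h1); rewrite /K4 mulrDr lerD ?ler_wpM2l ?(ltW s0)//.
    by rewrite -/K1 mulrC ler_wpM2r// expr2 ler_piMl// ltW.
  have ux : `|tau * x| = tau * `|x| by rewrite normrM (ger0_norm tau0).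
  have uE : expR `|tau * x| <= E.
    rewrite ler_expR ux ler_wpM2l//; apply: (le_trans xs).
    exact: ler_piMl K40 s1.
  have x2 : (tau * x) ^+ 2 <= tau ^+ 2 * K4 ^+ 2 * s ^+ 2.
    have -> : tau ^+ 2 * K4 ^+ 2 * s ^+ 2 = (tau * (s * K4)) ^+ 2 by ring.
    rewrite -[leLHS]real_normK ?num_real// lerXn2r ?nnegrE ?ux//.
    - exact: mulr_ge0.
    - by apply: mulr_ge0 => //; apply: mulr_ge0 => //; exact: ltW.
    - by rewrite ler_wpM2l.
  have e1 := expR_sub1_le (tau * x).
  have e2 : (tau * x) ^+ 2 * expR `|tau * x| <= tau ^+ 2 * K4 ^+ 2 * s ^+ 2 * E.
    by apply: ler_pM => //; exact: sqr_ge0.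
  have e3 : `|expR (tau * x) - 1| <= tau * (s * w) + (tau * K1 + tau ^+ 2 * K4 ^+ 2 * E) * s ^+ 2.
    apply: (le_trans e1).
    have a1 : `|tau * x| <= tau * (s * w + K1 * s ^+ 2) by rewrite ux ler_wpM2l.
    apply: le_trans (lerD a1 e2) _; rewrite le_eqVlt; apply/orP; left; apply/eqP.
    ring.
  apply: (le_trans (ler_wpM2l (ltW h0) e3)).
  have -> : s * (w * (tau * h U)) + K * s ^+ 2 = h U * (tau * (s * w)) +
     Kh * (tau * K1 + tau ^+ 2 * K4 ^+ 2 * E) * s ^+ 2 by rewrite /K; ring.
  rewrite mulrDr lerD2l mulrA ler_wpM2r ?sqr_ge0// ler_wpM2r//.
  apply: addr_ge0; first exact: mulr_ge0.
  by apply: mulr_ge0; [apply: mulr_ge0; exact: sqr_ge0|exact: ltW].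
have g0 (U : T) : unitary U -> 0 <= tau * h U.
  by move=> _; apply: mulr_ge0 => //; exact: expR_ge0.
move=> /(_ g0 st) => H; apply: (le_trans H).
rewrite -(ExZ hP _ bh) -(ExZ hP); last by apply: bmM => //; exact: bm_steinV.
apply: (Ex_le hP); [by apply: bmZ; apply: bmM => //; exact: bm_steinV|exact: bmZ|].
move=> U uU; have hU : 0 <= h U := expR_ge0 _.
have y1 : dotm (YB D B U) (YB D B U) <= 4 * zm ^+ 2 * dotm B B.
  rewrite -!fnorm_sqr.
  have -> : 4 * zm ^+ 2 * fnorm B ^+ 2 = (2 * zm * fnorm B) ^+ 2 by ring.
  by rewrite lerXn2r ?nnegrE ?fnorm_ge0 ?fnorm_YB_op// !mulr_ge0// fnorm_ge0.
have y2 : dotm (YB D (Bp B) U) (YB D (Bp B) U) <= 4 * zm ^+ 2 * (dotm B B / (16 * n%:R ^+ 2)).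
  rewrite -!fnorm_sqr.
  have -> : 4 * zm ^+ 2 * (fnorm B ^+ 2 / (16 * n%:R ^+ 2)) =
     (2 * zm * (fnorm B / (4 * n%:R))) ^+ 2 by field; rewrite gt_eqF.
  have c0 : 0 <= 2 * zm by lra.
  have f0 : 0 <= fnorm B / (4 * n%:R).
    by apply: divr_ge0; [exact: fnorm_ge0|rewrite mulr_ge0// ltW].
  rewrite lerXn2r ?nnegrE ?fnorm_ge0 ?(mulr_ge0 c0 f0)//.
  apply: le_trans (fnorm_YB_op (Bp B) uU hop) _; rewrite ler_wpM2l//.
  exact: fnorm_Bp.
have -> : tau * (4 * zm ^+ 2 * dotm B B / n%:R) * h U =
   2^-1 * ((16 * n%:R * (4 * zm ^+ 2 * (dotm B B / (16 * n%:R ^+ 2))) +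
     4 * zm ^+ 2 * dotm B B / n%:R) * (tau * h U)) by field; rewrite gt_eqF.
rewrite ler_wpM2l ?invr_ge0// ler_wpM2r ?mulr_ge0// lerD//.
  by rewrite ler_wpM2l// mulr_ge0// ltW.
by rewrite ler_wpM2r// invr_ge0 ltW.
Qed.

End Moments.

(** * Concentration of compressions in Frobenius norm *)

Section Concentration.
Variables (R : realType) (n : nat).
Hypothesis n0 : (0 < n)%N.
Local Notation T := (cmxMeas R n).
Variables (P : probability T R) (hP : haar_prob P).
Let nR : 0 < n%:R :> R. Proof. by rewrite ltr0n. Qed.

(* Grönwall's inequality in discrete form: by convexity of the exponential,
   [phi t * (1 - d * b) <= phi (t - d)], which is iterated over a mesh [d = 1/N]. *)
Lemma Ex_expR_gronwall (f : T -> R) b : bm f -> 0 <= b ->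
  (forall tau, 0 <= tau -> tau <= 1 -> Ex P (fun U => f U * expR (tau * f U)) <=
      tau * b * Ex P (fun U => expR (tau * f U))) ->
  Ex P (fun U => expR (f U)) <= expR (2 * b).
Proof.
move=> bf b0 H; pose phi tau := Ex P (fun U => expR (tau * f U)).
have bphi tau : bm (fun U => expR (tau * f U)) by apply: bm_expR; exact: bmZ.
have phi0 tau : 0 <= phi tau.
  rewrite -(Ex_cst hP 0); apply: (Ex_le hP) => //; exact: bm_cst.
(* A mesh fine enough for [b / N <= 1/2], as [inv_onem_le] requires. *)
pose N := (Num.bound (2 * b)).+1.
have NR : 0 < N%:R :> R by rewrite ltr0n.
have bN : b / N%:R <= 2^-1.
  rewrite ler_pdivrMr//; have b2 : 0 <= 2 * b by lra.
  have hb : 2 * b < N%:R by apply: lt_le_trans (archi_boundP b2) _; rewrite ler_nat.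
  lra.
have st (j : nat) : (j <= N)%N -> phi (j%:R / N%:R) <= expR (2 * b / N%:R * j%:R).
  elim: j => [|j IH] jN.
    rewrite mul0r mulr0 expR0 /phi -[leRHS](Ex_cst hP).
    rewrite le_eqVlt; apply/orP; left; apply/eqP/Ex_eq => U _.
    by rewrite mul0r expR0.
  set t : R := j.+1%:R / N%:R; pose t' : R := j%:R / N%:R.
  have t0 : 0 <= t by rewrite divr_ge0.
  have t1 : t <= 1 by rewrite ler_pdivrMr// mul1r ler_nat.
  have tt' : t - t' = N%:R^-1 by rewrite /t /t' -natr1; field; rewrite gt_eqF.
  have h1 : phi t - phi t' <= N%:R^-1 * Ex P (fun U => f U * expR (t * f U)).
    rewrite -(ExB hP)// -(ExZ hP); last by apply: bmM.
    apply: (Ex_le hP); [exact: bmB|by apply: bmZ; exact: bmM|].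
    move=> U _; apply: le_trans (expR_sub_le _ _) _.
    by rewrite -mulrBl tt' mulrA.
  have h2 : phi t - phi t' <= b / N%:R * phi t.
    apply: (le_trans h1); rewrite mulrC ler_pdivrMr//.
    apply: (le_trans (H t t0 t1)); rewrite -/(phi t).
    have -> : b / N%:R * phi t * N%:R = 1 * b * phi t by field; rewrite gt_eqF.
    by rewrite ler_wpM2r// ler_wpM2r.
  have bN0 : 0 <= b / N%:R by rewrite divr_ge0// ltW.
  have h3 := inv_onem_le bN0 bN.
  have h4 : phi t <= phi t' * expR (2 * (b / N%:R)).
    have : phi t * (1 - b / N%:R) <= phi t' by lra.
    have := expR_gt0 (2 * (b / N%:R)); have := phi0 t; have := phi0 t'.
    move: h3; move: (b / N%:R) (expR _) (phi t) (phi t') => x e p p' h3 p'0 p0 e0 hp.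
    have : p * ((1 - x) * e) <= p' * e by rewrite mulrA ler_wpM2r// ltW.
    have : p <= p * ((1 - x) * e) by rewrite ler_peMr.
    exact: le_trans.
  have jE : j.+1%:R = j%:R + 1 :> R by rewrite natr1.
  apply: (le_trans h4); rewrite jE mulrDr mulr1 expRD.
  have -> : 2 * (b / N%:R) = 2 * b / N%:R by rewrite mulrA.
  by rewrite ler_wpM2r ?expR_ge0// IH// ltnW.
have := st N (leqnn N); rewrite divff ?gt_eqF// divfK ?gt_eqF// /phi.
by under [X in Ex P X]eq_fun do rewrite mul1r.
Qed.

Section Tail.
Variables (D : 'M[R]_(n + n)) (l zm sg : R).
Hypotheses (Ds : D^T = D) (trD : \tr D = 2 * n%:R * l).
Hypothesis trDD : \tr (D *m D) = 2 * n%:R * sg.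
Hypothesis zm0 : 0 < zm.
Hypothesis hop : forall p (X : 'M[R]_(n + n, p)), fnorm (D *m X) <= zm * fnorm X.
Local Notation fB := (linobs D l).

Lemma Ex_linobs_mgf B : Ex P (fun U => expR (fB B U)) <= expR (8 * zm ^+ 2 * dotm B B / n%:R).
Proof.
have -> : 8 * zm ^+ 2 * dotm B B / n%:R = 2 * (4 * zm ^+ 2 * dotm B B / n%:R).
  by field; rewrite gt_eqF.
apply: Ex_expR_gronwall; first exact: bm_linobs.
  apply: divr_ge0; last exact: ltW.
  by apply: mulr_ge0; [rewrite mulr_ge0// sqr_ge0|exact: dotmm_ge0].
move=> tau t0 _; exact: (Ex_linobs_expR n0 hP Ds trD B (ltW zm0) hop t0).
Qed.

(** By the parallelogram law the squared commutator is at most [2 |B M|^2 + 2 |M B|^2], and these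
    are linear observables of [M^2], the conjugate of [D^2], whose means are already known. So [sg]
    appears where a pointwise bound would give [zm^2]. *)
Lemma Ex_YB_sqr B : Ex P (fun U => dotm (YB D B U) (YB D B U)) <= 4 * sg * dotm B B.
Proof.
have DDs : (D *m D)^T = D *m D by rewrite trmx_mul Ds.
pose C1 := B^T *m B; pose C2 := B *m B^T.
have b1 := bm_linobs (D *m D) sg C1; have b2 := bm_linobs (D *m D) sg C2.
have pt (U : T) : unitary U -> dotm (YB D B U) (YB D B U) <=
   2 * linobs (D *m D) sg C1 U + 2 * linobs (D *m D) sg C2 U + 4 * sg * dotm B B.
  move=> uU; have Ms := Mg_sym U Ds.
  have MM := Mg_mulmx D D uU.
  have e1 : dotm (B *m Mg D U) (B *m Mg D U) = dotm C1 (Mg (D *m D) U).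
    by rewrite dotm_mulr Ms -mulmxA MM [RHS]dotm_mull trmxK.
  have e2 : dotm (Mg D U *m B) (Mg D U *m B) = dotm C2 (Mg (D *m D) U).
    by rewrite dotm_mull Ms mulmxA MM [RHS]dotm_mulr trmxK.
  have t1 : dotm C1 sg%:M = sg * dotm B B.
    by rewrite -[sg%:M]scalemx1 dotmZr /C1 dotm_mull trmxK mulmx1.
  have t2 : dotm C2 sg%:M = sg * dotm B B.
    by rewrite -[sg%:M]scalemx1 dotmZr /C2 dotm_mulr trmxK mul1mx.
  rewrite /linobs /YB dotmBl !dotmBr t1 t2 -e1 -e2.
  have := dotmm_ge0 (B *m Mg D U + Mg D U *m B).
  rewrite dotmDl !dotmDr; lra.
apply: le_trans (Ex_le hP (bm_YB2 D B B) _ pt) _.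
  by apply: bmD; [apply: bmD; exact: bmZ|exact: bm_cst].
rewrite (ExD hP); [|by apply: bmD; exact: bmZ|exact: bm_cst].
rewrite (ExD hP); [|exact: bmZ|exact: bmZ].
rewrite (ExZ hP _ b1) (ExZ hP _ b2) (Ex_cst hP).
rewrite (Ex_linobs n0 hP DDs trDD) (Ex_linobs n0 hP DDs trDD); lra.
Qed.

Lemma Ex_linobs_sqr B : Ex P (fun U => fB B U ^+ 2) <= 4 * sg * dotm B B / n%:R.
Proof.
have bf := bm_linobs D l B.
have K0 : 0 <= 6 * bnd D B := mulr_ge0 (ler0n R 6) (bnd_ge0 D B).
have := Ex_stein2 (B := B) n0 hP Ds trD bf (bm_cst n 1) K0 (fun _ _ => ler01).
have st : forall (a : genidx n) s (U : T), unitary U -> 0 < s -> s <= 2^-1 ->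
     `|fB B (stepC a s *m U) - fB B U| <= s * (`|dotm (genA R a) (YB D B U)| * 1) + 6 * bnd D B * s ^+ 2.
  by move=> a s U uU s0 s2; rewrite mulr1; exact: linobs_step_lip.
move=> /(_ st) H.
have -> : Ex P (fun U => fB B U ^+ 2) = Ex P (fun U => fB B U * fB B U).
  by apply: Ex_eq => U _; rewrite expr2.
apply: (le_trans H).
have -> : Ex P (fun U => (16 * n%:R * dotm (YB D (Bp B) U) (YB D (Bp B) U) +
   dotm (YB D B U) (YB D B U) / n%:R) * 1) =
   16 * n%:R * Ex P (fun U => dotm (YB D (Bp B) U) (YB D (Bp B) U)) +
   n%:R^-1 * Ex P (fun U => dotm (YB D B U) (YB D B U)).
  rewrite -!(ExZ hP); [|exact: bm_YB2|exact: bm_YB2].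
  rewrite -(ExD hP); [|by apply: bmZ; exact: bm_YB2|by apply: bmZ; exact: bm_YB2].
  by apply: Ex_eq => U _; rewrite mulr1 [_ / _]mulrC.
have h1 := Ex_YB_sqr (Bp B); have h2 := Ex_YB_sqr B.
have h3 : dotm (Bp B) (Bp B) <= dotm B B / (16 * n%:R ^+ 2).
  rewrite -!fnorm_sqr.
  have -> : fnorm B ^+ 2 / (16 * n%:R ^+ 2) = (fnorm B / (4 * n%:R)) ^+ 2.
    by field; rewrite gt_eqF.
  rewrite lerXn2r ?nnegrE ?fnorm_ge0 ?fnorm_Bp//.
  by apply: divr_ge0; [exact: fnorm_ge0|rewrite mulr_ge0// ltW].
have sg0 : 0 <= sg.
  have : 0 <= \tr (D *m D) by rewrite -{1}Ds; exact: dotmm_ge0.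
  by rewrite trDD pmulr_rge0// mulr_gt0.
have h4 : 16 * n%:R * Ex P (fun U => dotm (YB D (Bp B) U) (YB D (Bp B) U)) <=
    4 * sg * dotm B B / n%:R.
  apply: (@le_trans _ _ (16 * n%:R * (4 * sg * (dotm B B / (16 * n%:R ^+ 2))))).
    rewrite ler_wpM2l ?mulr_ge0 ?(ltW nR)//; apply: (le_trans h1).
    by rewrite ler_wpM2l// mulr_ge0.
  rewrite le_eqVlt; apply/orP; left; apply/eqP; field; rewrite gt_eqF//.
have h5 : n%:R^-1 * Ex P (fun U => dotm (YB D B U) (YB D B U)) <= 4 * sg * dotm B B / n%:R.
  by rewrite mulrC ler_wpM2r// invr_ge0 ltW.
lra.
Qed.

Variables (q : nat) (S : 'M[R]_(q, n + n)).
Hypothesis SS : S *m S^T = 1%:M.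

Definition Xs (U : T) : 'M[R]_q := S *m (Mg D U - l%:M) *m S^T.

Lemma dotm_Xs (m : 'M[R]_q) (U : T) : dotm m (Xs U) = fB (S^T *m m *m S) U.
Proof. by rewrite /Xs /linobs dotmC dotm_mulr dotm_mull !trmxK mulmxA dotmC. Qed.

Lemma dotm_lift (m : 'M[R]_q) : dotm (S^T *m m *m S) (S^T *m m *m S) = dotm m m.
Proof.
by rewrite -fnorm_sqr fnorm_orthor// fnorm_orthol ?trmxK// fnorm_sqr.
Qed.

Lemma mxmeas_Xs : mxmeas Xs.
Proof.
apply: mxmeas_mul; last exact: mxmeas_cst.
apply: mxmeas_mul; first exact: mxmeas_cst.
by apply: mxmeas_add; [exact: mxmeas_Mg|exact: mxmeas_cst].
Qed.

Lemma fnorm_Xs : exists K, forall U : T, unitary U -> fnorm (Xs U) <= K.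
Proof.
exists (fnorm S * (fnorm D + fnorm (l%:M : 'M[R]_(n + n))) * fnorm S) => U uU.
apply: le_trans (fnormM _ _) _; rewrite fnorm_tr ler_wpM2r ?fnorm_ge0//.
apply: le_trans (fnormM _ _) _; rewrite ler_wpM2l ?fnorm_ge0//.
by apply: le_trans (fnormB _ _) _; rewrite fnorm_Mg.
Qed.

Lemma bm_Xs : bm (fun U => dotm (Xs U) (Xs U)).
Proof.
have [K hK] := fnorm_Xs.
by apply: (@bm_dotm _ _ _ _ _ _ K K) => //; exact: mxmeas_Xs.
Qed.

Lemma Ex_Xs_sqr : Ex P (fun U => dotm (Xs U) (Xs U)) <= q%:R ^+ 2 * (4 * sg / n%:R).
Proof.
have E U : dotm (Xs U) (Xs U) = \sum_i \sum_j fB (S^T *m delta_mx i j *m S) U ^+ 2.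
  rewrite dotmE; apply: eq_bigr => i _; apply: eq_bigr => j _.
  by rewrite -dotm_Xs dotm_delta expr2.
under [X in Ex P X]eq_fun do rewrite E.
have bf i j : bm (fun U => fB (S^T *m delta_mx i j *m S) U ^+ 2).
  by under [X in bm X]eq_fun do rewrite expr2; apply: bmM; exact: bm_linobs.
rewrite (Ex_sum hP); last by move=> i; exact: bm_sum.
apply: (@le_trans _ _ (\sum_(i < q) \sum_(j < q) 4 * sg / n%:R)).
  apply: ler_sum => i _; rewrite (Ex_sum hP)//; apply: ler_sum => j _.
  apply: le_trans (Ex_linobs_sqr _) _; rewrite dotm_lift dotm_delta mxE !eqxx mulr1.
  by [].
move: (4 * sg / n%:R) => c.
by rewrite !sumr_const !card_ord -mulrnA -[leLHS]mulr_natl natrM expr2.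
Qed.

(** Each entry is decoupled by an integer-valued variable. With [th^2 = n / (16 zm^2)] the
    subgaussian bound consumes exactly half of the Gaussian weight, and [th^2 / 4] is the factor
    [n / (64 zm^2)]. Each of the [q^2] entries costs 1 for rounding and 7 from [sum_gauss], hence
    8. *)
Lemma Ex_Xs_expR : Ex P (fun U => expR (n%:R / (64 * zm ^+ 2) * dotm (Xs U) (Xs U)))
  <= expR (8 * q%:R ^+ 2).
Proof.
pose th := Num.sqrt (n%:R / (16 * zm ^+ 2)).
have z2 : 0 < zm ^+ 2 by rewrite exprn_gt0.
have th0 : 0 <= th := sqrtr_ge0 _.
have th2 : th ^+ 2 = n%:R / (16 * zm ^+ 2).
  by rewrite sqr_sqrtr// divr_ge0// ?mulr_ge0// ltW.
have [K hK] := fnorm_Xs.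
pose N := Num.bound (th * `|K|).
pose tt := (bool * 'I_N.+1)%type.
pose mm (m : {ffun 'I_q * 'I_q -> tt}) : 'M[R]_q := \matrix_(i, j) sgnat R (m (i, j)).
pose G (m : {ffun 'I_q * 'I_q -> tt}) (U : T) :=
  expR (fB (S^T *m (th *: mm m) *m S) U).
have bG m : bm (G m) by apply: bm_expR; exact: bm_linobs.
have sumE (F : 'I_q -> 'I_q -> R) : \sum_i \sum_j F i j = \sum_(ij : 'I_q * 'I_q) F ij.1 ij.2.
  by rewrite pair_big.
have mmE m : dotm (mm m) (mm m) = \sum_(ij : 'I_q * 'I_q) sgnat R (m ij) ^+ 2.
  by rewrite dotmE sumE; apply: eq_bigr => -[i j] _; rewrite !mxE expr2.
have pt (U : T) : unitary U -> expR (n%:R / (64 * zm ^+ 2) * dotm (Xs U) (Xs U)) <=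
   expR (q%:R ^+ 2) * \sum_m expR (- dotm (mm m) (mm m)) * G m U.
  move=> uU; pose a (ij : 'I_q * 'I_q) := th * Xs U ij.1 ij.2.
  have aN ij : `|a ij| <= N%:R.
    rewrite /a normrM (ger0_norm th0).
    apply: (@le_trans _ _ (th * `|K|)).
      rewrite ler_wpM2l//; apply: le_trans (entry_le_fnorm _ _ _) _.
      exact: le_trans (hK U uU) (ler_norm _).
    by apply/ltW/archi_boundP; rewrite mulr_ge0.
  have e1 : n%:R / (64 * zm ^+ 2) * dotm (Xs U) (Xs U) =
      q%:R ^+ 2 + \sum_(ij : 'I_q * 'I_q) (a ij ^+ 2 / 4 - 1).
    have e0 : \sum_(ij : 'I_q * 'I_q) a ij ^+ 2 = th ^+ 2 * dotm (Xs U) (Xs U).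
      by rewrite dotmE sumE mulr_sumr; apply: eq_bigr => ij _; rewrite /a; ring.
    rewrite sumrB -mulr_suml e0 th2 sumr_const card_prod !card_ord natrM.
    by field; rewrite gt_eqF.
  rewrite e1 expRD ler_wpM2l ?expR_ge0// expR_sum.
  apply: (@le_trans _ _ (\prod_(ij : 'I_q * 'I_q) \sum_(t : tt)
      expR (- (sgnat R t ^+ 2) + a ij * sgnat R t))).
    apply: ler_prod => ij _; rewrite expR_ge0/=; exact: gauss_decoupling1.
  (* Expanding the product over entries gives a sum over integer matrices [mm m], and each exponent
     is again a linear observable. *)
  rewrite bigA_distr_bigA/=; apply: ler_sum => m _.
  rewrite -expR_sum /G -expRD ler_expR -dotm_Xs mmE dotmZl dotmE sumE.
  rewrite big_split/= sumrN lerD2l mulr_sumr le_eqVlt; apply/orP; left; apply/eqP.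
  by apply: eq_bigr => -[i j] _; rewrite /a !mxE/=; ring.
apply: (@le_trans _ _ (Ex P (fun U => expR (q%:R ^+ 2) *
   \sum_m expR (- dotm (mm m) (mm m)) * G m U))).
  apply: (Ex_le hP) => //; first by apply: bm_expR; apply: bmZ; exact: bm_Xs.
  by apply: bmZ; apply: bm_sum => m; exact: bmZ.
rewrite (ExZ hP); last by apply: bm_sum => m; exact: bmZ.
rewrite (Ex_sum hP); last by move=> m; exact: bmZ.
have -> : 8 * q%:R ^+ 2 = q%:R ^+ 2 + 7 * q%:R ^+ 2 :> R by ring.
rewrite expRD ler_wpM2l ?expR_ge0//.
apply: (@le_trans _ _ (\sum_(m : {ffun 'I_q * 'I_q -> tt})
    \prod_(ij : 'I_q * 'I_q) expR (- (sgnat R (m ij) ^+ 2) / 2))).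
  apply: ler_sum => m _; rewrite (ExZ hP)// -expR_sum.
  apply: (@le_trans _ _ (expR (- dotm (mm m) (mm m)) *
      expR (8 * zm ^+ 2 * (th ^+ 2 * dotm (mm m) (mm m)) / n%:R))).
    rewrite ler_wpM2l ?expR_ge0//; apply: le_trans (Ex_linobs_mgf _) _.
    by rewrite dotm_lift dotmZl dotmZr mulrA -expr2.
  rewrite -expRD ler_expR -mulr_suml sumrN -mmE th2 le_eqVlt; apply/orP; left; apply/eqP.
  by field; rewrite !gt_eqF.
rewrite -(bigA_distr_bigA (fun (ij : 'I_q * 'I_q) (t : tt) => expR (- (sgnat R t ^+ 2) / 2))).
apply: (@le_trans _ _ (\prod_(ij : 'I_q * 'I_q) expR 7)).
  apply: ler_prod => ij _; rewrite sum_gauss andbT.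
  by apply: sumr_ge0 => t _; exact: expR_ge0.
by rewrite prodr_const card_prod !card_ord -expRM_natl natrM expr2 mulrC.
Qed.

Lemma measurable_Xs_gt (t0 : R) : measurable [set U : T | (t0 < fnorm (Xs U))%R].
Proof.
have mf := measurable_fnorm mxmeas_Xs.
have -> : [set U : T | (t0 < fnorm (Xs U))%R] =
    setT `&` (fun U => fnorm (Xs U)) @^-1` `]t0, +oo[%classic.
  by apply/seteqP; split => U /=; rewrite in_itv/= andbT; [split|case].
by apply: mf => //; exact: measurable_itv.
Qed.

Lemma Xs_chebyshev (t0 : R) : 0 < t0 ->
  (P [set U : T | (t0 < fnorm (Xs U))%R] <=
    (q%:R ^+ 2 * (4 * sg / n%:R) / t0 ^+ 2)%:E)%E.
Proof.
move=> t00; set A := [set U : T | _].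
have mA : measurable A.
  exact: measurable_Xs_gt.
have := @Ex_markov _ _ _ hP (fun U => dotm (Xs U) (Xs U)) A (t0 ^+ 2) bm_Xs mA.
move=> H; have {}H : ((t0 ^+ 2)%:E * P A <= (Ex P (fun U => dotm (Xs U) (Xs U)))%:E)%E.
  apply: H => [U _|U _ AU|]; [exact: dotmm_ge0| |exact: sqr_ge0].
  by rewrite -fnorm_sqr lerXn2r ?nnegrE ?fnorm_ge0 ?(ltW t00)// ltW.
have t2 : 0 < t0 ^+ 2 by rewrite exprn_gt0.
rewrite mulrC EFinM lee_pdivlMl//; apply: (le_trans H); rewrite lee_fin.
exact: Ex_Xs_sqr.
Qed.

Lemma Xs_tail (t0 : R) : 0 < t0 ->
  (P [set U : T | (t0 < fnorm (Xs U))%R] <=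
    (expR (8 * q%:R ^+ 2 - n%:R / (64 * zm ^+ 2) * t0 ^+ 2))%:E)%E.
Proof.
move=> t00; set A := [set U : T | _].
have mA : measurable A by exact: measurable_Xs_gt.
pose c := n%:R / (64 * zm ^+ 2).
have c0 : 0 <= c by rewrite divr_ge0 ?mulr_ge0 ?sqr_ge0// ltW.
have bX : bm (fun U => expR (c * dotm (Xs U) (Xs U))).
  by apply: bm_expR; apply: bmZ; exact: bm_Xs.
have := @Ex_markov _ _ _ hP _ A (expR (c * t0 ^+ 2)) bX mA.
move=> H; have {}H : ((expR (c * t0 ^+ 2))%:E * P A <=
    (Ex P (fun U => expR (c * dotm (Xs U) (Xs U))))%:E)%E.
  apply: H => [U _|U _ AU|]; [exact: expR_ge0| |exact: expR_ge0].
  rewrite ler_expR ler_wpM2l// -fnorm_sqr lerXn2r ?nnegrE ?fnorm_ge0 ?(ltW t00)//.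
  exact: ltW.
rewrite expRD expRN mulrC EFinM lee_pdivlMl ?expR_gt0//; apply: (le_trans H).
rewrite lee_fin; exact: Ex_Xs_expR.
Qed.

End Tail.
End Concentration.

(** * Reduced covariance matrices *)

Section Selection.
Variables (R : realType) (n k : nat) (hk : (k <= n)%N).

Lemma sub_idx_inj : injective (sub_idx hk).
Proof.
have sl (a : 'I_k) : sub_idx hk (lshift k a) = lshift n (widen_ord hk a).
  by rewrite /sub_idx (unsplitK (inl a)).
have sr (a : 'I_k) : sub_idx hk (rshift k a) = rshift n (widen_ord hk a).
  by rewrite /sub_idx (unsplitK (inr a)).
have winj (a b : 'I_k) : widen_ord hk a = widen_ord hk b -> a = b.
  by move=> /(congr1 val) /= h; apply: val_inj.
move=> i j; case: (split_ordP i) => a ->; case: (split_ordP j) => b ->;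
  rewrite ?sl ?sr => /eqP; rewrite ?eq_lshift ?eq_rshift ?eq_lrshift ?eq_rlshift//.
- by move=> /eqP/winj ->.
- by move=> /eqP/winj ->.
Qed.

Definition selmx : 'M[R]_(k + k, n + n) := \matrix_(i, x) (x == sub_idx hk i)%:R.

Lemma selmx_mul p (X : 'M[R]_(n + n, p)) :
  selmx *m X = \matrix_(i, j) X (sub_idx hk i) j.
Proof.
apply/matrixP => i j; rewrite !mxE (bigD1 (sub_idx hk i))//= big1 ?addr0.
  by rewrite !mxE eqxx mul1r.
by move=> x xi; rewrite !mxE (negPf xi) mul0r.
Qed.

Lemma selmx_ortho : selmx *m selmx^T = 1%:M.
Proof.
rewrite selmx_mul; apply/matrixP => i j; rewrite !mxE.
by rewrite (inj_eq sub_idx_inj).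
Qed.

Lemma subcovE (M : 'M[R]_(n + n)) : subcov hk M = selmx *m M *m selmx^T.
Proof.
rewrite -mulmxA selmx_mul; apply/matrixP => i j; rewrite !mxE.
rewrite (bigD1 (sub_idx hk j))//= big1 ?addr0.
  by rewrite !mxE eqxx mulr1.
by move=> x xi; rewrite !mxE (negPf xi) mulr0.
Qed.

End Selection.

(** By duality: the square of the left side is the pairing of [Y] with [S^T S Y], and [S^T] is an
    isometry. *)
Lemma fnorm_contract (R : rcfType) m n p (S : 'M[R]_(m, n)) (Y : 'M[R]_(n, p)) :
  S *m S^T = 1%:M -> fnorm (S *m Y) <= fnorm Y.
Proof.
move=> SS; have [->|nz] := eqVneq (fnorm (S *m Y)) 0; first exact: fnorm_ge0.
have p0 : 0 < fnorm (S *m Y) by rewrite lt_neqAle eq_sym nz fnorm_ge0.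
rewrite -(ler_pM2l p0) -expr2 fnorm_sqr dotm_mull.
apply: le_trans (ler_norm _) _; rewrite dotmC.
apply: le_trans (normr_dotm_le _ _) _.
by rewrite fnorm_orthol ?trmxK.
Qed.

(** * The diagonal matrix of squeezing parameters and its traces *)

Section DiagOp.
Variable R : realType.

Lemma diag_op m p (d : 'rV[R]_m) zm (X : 'M[R]_(m, p)) :
  (forall i, `|d 0 i| <= zm) -> 0 <= zm -> fnorm (diag_mx d *m X) <= zm * fnorm X.
Proof.
move=> dz z0; rewrite -(@ler_pXn2r _ 2) ?nnegrE ?mulr_ge0 ?fnorm_ge0//.
rewrite exprMn !fnorm_sqr !dotmE mulr_sumr; apply: ler_sum => i _.
rewrite mulr_sumr; apply: ler_sum => j _; rewrite mul_diag_mx !mxE.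
rewrite mulrACA -!expr2 ler_wpM2r ?sqr_ge0// -[leLHS]real_normK ?num_real//.
by rewrite lerXn2r ?nnegrE.
Qed.

Lemma diag_mx_sqrt m (d : 'rV[R]_m) : (forall i, 0 <= d 0 i) ->
  diag_mx (\row_i Num.sqrt (d 0 i)) *m (diag_mx (\row_i Num.sqrt (d 0 i)))^T = diag_mx d.
Proof.
move=> d0; rewrite tr_diag_mx mulmx_diag; congr diag_mx; apply/rowP => i.
by rewrite !mxE -expr2 sqr_sqrtr.
Qed.

Lemma vnormE n (v : 'cV[R]_n) : vnorm v = fnorm v.
Proof.
rewrite /vnorm /fnorm dotmE; congr Num.sqrt; apply: eq_bigr => i _.
by rewrite big_ord1 expr2.
Qed.

Lemma le_opnorm_Zmx n (z : 'I_n -> R) j : (forall i, 1 <= z i) -> z j <= opnorm (Zmx z).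
Proof.
move=> z1; have z0 i : 0 <= z i by apply: le_trans (z1 i).
pose e : 'cV[R]_n := delta_mx j 0.
have ev : vnorm e = 1.
  rewrite vnormE /fnorm dotmE (bigD1 j)//= [X in _ + X]big1 ?addr0.
    by rewrite big_ord1 mxE !eqxx mulr1 sqrtr1.
  by move=> i ij; rewrite big_ord1 mxE (negPf ij) mul0r.
have Ze : vnorm (Zmx z *m e) = z j.
  have -> : Zmx z *m e = z j *: e.
    apply/matrixP => i l; rewrite /Zmx mul_diag_mx !mxE.
    by have [->|] := eqVneq i j => //=; rewrite !mulr0.
  by rewrite vnormE fnormZ -vnormE ev mulr1 ger0_norm.
rewrite -[leLHS]Ze; apply: sup_upper_bound; last by exists e.
split; first by exists (z j); exists e.
(* The supremum dominates its elements only for a bounded set; a crude bound is enough. *)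
exists (\sum_i z i) => _ [v /= v1 <-]; rewrite vnormE.
have s0 : 0 <= \sum_i z i by apply: sumr_ge0.
apply: le_trans (diag_op (zm := \sum_i z i) _ _ _) _ => //.
  move=> i; rewrite mxE ger0_norm// (bigD1 i)//= lerDl; exact: sumr_ge0.
by rewrite -vnormE v1 mulr1.
Qed.

Variables (n : nat) (z : 'I_n -> R).
Hypothesis z1 : forall j, 1 <= z j.
Let z0 j : 0 < z j. Proof. by apply: lt_le_trans (z1 j). Qed.

Definition dvec : 'rV[R]_(n + n) := row_mx (\row_j z j) (\row_j (z j)^-1).

Lemma dvecE : block_mx (Zmx z) 0 0 (invmx (Zmx z)) = diag_mx dvec.
Proof.
rewrite /dvec diag_mx_row; congr block_mx.
have h : Zmx z *m diag_mx (\row_j (z j)^-1) = 1%:M.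
  rewrite /Zmx mulmx_diag; apply/matrixP => i j; rewrite !mxE.
  by have [->|] := eqVneq i j => //; rewrite divff ?gt_eqF.
have [zu _] := mulmx1_unit h.
by rewrite -[LHS]mulmx1 -h mulmxA mulVmx// mul1mx.
Qed.

Lemma dvec_bounds zm : (forall j, z j <= zm) -> forall i, 0 < dvec 0 i <= zm.
Proof.
move=> zz i; case: (split_ordP i) => j ->; rewrite /dvec ?row_mxEl ?row_mxEr mxE.
  by rewrite z0 zz.
rewrite invr_gt0 z0 (le_trans _ (zz j))// (le_trans _ (z1 j))//.
by rewrite invf_le1.
Qed.

Lemma McovE U : Mcov (Zmx z) U = Mg (diag_mx dvec) U.
Proof. by rewrite /Mcov dvecE. Qed.

Hypothesis n0 : (0 < n)%N.

Lemma tr_dvec : \tr (diag_mx dvec) = 2 * n%:R * avg_energy z.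
Proof.
have nR : 0 < n%:R :> R by rewrite ltr0n.
rewrite mxtrace_diag /avg_energy big_split_ord/= /dvec.
rewrite mulrA divff ?gt_eqF ?mulr_gt0// mul1r -big_split/=.
by apply: eq_bigr => i _; rewrite row_mxEl row_mxEr !mxE.
Qed.

Definition avg_sqr : R := (2 * n%:R)^-1 * \tr (diag_mx dvec *m diag_mx dvec).

Lemma tr_dvec2 : \tr (diag_mx dvec *m diag_mx dvec) = 2 * n%:R * avg_sqr.
Proof.
have nR : 0 < n%:R :> R by rewrite ltr0n.
by rewrite /avg_sqr mulrA divff ?mul1r// gt_eqF ?mulr_gt0.
Qed.

(** Bounding one of the two factors by [zm] and averaging the other keeps a single power of [zm];
    this is the [zeta] in the threshold for eps. *)
Lemma avg_sqr_le zm : (forall j, z j <= zm) -> avg_sqr <= zm * avg_energy z.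
Proof.
move=> zz; have nR : 0 < n%:R :> R by rewrite ltr0n.
have -> : avg_energy z = (2 * n%:R)^-1 * \tr (diag_mx dvec).
  by rewrite tr_dvec mulrA mulVf ?mul1r// gt_eqF ?mulr_gt0.
rewrite /avg_sqr mulrCA ler_wpM2l ?invr_ge0 ?mulr_ge0 ?(ltW nR)//.
rewrite mulmx_diag !mxtrace_diag mulr_sumr; apply: ler_sum => i _; rewrite mxE.
by have /andP[d0 dz] := dvec_bounds zz i; rewrite ler_wpM2r// ltW.
Qed.

Lemma avg_energy_le zm : (forall j, z j <= zm) -> avg_energy z <= zm.
Proof.
move=> zz; have nR : 0 < n%:R :> R by rewrite ltr0n.
have := tr_dvec; rewrite mxtrace_diag => E.
rewrite -(@ler_pM2l _ (2 * n%:R)) ?mulr_gt0// -E.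
apply: (@le_trans _ _ (\sum_(i < n + n) zm)).
  by apply: ler_sum => i _; have /andP[] := dvec_bounds zz i.
by rewrite sumr_const card_ord -[leLHS]mulr_natl natrD; lra.
Qed.

(** The Gram form on which existence of the symplectic eigenvalues and measurability of the entropy
    rest. *)
Lemma Mcov_sub_factor k (hk : (k <= n)%N) (U : 'M[R[i]]_n)
    (B := selmx R hk *m eta U *m diag_mx (\row_i Num.sqrt (dvec 0 i))) :
  Mcov_sub hk (Zmx z) U = B *m B^T.
Proof.
have e : diag_mx (\row_i Num.sqrt (dvec 0 i)) *m (diag_mx (\row_i Num.sqrt (dvec 0 i)))^T
    = diag_mx dvec.
  apply: diag_mx_sqrt => i; have zz j : z j <= \sum_i z i.
    by rewrite (bigD1 j)//= lerDl sumr_ge0// => l _; exact: ltW.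
  by have /andP[/ltW] := dvec_bounds zz i.
rewrite /Mcov_sub subcovE McovE /Mg /B !trmx_mul !mulmxA.
by rewrite -e !mulmxA.
Qed.

End DiagOp.

Lemma haar_prob_ge (R : realType) n (P : probability (cmxMeas R n) R)
    (A W : set (cmxMeas R n)) (p : R) : haar_prob P -> measurable A -> measurable W ->
  (forall U, unitary U -> ~ W U -> A U) -> (P W <= p%:E)%E -> ((1 - p)%:E <= P A)%E.
Proof.
move=> hP mA mW h PW.
have : (P (@Un R n) <= P A + P W)%E.
  apply: le_trans (measureU2 _ mA mW); apply: le_measure; rewrite ?inE.
  - exact: measurable_Un.
  - exact: measurableU.
  - by move=> U uU; have [?|nW] := pselect (W U); [right|left; exact: h].
rewrite (P_Un hP) => H; have {H} : (1 <= P A + p%:E)%E.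
  by apply: le_trans H _; rewrite leeD2l.
have /fineK <- := fin_num_measure P A mA.
by rewrite -EFinD !lee_fin lerBlDr.
Qed.

(** * Entropy deviation of the reduced state for a fixed number of modes *)

Section Reduced.
Variables (R : realType) (n : nat).
Hypothesis n0 : (0 < n)%N.
Local Notation T := (cmxMeas R n).
Variables (P : probability T R) (hP : haar_prob P).
Variables (z : 'I_n -> R) (zm Bd mu L : R) (k : nat) (hk : (k <= n)%N).
Hypotheses (z1 : forall j, 1 <= z j) (zz : forall j, z j <= zm).
Local Notation lam := (avg_energy z).
Hypotheses (lamB : lam <= Bd) (mu1 : 1 < mu) (lam_mu : mu <= lam).
Hypotheses (L0 : 0 < L) (GL : forall x l, 0 <= x -> mu <= l ->
  `|Gfun x - Gfun l| <= L * `|x - l|).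
Local Notation D := (diag_mx (dvec z)).
Local Notation S := (selmx R hk).
Local Notation X := (Xs D lam S).
Local Notation dev U := (`|k%:R * Gfun lam - entropy (Mcov_sub hk (Zmx z) U)|).
Let L1 : R := L * (2 * Bd + 2).
Let nR : 0 < n%:R :> R. Proof. by rewrite ltr0n. Qed.
Let lam1 : 1 <= lam. Proof. exact: le_trans (ltW mu1) lam_mu. Qed.
Let lamz : lam <= zm. Proof. exact: avg_energy_le. Qed.
Let zm0 : 0 < zm. Proof. by apply: lt_le_trans lamz; apply: lt_le_trans lam1. Qed.
Let sk0 : 0 <= Num.sqrt k%:R :> R. Proof. exact: sqrtr_ge0. Qed.

Lemma diag_dvec_op p (Y : 'M[R]_(n + n, p)) : fnorm (D *m Y) <= zm * fnorm Y.
Proof.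
apply: diag_op; last exact: ltW.
by move=> i; have /andP[d0 dz] := dvec_bounds z1 zz i; rewrite gtr0_norm.
Qed.

Lemma Mcov_subB (U : T) : Mcov_sub hk (Zmx z) U - lam%:M = X U.
Proof.
rewrite /Mcov_sub subcovE (McovE z1) /Xs mulmxBr mulmxBl; congr (_ - _).
by rewrite mul_mx_scalar -scalemxAl selmx_ortho scalemx1.
Qed.

Lemma Xs_op (U : T) p (Y : 'M[R]_(k + k, p)) : unitary U ->
  fnorm (X U *m Y) <= 2 * zm * fnorm Y.
Proof.
move=> uU; rewrite -Mcov_subB mulmxBl mul_scalar_mx.
apply: le_trans (fnormB _ _) _; rewrite fnormZ ger0_norm ?(le_trans _ lam1)//.
have h1 : fnorm (Mcov_sub hk (Zmx z) U *m Y) <= zm * fnorm Y.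
  rewrite /Mcov_sub subcovE (McovE z1).
  have -> : S *m Mg D U *m S^T *m Y = S *m (Mg D U *m (S^T *m Y)) by rewrite !mulmxA.
  apply: le_trans (fnorm_contract _ (selmx_ortho _ _)) _.
  apply: le_trans (Mg_op uU diag_dvec_op _) _.
  by rewrite fnorm_orthol// trmxK selmx_ortho.
have h2 : lam * fnorm Y <= zm * fnorm Y by rewrite ler_wpM2r ?fnorm_ge0.
lra.
Qed.

Lemma dev_op (U : T) e : (forall q (Y : 'M[R]_(k + k, q)), fnorm (X U *m Y) <= e * fnorm Y) ->
  dev U <= L * (Num.sqrt k%:R * ((2 * lam + e) * fnorm (X U))).
Proof.
move=> he; rewrite -Mcov_subB (Mcov_sub_factor z1).
apply: (entropy_deviation (ltW L0) lam1) => [x x0|q Y]; first exact: GL.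
by rewrite -(Mcov_sub_factor z1) Mcov_subB.
Qed.

Lemma dev_small (U : T) : fnorm (X U) <= 1 -> dev U <= L1 * Num.sqrt k%:R * fnorm (X U).
Proof.
move=> t1; apply: le_trans (dev_op (e := fnorm (X U)) (fun _ Y => fnormM _ Y)) _.
rewrite /L1 -!mulrA ler_wpM2l ?(ltW L0)// [leRHS]mulrCA ler_wpM2l//.
by rewrite ler_wpM2r ?fnorm_ge0//; move: lamB; lra.
Qed.

(** Taking the operator bound [2 zm] for [e] costs a factor [zm] but keeps the estimate linear in
    the Frobenius norm when the latter exceeds 1. *)
Lemma dev_large (U : T) : unitary U ->
  dev U <= L1 * Num.sqrt k%:R * (zm * fnorm (X U)).
Proof.
move=> uU; apply: le_trans (dev_op (e := 2 * zm) (fun _ Y => Xs_op Y uU)) _.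
rewrite /L1 -!mulrA ler_wpM2l ?(ltW L0)// [leRHS]mulrCA ler_wpM2l//.
rewrite [leRHS]mulrA ler_wpM2r ?fnorm_ge0//.
have : lam * 1 <= Bd * zm by apply: ler_pM => //; [exact: le_trans lam1|exact: le_trans lamz].
lra.
Qed.

(** Beyond this level the event is certain, so eps may be assumed smaller; that is what allows eps^2
    to be traded for powers of [n]. *)
Lemma dev_max (U : T) : unitary U -> dev U <= 4 * L1 * k%:R * zm ^+ 2.
Proof.
move=> uU; apply: (le_trans (dev_large uU)).
have Bd0 : 1 <= Bd := le_trans lam1 lamB.
have L10 : 0 <= L1 by rewrite /L1 mulr_ge0 ?(ltW L0)//; lra.
have t2 : fnorm (X U) <= 2 * zm * (2 * Num.sqrt k%:R).
  rewrite -[X in fnorm X]mulmx1; apply: le_trans (Xs_op _ uU) _.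
  rewrite ler_wpM2l ?mulr_ge0 ?(ltW zm0)// fnorm1.
  rewrite -(@ler_pXn2r _ 2) ?nnegrE ?mulr_ge0 ?sqrtr_ge0//.
  rewrite exprMn !sqr_sqrtr ?ler0n// natrD.
  have : 0 <= k%:R :> R by rewrite ler0n.
  lra.
have -> : 4 * L1 * k%:R * zm ^+ 2 =
    L1 * Num.sqrt k%:R * (zm * (2 * zm * (2 * Num.sqrt k%:R))).
  by rewrite -[in LHS](@sqr_sqrtr _ k%:R) ?ler0n//; ring.
by apply: ler_wpM2l; [exact: mulr_ge0|apply: ler_wpM2l => //; exact: ltW].
Qed.

Lemma measurable_dev eps : measurable [set U : T | (dev U <= eps)%R].
Proof.
have me : measurable_fun setT (fun U : T => entropy (Mcov_sub hk (Zmx z) U)).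
  under eq_fun do rewrite (Mcov_sub_factor z1).
  apply: measurable_entropy; apply: mxmeas_mul; last exact: mxmeas_cst.
  by apply: mxmeas_mul; [exact: mxmeas_cst|exact: mxmeas_eta].
have mf : measurable_fun setT (fun U : T => dev U).
  apply: measurableT_comp => //; apply: measurable_funB => //.
have -> : [set U : T | (dev U <= eps)%R] =
    setT `&` (fun U => dev U) @^-1` `]-oo, eps]%classic.
  by apply/seteqP; split => U /=; rewrite in_itv/=; [split|case].
by apply: mf => //; exact: measurable_itv.
Qed.

Lemma dev_sure eps : 4 * L1 * k%:R * zm ^+ 2 <= eps ->
  (1 <= P [set U : T | (dev U <= eps)%R])%E.
Proof.
move=> he; have := @haar_prob_ge R n P [set U : T | (dev U <= eps)%R] set0 0 hP.
rewrite subr0; apply => //; [exact: measurable_dev| |by rewrite measure0].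
by move=> U uU _ /=; apply: le_trans (dev_max uU) he.
Qed.

(** Thresholds for the Frobenius norm that force a deviation of at most eps, through [dev_small] or
    through [dev_large]. *)
Definition admissible t0 eps := 0 < t0 /\
  (t0 <= 1 /\ L1 * Num.sqrt k%:R * t0 <= eps \/ L1 * Num.sqrt k%:R * (zm * t0) <= eps).

Let adm_dev t0 eps (U : T) : admissible t0 eps -> unitary U ->
  ~ (t0 < fnorm (X U))%R -> dev U <= eps.
Proof.
have Bd0 : 1 <= Bd := le_trans lam1 lamB.
have L10 : 0 <= L1 * Num.sqrt k%:R by rewrite mulr_ge0// /L1 mulr_ge0 ?(ltW L0)//; lra.
move=> [t00 H] uU /negP; rewrite -leNgt => tt.
case: H => [[t1 he]|he].
  apply: le_trans (dev_small (le_trans tt t1)) _; apply: le_trans he.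
  by rewrite ler_wpM2l.
apply: le_trans (dev_large uU) _; apply: le_trans he.
by rewrite ler_wpM2l// ler_wpM2l// ltW.
Qed.

Lemma dev_chebyshev t0 eps : admissible t0 eps ->
  ((1 - 16 * k%:R ^+ 2 * zm * Bd / (n%:R * t0 ^+ 2))%:E <= P [set U : T | (dev U <= eps)%R])%E.
Proof.
move=> adm; have t00 := adm.1.
apply: (haar_prob_ge (W := [set U : T | (t0 < fnorm (X U))%R]) hP).
- exact: measurable_dev.
- exact: measurable_Xs_gt.
- by move=> U uU; exact: adm_dev.
apply: le_trans (Xs_chebyshev n0 hP (tr_diag_mx _) (tr_dvec z n0) (tr_dvec2 z n0)
  (selmx_ortho R hk) t00) _.
have sgz : avg_sqr z <= zm * Bd.
  by apply: le_trans (avg_sqr_le z1 n0 zz) _; rewrite ler_wpM2l// ltW.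
rewrite lee_fin natrD; have tt : 0 < t0 ^+ 2 by rewrite exprn_gt0.
have -> : (k%:R + k%:R) ^+ 2 * (4 * avg_sqr z / n%:R) / t0 ^+ 2 =
   16 * k%:R ^+ 2 / (n%:R * t0 ^+ 2) * avg_sqr z by field; rewrite !gt_eqF.
have -> : 16 * k%:R ^+ 2 * zm * Bd / (n%:R * t0 ^+ 2) =
   16 * k%:R ^+ 2 / (n%:R * t0 ^+ 2) * (zm * Bd) by field; rewrite !gt_eqF.
rewrite ler_wpM2l// divr_ge0// ?mulr_ge0 ?sqr_ge0// ltW//.
Qed.

(** The compression has size [q = 2 k], so [8 q^2] becomes [32 k^2]. *)
Lemma dev_tail t0 eps : admissible t0 eps ->
  ((1 - expR (32 * k%:R ^+ 2 - n%:R / (64 * zm ^+ 2) * t0 ^+ 2))%:E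
     <= P [set U : T | (dev U <= eps)%R])%E.
Proof.
move=> adm; have t00 := adm.1.
apply: (haar_prob_ge (W := [set U : T | (t0 < fnorm (X U))%R]) hP).
- exact: measurable_dev.
- exact: measurable_Xs_gt.
- by move=> U uU; exact: adm_dev.
apply: le_trans (Xs_tail n0 hP (tr_diag_mx _) (tr_dvec z n0) zm0 diag_dvec_op
  (selmx_ortho R hk) t00) _.
rewrite lee_fin ler_expR lerD2r natrD le_eqVlt; apply/orP; left; apply/eqP; ring.
Qed.

End Reduced.

(** * Rates *)

Section Powers.
Variable R : realType.

Lemma powR_expR (n : nat) (r : R) : (0 < n)%N -> n%:R `^ r = expR (r * ln n%:R).
Proof. by move=> n0; rewrite /powR gt_eqF// ltr0n. Qed.

Section PowersOfDimension.
Variables (zeta kappa : R) (n : nat).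
Hypotheses (hzeta : 0 <= zeta) (hkappa : 0 <= kappa).
Hypotheses (h1 : 8 * zeta + 3 * kappa < 1) (h2 : zeta + 3 * kappa < 1).
Hypothesis n0 : (0 < n)%N.
Local Notation N := (n%:R : R).
Local Notation a := (N `^ zeta).
Local Notation b := (N `^ kappa).
Local Notation l := (ln N).

Let N0 : 0 < N. Proof. by rewrite ltr0n. Qed.
Let l0 : 0 <= l. Proof. by rewrite ln_ge0// ler1n. Qed.
Let NE : N = expR l. Proof. by rewrite lnK. Qed.
Let aE m : a ^+ m = expR (m%:R * zeta * l).
Proof. by rewrite powR_expR// -expRM_natl mulrA. Qed.
Let bE m : b ^+ m = expR (m%:R * kappa * l).
Proof. by rewrite powR_expR// -expRM_natl mulrA. Qed.

Lemma powR_nat_ge1 (r : R) : 0 <= r -> 1 <= N `^ r.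
Proof. by move=> r0; rewrite powR_expR// -[leLHS]expR0 ler_expR mulr_ge0. Qed.

Lemma powR_rate : N `^ (1 - 8 * zeta - 3 * kappa) = N / (a ^+ 8 * b ^+ 3).
Proof.
rewrite aE bE powR_expR// [X in X / _]NE -expRD -expRN -expRD; congr expR; ring.
Qed.

Lemma powR_threshold : (N `^ ((zeta + 3 * kappa - 1) / 2)) ^+ 2 = a * b ^+ 3 / N.
Proof.
rewrite -[a in RHS]expr1 aE bE powR_expR// [X in _ = _ / X]NE -expRN -!expRD -expRM_natl.
by congr expR; field.
Qed.

Lemma powR_mul_le : a * b ^+ 3 <= N.
Proof.
rewrite -[leLHS]/(a * _) -[X in X * _]expr1 aE bE [leRHS]NE -expRD ler_expR.
by rewrite -mulrDl -[leRHS]mul1r ler_wpM2r// mul1r ltW.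
Qed.

Lemma powR_mul_le' : b * a ^+ 2 <= N.
Proof.
rewrite -[X in X * _]expr1 aE bE [leRHS]NE -expRD ler_expR.
rewrite -mulrDl -[leRHS]mul1r ler_wpM2r// mul1r; move: h1 hzeta hkappa; lra.
Qed.

(** The two conditions on the exponents imply [4 zeta + 2 kappa < 1], so the hypothesis can hold for
    finitely many [n] only. *)
Lemma nat_le_of_powR (C3 : R) : 0 < C3 -> N <= C3 * (a ^+ 4 * b ^+ 2) ->
  N <= 1 + expR (ln C3 / (1 - 4 * zeta - 2 * kappa)).
Proof.
move=> C30; have d0 : 0 < 1 - 4 * zeta - 2 * kappa by move: h1 h2 hzeta hkappa; lra.
move=> H; apply: (@le_trans _ _ (expR (ln C3 / (1 - 4 * zeta - 2 * kappa)))); last by rewrite lerDr.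
rewrite NE ler_expR ler_pdivlMr// -ler_expR lnK//.
move: H; rewrite aE bE -expRD -ler_pdivrMr ?expR_gt0// {1}NE -expRN -expRD.
by apply: le_trans; rewrite ler_expR le_eqVlt; apply/orP; left; apply/eqP; ring.
Qed.

End PowersOfDimension.

(** [X] is eps^2: one of its two factors is replaced by the a priori bound [V a^(8 - m) b^2]. Only
    half of the tail exponent is used, the other half being reserved for the entropy term; [m] is 2
    for [t <= 1] and 4 otherwise. *)
Lemma expo_split (c X N a b W V : R) m : (m <= 8)%N -> 0 < c -> 0 < X -> 0 < N ->
  1 <= a -> 1 <= b -> 0 < W -> X <= V * (a ^+ (8 - m) * b ^+ 2) -> c * (W * V) <= 2^-1 ->
  c * X ^+ 2 * (N / (a ^+ 8 * b ^+ 3)) <= N * X / (W * a ^+ m * b) / 2.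
Proof.
move=> m8 c0 X0 N0 a1 b1 W0 hX hc.
have a0 : 0 < a by apply: lt_le_trans a1.
have b0 : 0 < b by apply: lt_le_trans b1.
have -> : a ^+ 8 = a ^+ m * a ^+ (8 - m) by rewrite -exprD subnKC.
have A0 : 0 < a ^+ m by rewrite exprn_gt0.
have A0' : 0 < a ^+ (8 - m) by rewrite exprn_gt0.
move: (a ^+ m) (a ^+ (8 - m)) A0 A0' hX => A A' A0 A0' hX.
have -> : c * X ^+ 2 * (N / (A * A' * b ^+ 3)) =
    N * X / (W * A * b) * (c * W * X / (A' * b ^+ 2)) by field; rewrite !gt_eqF.
have e0 : 0 <= N * X / (W * A * b).
  by apply: divr_ge0; apply: mulr_ge0; rewrite ?mulr_ge0// ltW.
rewrite ler_wpM2l// ler_pdivrMr ?mulr_gt0 ?exprn_gt0//.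
apply: (@le_trans _ _ (c * W * (V * (A' * b ^+ 2)))).
  by rewrite ler_wpM2l// mulr_ge0// ltW.
rewrite mulrA ler_wpM2r//; first by rewrite mulr_ge0// ?exprn_ge0// ltW.
by rewrite -mulrA.
Qed.

(** For the range where the entropy term dominates: [N X] is then at most of order [a^2 b^3], and
    [a b^3 <= N] keeps the claimed exponent below 1/2, hence the allowed failure probability above
    1/2. *)
Lemma small_rate (c X N a b Q : R) : 0 < c -> 0 < X -> 0 < N -> 1 <= a -> 1 <= b ->
  a * b ^+ 3 <= N -> N * X <= Q * (a ^+ 2 * b ^+ 3) -> c * Q ^+ 2 <= 2^-1 ->
  c * X ^+ 2 * (N / (a ^+ 8 * b ^+ 3)) <= 2^-1.
Proof.
move=> c0 X0 N0 a1 b1 hN hX hc.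
have a0 : 0 < a by apply: lt_le_trans a1.
have b0 : 0 < b by apply: lt_le_trans b1.
apply: le_trans hc.
have -> : c * X ^+ 2 * (N / (a ^+ 8 * b ^+ 3)) = c * ((N * X) ^+ 2 / (N * (a ^+ 8 * b ^+ 3))).
  by field; rewrite !gt_eqF.
rewrite ler_wpM2l ?(ltW c0)// ler_pdivrMr ?mulr_gt0 ?exprn_gt0//.
apply: (@le_trans _ _ ((Q * (a ^+ 2 * b ^+ 3)) ^+ 2)).
  rewrite lerXn2r ?nnegrE ?(le_trans _ hX)// mulr_ge0// ltW//.
rewrite exprMn ler_wpM2l ?sqr_ge0//.
apply: (@le_trans _ _ (a ^+ 3 * (a * b ^+ 3) * b ^+ 3)).
  rewrite le_eqVlt; apply/orP; left; apply/eqP; ring.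
have -> : N * (a ^+ 8 * b ^+ 3) = a ^+ 3 * (a ^+ 5 * N) * b ^+ 3 by ring.
rewrite ler_wpM2r ?exprn_ge0 ?(ltW b0)// ler_wpM2l ?exprn_ge0 ?(ltW a0)//.
apply: (le_trans hN); rewrite ler_peMl ?(ltW N0)//; exact: exprn_ege1.
Qed.

End Powers.

Section Rates.
Variables (R : realType) (n : nat).
Hypothesis n0 : (0 < n)%N.
Local Notation T := (cmxMeas R n).
Local Notation N := (n%:R : R).
Variables (P : probability T R) (hP : haar_prob P).
Variables (z : 'I_n -> R) (a b C0 K Bd mu L : R) (k : nat) (hk : (k <= n)%N).
Hypotheses (z1 : forall j, 1 <= z j) (zz : forall j, z j <= C0 * a).
Hypotheses (lamB : avg_energy z <= Bd) (mu1 : 1 < mu) (lam_mu : mu <= avg_energy z).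
Hypotheses (L0 : 0 < L) (GL : forall x l, 0 <= x -> mu <= l ->
  `|Gfun x - Gfun l| <= L * `|x - l|).
Hypotheses (k0 : (0 < k)%N) (kK : k%:R <= K * b).
Hypotheses (C00 : 0 < C0) (K0 : 0 < K) (Bd0 : 0 < Bd) (a1 : 1 <= a) (b1 : 1 <= b).
Hypotheses (abN : a * b ^+ 3 <= N) (baN : b * a ^+ 2 <= N).
Variables (c C N1 L1 D1 : R).
Hypotheses (L1E : L1 = L * (2 * Bd + 2)) (D1E : D1 = 4 * L1 * K * C0 ^+ 2).
Hypotheses (c0 : 0 < c) (C1 : 1 <= C) (N1_1 : 1 <= N1).
Hypothesis hc1 : c * (64 * C0 ^+ 2 * L1 ^+ 2 * K * (L1 ^+ 2 * K)) <= 2^-1.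
Hypothesis hc2 : c * (64 * C0 ^+ 4 * L1 ^+ 2 * K * D1 ^+ 2) <= 2^-1.
Hypothesis hc3 : c * (64 ^+ 2 * K ^+ 3 * C0 ^+ 2 * L1 ^+ 2) ^+ 2 <= 2^-1.
Hypothesis hC1 : 32 * Bd * L1 ^+ 2 * K ^+ 3 * C0 <= C.
Hypothesis hC2 : D1 * N1 ^+ 2 <= C.
Hypothesis hN1 : N <= 64 ^+ 2 * C0 ^+ 4 * K ^+ 2 * (a ^+ 4 * b ^+ 2) -> N <= N1.
Local Notation zm := (C0 * a).
Local Notation dev U :=
  (`|k%:R * Gfun (avg_energy z) - entropy (Mcov_sub hk (Zmx z) U)|).

Let N0 : 0 < N. Proof. by rewrite ltr0n. Qed.
Let a0 : 0 < a. Proof. exact: lt_le_trans a1. Qed.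
Let b0 : 0 < b. Proof. exact: lt_le_trans b1. Qed.
Let kR : 0 < k%:R :> R. Proof. by rewrite ltr0n. Qed.
Let L10 : 0 < L1. Proof. by rewrite L1E mulr_gt0//; move: Bd0; lra. Qed.
Let D10 : 0 < D1. Proof. by rewrite D1E !mulr_gt0 ?exprn_gt0. Qed.

Let rate (e : R) : R := c * e ^+ 4 * (N / (a ^+ 8 * b ^+ 3)).

Let k_sqr_le : k%:R ^+ 2 <= (K * b) ^+ 2.
Proof. by rewrite lerXn2r ?nnegrE// ltW// mulr_gt0. Qed.

Lemma dev_prob_small eps : 0 < eps -> C ^+ 2 * (a * b ^+ 3) < N * eps ^+ 2 ->
  eps <= L1 * Num.sqrt k%:R ->
  ((1 - expR (- rate eps))%:E <= P [set U : T | (dev U <= eps)%R])%E.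
Proof.
move=> e0 hC hes; have sk : 0 < Num.sqrt k%:R :> R by rewrite sqrtr_gt0.
have Ls0 : 0 < L1 * Num.sqrt k%:R by rewrite mulr_gt0.
pose t0 := eps / (L1 * Num.sqrt k%:R).
have adm : admissible zm Bd L k t0 eps.
  rewrite /admissible -L1E; split; first by rewrite divr_gt0.
  by left; rewrite ler_pdivrMr// mul1r hes mulrC divfK ?gt_eqF.
have skE : Num.sqrt k%:R ^+ 2 = k%:R :> R by rewrite sqr_sqrtr// ltW.
have t02 : t0 ^+ 2 = eps ^+ 2 / (L1 ^+ 2 * k%:R) by rewrite expr_div_n exprMn skE.
have X0 : 0 < eps ^+ 2 by rewrite exprn_gt0.
have XV : eps ^+ 2 <= L1 ^+ 2 * k%:R.
  by rewrite -skE -exprMn lerXn2r ?nnegrE// ltW.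
have rE : rate eps = c * (eps ^+ 2) ^+ 2 * (N / (a ^+ 8 * b ^+ 3)) by rewrite /rate -exprM.
(* If the tail exponent is at least [64 k^2], half of it pays for [32 k^2] and the other half for
   the rate; otherwise [small_rate] and Chebyshev apply, the lower bound on eps making Chebyshev's
   bound at most 1/2. *)
case: (leP (64 * k%:R ^+ 2) (N * eps ^+ 2 / (64 * C0 ^+ 2 * L1 ^+ 2 * K * a ^+ 2 * b))) => hcase.
  apply: le_trans (dev_tail n0 hP hk z1 zz lamB mu1 lam_mu L0 GL adm).
  rewrite lee_fin lerD2l lerN2 ler_expR t02.
  have h1 : N * eps ^+ 2 / (64 * C0 ^+ 2 * L1 ^+ 2 * K * a ^+ 2 * b) <=
      N / (64 * zm ^+ 2) * (eps ^+ 2 / (L1 ^+ 2 * k%:R)).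
    have -> : N / (64 * zm ^+ 2) * (eps ^+ 2 / (L1 ^+ 2 * k%:R)) =
        N * eps ^+ 2 / (64 * C0 ^+ 2 * L1 ^+ 2 * a ^+ 2 * k%:R).
      by field; rewrite !gt_eqF.
    have -> : 64 * C0 ^+ 2 * L1 ^+ 2 * K * a ^+ 2 * b =
       64 * C0 ^+ 2 * L1 ^+ 2 * a ^+ 2 * (K * b) by ring.
    have q0 : 0 < 64 * C0 ^+ 2 * L1 ^+ 2 * a ^+ 2 by rewrite !mulr_gt0 ?exprn_gt0.
    apply: ler_wpM2l; first by rewrite mulr_ge0// ltW.
    rewrite lef_pV2 ?posrE ?(mulr_gt0 q0 kR) ?(mulr_gt0 q0 (mulr_gt0 K0 b0))//.
    by apply: ler_wpM2l => //; exact: ltW.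
  have h2 : rate eps <= N * eps ^+ 2 / (64 * C0 ^+ 2 * L1 ^+ 2 * K * a ^+ 2 * b) / 2.
    rewrite rE; apply: (expo_split (V := L1 ^+ 2 * K)) => //.
      by rewrite !mulr_gt0 ?exprn_gt0.
    apply: (le_trans XV); rewrite -mulrA; apply: ler_wpM2l; first exact: sqr_ge0.
    apply: (le_trans kK); apply: ler_wpM2l; first exact: ltW.
    rewrite expr2 mulrA ler_peMl ?(ltW b0)//.
    by apply: (le_trans b1); rewrite ler_peMl ?(ltW b0)// exprn_ege1.
  lra.
apply: le_trans (dev_chebyshev n0 hP hk z1 zz lamB mu1 lam_mu L0 GL adm).
rewrite lee_fin lerD2l lerN2.
have yl : rate eps <= 2^-1.
  rewrite rE; apply: small_rate abN _ hc3 => //.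
  have w0 : 0 < 64 * C0 ^+ 2 * L1 ^+ 2 * K * a ^+ 2 * b by rewrite !mulr_gt0 ?exprn_gt0.
  move: hcase; rewrite ltr_pdivrMr// => /ltW h; apply: (le_trans h).
  apply: (@le_trans _ _ (64 * (K * b) ^+ 2 * (64 * C0 ^+ 2 * L1 ^+ 2 * K * a ^+ 2 * b))).
    by rewrite ler_wpM2r ?(ltW w0)// ler_wpM2l.
  by rewrite le_eqVlt; apply/orP; left; apply/eqP; ring.
have ey : 2^-1 <= expR (- rate eps).
  apply: le_trans (expR_ge1Dx _); lra.
apply: le_trans ey; rewrite t02.
have -> : 16 * k%:R ^+ 2 * zm * Bd / (N * (eps ^+ 2 / (L1 ^+ 2 * k%:R))) =
    16 * k%:R ^+ 3 * zm * Bd * L1 ^+ 2 / (N * eps ^+ 2) by field; rewrite !gt_eqF.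
rewrite ler_pdivrMr ?mulr_gt0//.
have k3 : k%:R ^+ 3 <= (K * b) ^+ 3 by rewrite lerXn2r ?nnegrE// ltW// mulr_gt0.
have h1 : 32 * (zm * Bd * L1 ^+ 2) * k%:R ^+ 3 <= 32 * (zm * Bd * L1 ^+ 2) * (K * b) ^+ 3.
  by apply: ler_wpM2l => //; rewrite ltW// !mulr_gt0 ?exprn_gt0.
have h2 : 32 * (zm * Bd * L1 ^+ 2) * (K * b) ^+ 3 <= C ^+ 2 * (a * b ^+ 3).
  have -> : 32 * (zm * Bd * L1 ^+ 2) * (K * b) ^+ 3 =
     32 * Bd * L1 ^+ 2 * K ^+ 3 * C0 * (a * b ^+ 3) by ring.
  apply: ler_wpM2r; first by rewrite ltW// mulr_gt0// exprn_gt0.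
  by apply: (le_trans hC1); rewrite expr2 ler_peMl// (le_trans _ C1).
lra.
Qed.

(** Here eps exceeds a multiple of [sqrt k], so the tail exponent can fall below [64 k^2] only if
    [N <= N1]. Then eps is below [D1 N1], and [C >= D1 N1^2] contradicts the assumed lower bound on
    eps. *)
Lemma dev_prob_large eps : 0 < eps -> C ^+ 2 * (a * b ^+ 3) < N * eps ^+ 2 ->
  L1 * Num.sqrt k%:R < eps -> eps < 4 * L1 * k%:R * zm ^+ 2 ->
  ((1 - expR (- rate eps))%:E <= P [set U : T | (dev U <= eps)%R])%E.
Proof.
move=> e0 hC hes heD; have sk : 0 < Num.sqrt k%:R :> R by rewrite sqrtr_gt0.
have zm0 : 0 < zm by rewrite mulr_gt0.
have Ls0 : 0 < L1 * Num.sqrt k%:R by rewrite mulr_gt0.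
pose t0 := eps / (L1 * Num.sqrt k%:R * zm).
have adm : admissible zm Bd L k t0 eps.
  rewrite /admissible -L1E; split; first by rewrite divr_gt0// mulr_gt0.
  by right; rewrite mulrA mulrC divfK ?gt_eqF// mulr_gt0.
have skE : Num.sqrt k%:R ^+ 2 = k%:R :> R by rewrite sqr_sqrtr// ltW.
have t02 : t0 ^+ 2 = eps ^+ 2 / (L1 ^+ 2 * k%:R * zm ^+ 2).
  by rewrite expr_div_n !exprMn skE.
have X0 : 0 < eps ^+ 2 by rewrite exprn_gt0.
have eD : eps < D1 * (b * a ^+ 2).
  apply: (lt_le_trans heD).
  have -> : D1 * (b * a ^+ 2) = 4 * L1 * (K * b) * zm ^+ 2 by rewrite D1E; ring.
  apply: ler_wpM2r; first exact: sqr_ge0.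
  by apply: ler_wpM2l => //; rewrite mulr_ge0// ltW.
have XL : L1 ^+ 2 * k%:R < eps ^+ 2.
  by rewrite -skE -exprMn ltrXn2r// ?nnegrE// ltW.
have rE : rate eps = c * (eps ^+ 2) ^+ 2 * (N / (a ^+ 8 * b ^+ 3)) by rewrite /rate -exprM.
have w0 : 0 < 64 * C0 ^+ 4 * L1 ^+ 2 * K * a ^+ 4 * b by rewrite !mulr_gt0 ?exprn_gt0.
case: (leP (64 * k%:R ^+ 2) (N * eps ^+ 2 / (64 * C0 ^+ 4 * L1 ^+ 2 * K * a ^+ 4 * b))) => hcase.
  apply: le_trans (dev_tail n0 hP hk z1 zz lamB mu1 lam_mu L0 GL adm).
  rewrite lee_fin lerD2l lerN2 ler_expR t02.
  have h1 : N * eps ^+ 2 / (64 * C0 ^+ 4 * L1 ^+ 2 * K * a ^+ 4 * b) <=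
      N / (64 * zm ^+ 2) * (eps ^+ 2 / (L1 ^+ 2 * k%:R * zm ^+ 2)).
    have -> : N / (64 * zm ^+ 2) * (eps ^+ 2 / (L1 ^+ 2 * k%:R * zm ^+ 2)) =
        N * eps ^+ 2 / (64 * C0 ^+ 4 * L1 ^+ 2 * a ^+ 4 * k%:R).
      by field; rewrite !gt_eqF.
    have -> : 64 * C0 ^+ 4 * L1 ^+ 2 * K * a ^+ 4 * b =
       64 * C0 ^+ 4 * L1 ^+ 2 * a ^+ 4 * (K * b) by ring.
    have q0 : 0 < 64 * C0 ^+ 4 * L1 ^+ 2 * a ^+ 4 by rewrite !mulr_gt0 ?exprn_gt0.
    apply: ler_wpM2l; first by rewrite mulr_ge0// ltW.
    rewrite lef_pV2 ?posrE ?(mulr_gt0 q0 kR) ?(mulr_gt0 q0 (mulr_gt0 K0 b0))//.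
    by apply: ler_wpM2l => //; exact: ltW.
  have h2 : rate eps <= N * eps ^+ 2 / (64 * C0 ^+ 4 * L1 ^+ 2 * K * a ^+ 4 * b) / 2.
    rewrite rE; apply: (expo_split (V := D1 ^+ 2)) => //.
      by rewrite !mulr_gt0 ?exprn_gt0.
    have -> : D1 ^+ 2 * (a ^+ (8 - 4) * b ^+ 2) = (D1 * (b * a ^+ 2)) ^+ 2 by ring.
    by rewrite lerXn2r ?nnegrE ?(ltW e0) ?(ltW eD)// ltW// (lt_trans e0).
  lra.
exfalso; have NN1 : N <= N1.
  apply: hN1; move: hcase; rewrite ltr_pdivrMr// => h.
  have {}h : N * (L1 ^+ 2 * k%:R) < 64 * k%:R ^+ 2 * (64 * C0 ^+ 4 * L1 ^+ 2 * K * a ^+ 4 * b).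
    by apply: le_lt_trans h; rewrite ler_wpM2l ?ltW.
  have q0 : 0 < L1 ^+ 2 * k%:R by rewrite mulr_gt0 ?exprn_gt0.
  rewrite -(ler_pM2r q0); apply: (le_trans (ltW h)).
  have -> : 64 * k%:R ^+ 2 * (64 * C0 ^+ 4 * L1 ^+ 2 * K * a ^+ 4 * b) =
    64 ^+ 2 * C0 ^+ 4 * K * a ^+ 4 * b * (L1 ^+ 2 * k%:R) * k%:R by ring.
  have -> : 64 ^+ 2 * C0 ^+ 4 * K ^+ 2 * (a ^+ 4 * b ^+ 2) * (L1 ^+ 2 * k%:R) =
    64 ^+ 2 * C0 ^+ 4 * K * a ^+ 4 * b * (L1 ^+ 2 * k%:R) * (K * b) by ring.
  by apply: ler_wpM2l => //; rewrite ltW// !mulr_gt0 ?exprn_gt0.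
have h1 : eps < D1 * N1.
  apply: (lt_le_trans eD); apply: ler_wpM2l; first exact: ltW.
  exact: le_trans baN NN1.
have N10 : 0 < N1 by apply: lt_le_trans N1_1.
have h2 : N * eps ^+ 2 <= N1 * (D1 * N1) ^+ 2.
  apply: ler_pM => //; first exact: ltW.
  by rewrite lerXn2r ?nnegrE ?(ltW e0) ?(ltW h1)// ltW// mulr_gt0.
have h3 : (D1 * N1 ^+ 2) ^+ 2 <= C ^+ 2.
  by rewrite lerXn2r ?nnegrE// ltW ?(lt_le_trans _ C1)// mulr_gt0// exprn_gt0.
have h4 : C ^+ 2 * 1 <= C ^+ 2 * (a * b ^+ 3).
  apply: ler_wpM2l; first exact: sqr_ge0.
  by rewrite -[leLHS]mul1r; apply: ler_pM => //; exact: exprn_ege1.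
have h5 : N1 * (D1 * N1) ^+ 2 <= (D1 * N1 ^+ 2) ^+ 2.
  have -> : (D1 * N1 ^+ 2) ^+ 2 = N1 * (N1 * (D1 * N1) ^+ 2) by ring.
  by rewrite ler_peMl// mulr_ge0 ?sqr_ge0// ltW.
move: hC h2 h3 h4 h5; lra.
Qed.

Lemma dev_prob eps : 0 < eps -> C ^+ 2 * (a * b ^+ 3) < N * eps ^+ 2 ->
  ((1 - expR (- rate eps))%:E <= P [set U : T | (dev U <= eps)%R])%E.
Proof.
move=> e0 hC; case: (leP (4 * L1 * k%:R * zm ^+ 2) eps) => h.
  rewrite L1E in h.
  apply: le_trans (dev_sure n0 hP hk z1 zz lamB mu1 lam_mu L0 GL h).
  by rewrite lee_fin gerBl expR_ge0.
case: (leP eps (L1 * Num.sqrt k%:R)) => h'; first exact: dev_prob_small.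
exact: dev_prob_large.
Qed.

End Rates.

(** * Uniform constants and conclusion *)

Lemma ler_eventually_const (R : realType) (F G : nat -> R) :
  (forall n, (0 < n)%N -> 1 <= G n) ->
  (exists2 C : R, 0 < C & exists N : nat, forall n : nat, (N <= n)%N -> F n <= C * G n) ->
  exists2 C : R, 0 < C & forall n, (0 < n)%N -> F n <= C * G n.
Proof.
move=> G1 [C C0 [N hN]]; pose S := \sum_(m < N) `|F m|.
have S0 : 0 <= S by apply: sumr_ge0.
exists (C + S); first exact: ltr_wpDr.
move=> n n0; have g1 := G1 n n0; have g0 : 0 <= G n by apply: le_trans g1.
case: (leqP N n) => [Nn|nN].
  by apply: le_trans (hN n Nn) _; rewrite ler_wpM2r// lerDl.
apply: (@le_trans _ _ S).
  apply: le_trans (ler_norm _) _.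
  by rewrite /S (bigD1 (Ordinal nN))//= lerDl sumr_ge0.
by rewrite mulrDl ler_wpDl ?mulr_ge0 ?(ltW C0)// ler_peMr.
Qed.

Theorem theorem3 (R : realType) (zeta kappa mu : R)
  (z : forall n : nat, 'I_n -> R) (k : nat -> nat)
  (hzeta : 0 <= zeta) (hkappa : 0 <= kappa)
  (h1 : 8 * zeta + 3 * kappa < 1) (h2 : zeta + 3 * kappa < 1)
  (hz1 : forall n (j : 'I_n), 1 <= z n j)
  (hsq : exists2 C : R, 0 < C & exists N : nat, forall n : nat, (N <= n)%N ->
           opnorm (Zmx (z n)) <= C * (n%:R `^ zeta))
  (hbdd : exists B : R, forall n : nat, (0 < n)%N -> avg_energy (z n) <= B)
  (hmu : 1 < mu) (hmu_le : forall n : nat, (0 < n)%N -> mu <= avg_energy (z n))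
  (hk1 : forall n : nat, (0 < n)%N -> (0 < k n)%N)
  (hkn : forall n : nat, (k n <= n)%N)
  (hkbd : exists2 K : R, 0 < K & exists N : nat, forall n : nat, (N <= n)%N ->
           (k n)%:R <= K * (n%:R `^ kappa)) :
  exists2 C : R, 0 < C & exists2 c : R, 0 < c &
    forall (n : nat), (0 < n)%N ->
    forall P : probability (cmxMeas R n) R, haar_prob P ->
    forall eps : R, 0 < eps ->
      C * beta mu * (n%:R `^ ((zeta + 3 * kappa - 1) / 2)) < eps ->
      ((1 - expR (- c * (eps ^+ 4 / beta mu ^+ 4)
                    * n%:R `^ (1 - 8 * zeta - 3 * kappa)))%:E
        <= P [set U : cmxMeas R n |
                (`| (k n)%:R * Gfun (avg_energy (z n))
                   - entropy (Mcov_sub (hkn n) (Zmx (z n)) U) | <= eps)%R])%E.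
Proof.
have G1 r : 0 <= r -> forall n, (0 < n)%N -> 1 <= (n%:R : R) `^ r.
  by move=> r0 n n0; exact: powR_nat_ge1.
have [C0 C00 hz] := ler_eventually_const (G1 _ hzeta) hsq.
have [K K0 hk] := ler_eventually_const (G1 _ hkappa) hkbd.
have {}hz n (n0 : (0 < n)%N) j : z n j <= C0 * (n%:R `^ zeta).
  exact: le_trans (le_opnorm_Zmx j (hz1 n)) (hz n n0).
have [Bd hBd] := hbdd.
have Bd0 : 0 < Bd.
  by apply: lt_le_trans (hBd 1%N isT); apply: lt_le_trans (hmu_le 1%N isT); lra.
have [L L0 GL] := Gfun_lip hmu.
pose L1 := L * (2 * Bd + 2); pose D1 := 4 * L1 * K * C0 ^+ 2.
have L10 : 0 < L1 by rewrite mulr_gt0//; lra.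
have L1E : L1 = L * (2 * Bd + 2) by []; clearbody L1.
have D1E : D1 = 4 * L1 * K * C0 ^+ 2 by []; clearbody D1.
have D10 : 0 < D1 by rewrite D1E !mulr_gt0 ?exprn_gt0.
pose A1 := 64 * C0 ^+ 2 * L1 ^+ 2 * K * (L1 ^+ 2 * K).
pose A2 := 64 * C0 ^+ 4 * L1 ^+ 2 * K * D1 ^+ 2.
pose A3 := (64 ^+ 2 * K ^+ 3 * C0 ^+ 2 * L1 ^+ 2) ^+ 2.
pose N1 := 1 + expR (ln (64 ^+ 2 * C0 ^+ 4 * K ^+ 2) / (1 - 4 * zeta - 2 * kappa)).
pose C' := 1 + (32 * Bd * L1 ^+ 2 * K ^+ 3 * C0 + D1 * N1 ^+ 2).
have A10 : 0 < A1 by rewrite !mulr_gt0 ?exprn_gt0.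
have A20 : 0 < A2 by rewrite !mulr_gt0 ?exprn_gt0.
have A30 : 0 < A3 by rewrite exprn_gt0// !mulr_gt0 ?exprn_gt0.
have N11 : 1 <= N1 by rewrite lerDl expR_ge0.
(* [A1] and [A2] stem from the tail comparison for small and large eps, [A3] from the Chebyshev
   case; one [c'] meets all three requirements. *)
pose A := A1 + A2 + A3; pose c' := (2 * A)^-1.
have A0 : 0 < A by rewrite !addr_gt0.
have c'0 : 0 < c' by rewrite invr_gt0 mulr_gt0.
have hc B : B <= A -> c' * B <= 2^-1.
  move=> BA; rewrite mulrC ler_pdivrMr ?mulr_gt0//; lra.
have E1 : 0 <= 32 * Bd * L1 ^+ 2 * K ^+ 3 * C0.
  by rewrite ltW// !mulr_gt0 ?exprn_gt0.
have E2 : 0 <= D1 * N1 ^+ 2 by rewrite mulr_ge0 ?sqr_ge0// ltW.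
have C'1 : 1 <= C' by rewrite lerDl addr_ge0.
have be0 : 0 < beta mu by rewrite ln_gt0// ltr_pdivlMr; lra.
(* The constants may depend on [mu], so they are scaled to cancel [beta mu] in the threshold and in
   the rate. *)
exists (C' / beta mu); first by rewrite divr_gt0// (lt_le_trans _ C'1).
exists (c' * beta mu ^+ 4); first by rewrite mulr_gt0// exprn_gt0.
move=> n n0 P hP eps eps0; rewrite divfK ?gt_eqF// => hC.
have nR : 0 < n%:R :> R by rewrite ltr0n.
have -> : - (c' * beta mu ^+ 4) * (eps ^+ 4 / beta mu ^+ 4)
       * n%:R `^ (1 - 8 * zeta - 3 * kappa) =
     - (c' * eps ^+ 4 * (n%:R / ((n%:R `^ zeta) ^+ 8 * (n%:R `^ kappa) ^+ 3))).
  by rewrite powR_rate// !mulNr; congr (- (_ * _)); field; rewrite gt_eqF.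
apply: (@dev_prob R n n0 P hP (z n) _ _ C0 K Bd mu L (k n) (hkn n) (hz1 n) (hz n n0)
  (hBd n n0) hmu (hmu_le n n0) L0 GL (hk1 n n0) (hk n n0) C00 K0 Bd0 (G1 _ hzeta n n0)
  (G1 _ hkappa n n0) _ _ c' C' N1 L1 D1) => //.
- exact: powR_mul_le.
- exact: powR_mul_le'.
- by apply: hc; rewrite /A -/A1; lra.
- by apply: hc; rewrite /A -/A2; lra.
- by apply: hc; rewrite /A -/A3; lra.
- by rewrite /C'; lra.
- by rewrite /C'; lra.
- by apply: nat_le_of_powR => //; rewrite !mulr_gt0 ?exprn_gt0.
have C'0 : 0 <= C' by apply: le_trans C'1.
have w0 : 0 <= (n%:R : R) `^ ((zeta + 3 * kappa - 1) / 2) by exact: powR_ge0.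
have : (C' * n%:R `^ ((zeta + 3 * kappa - 1) / 2)) ^+ 2 < eps ^+ 2.
  by rewrite ltrXn2r// ?nnegrE ?mulr_ge0// ltW.
by rewrite exprMn powR_threshold// [C' ^+ 2 * (_ / _)]mulrA ltr_pdivrMr// [eps ^+ 2 * _]mulrC.
Qed.
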